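(* Let $D_1$ and $D_2$ be even unital matroid algebras and let $\pi:D_1\oplus D_2\to D$ be a generic index 4 inclusion with $H_1(\pi)\ne0$. Then $Out_{D_1\oplus D_2}(D)$ is equal to $Aut(H_1(\pi))$ if $\kappa(\pi)=0$, and is equal to $\mathbb Z_2$ otherwise.
   Context: All algebras are complex; direct limits here are algebraic. A matroid algebra is a complex $*$-algebra which is the union of a chain of $*$-subalgebras each of which is a full matrix algebra; a unital one is even if its generalised integer has the form $2^\infty p$. 4-cycle algebras. For positive integers $n_1,\dots,n_4$ with $r=\sum n_i$, the 4-cycle algebra with these block sizes is the algebra $A\subseteq M_r(\mathbb C)$ of block matrices $(a_{ij})$, $a_{ij}\in M_{n_i,n_j}(\mathbb C)$, with $a_{ij}=0$ unless $i=j$ or ($i\in\{1,2\}$, $j\in\{3,4\}$). $Q_1,\dots,Q_4$ denote the block projections. $C^*(A)=M_r(\mathbb C)$. An embedding (injective homomorphism) $\phi:A\to A'$ is star extendible if it extends to a $*$-homomorphism $C^*(A)\to C^*(A')$; its multiplicity is that of the extension. A multiplicity one star extendible embedding is rigid of type $\theta$ if $\theta$ is a permutation of $\{1,2,3,4\}$ preserving $\{1,2\}$ and $\{3,4\}$ and $\phi(Q_iAQ_j)\subseteq Q'_{\theta(i)}A'Q'_{\theta(j)}$ for all $i,j$ (four types: $\mathrm{id},(12),(34),(12)(34)$). A rigid embedding is a direct sum of multiplicity one rigid embeddings (with mutually orthogonal ranges); it is generic if all four types occur. $H_1$ of a 4-cycle algebra is $\mathbb Z$, and for $\phi$ rigid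 $H_1(\phi)=[\delta]$ is multiplication by $\delta$ = (number of summands of type $\mathrm{id}$ or $(12)(34)$) minus (number of type $(12)$ or $(34)$). A generic system is a direct system $(A_k,\alpha_k)$ of 4-cycle algebras with all $\alpha_k$ generic; $A$ denotes its algebraic direct limit, and $B$ the self-adjoint algebra generated by $A$ (the limit of the $C^*(A_k)$). An inclusion $\pi:D_1\oplus D_2\to D$ of matroid algebras is a generic index 4 inclusion if it is conjugate by a star isomorphism to an inclusion $A\cap A^*\to B$ of this form ($D_1$ from blocks 1,2 and $D_2$ from blocks 3,4); $A$ is then the associated limit algebra. $H_1(\pi)=H_1(A)=\varinjlim(H_1(A_k),H_1(\alpha_k))$, and $Aut(H_1(\pi))$ is the automorphism group of this abelian group. With $p_k$ the multiplicity of $\alpha_k$ and $H_1(\alpha_k)=[\delta_k]$, the coupling invariant $\kappa(\pi)$ is the class determined by any of the products $\prod_{k=l}^\infty |\delta_k|/p_k$ for suitably large $l$; $\kappa(\pi)=0$ means that these products are $0$ for all sufficiently large $l$. $Out_{D_1\oplus D_2}(D)$ is the group of automorphisms of $D$ which leave invariant the subalgebra $D_1\oplus D_2$ (respecting the ordered pair of summands), modulo those automorphisms whose restriction to $D_1\oplus D_2$ is an approximately inner automorphism of $D_1\oplus D_2$. Here an automorphism is approximately inner if it is a pointwise limit of a sequence of inner unitary automorphisms.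
   Formalization: The quotient is taken by automorphisms of D that are pointwise limits on all of D of inner automorphisms by unitaries of D_1⊕D_2; dividing by those whose restriction to D_1⊕D_2 is approximately inner would always give the trivial group, making the claim false. *)

(* Defs.v *)
From HB Require Import structures.
From mathcomp Require Import all_boot all_order all_algebra perm spectral.
From mathcomp Require Import all_classical all_reals.
From mathcomp Require Import ereal topology normedtype sequences.
From mathcomp.real_closed Require Import complex.
Import Order.TTheory GRing.Theory Num.Theory numFieldNormedType.Exports.

Set Implicit Arguments.
Unset Strict Implicit.
Unset Printing Implicit Defensive.

Local Open Scope classical_set_scope.
Local Open Scope ring_scope.
Local Open Scope quotient_scope.
Local Open Scope sesquilinear_scope.

(** * Groups of bijections, quotient groups *)

Record bijection (T : Type) := Bijection {
  bfun :> T -> T;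
  binv : T -> T;
  bfunK : cancel bfun binv;
  binvK : cancel binv bfun }.

HB.instance Definition _ T := gen_eqMixin (bijection T).
HB.instance Definition _ T := gen_choiceMixin (bijection T).

Section BijectionGroup.
Variable T : Type.
Implicit Types f g : bijection T.

Lemma bijection_ext f g : (forall x, f x = g x) -> f = g.
Proof.
case: f g => [f fi fK fiK] [g gi gK giK] /= /funext fg; subst g.
have e : fi = gi by apply/funext => x; rewrite -{1}(giK x) fK.
by subst gi; congr Bijection; exact: Prop_irrelevance.
Qed.

Definition bij_id : bijection T := @Bijection T id id (fun=> erefl) (fun=> erefl).
Definition bij_inv f := Bijection (@binvK T f) (@bfunK T f).
Definition bij_comp f g :=
  Bijection (can_comp (@bfunK T f) (@bfunK T g))
            (can_comp (@binvK T g) (@binvK T f)).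

Fact bij_compA : associative bij_comp.
Proof. by move=> f g h; apply: bijection_ext. Qed.
Fact bij_comp1g : left_id bij_id bij_comp.
Proof. by move=> f; apply: bijection_ext. Qed.
Fact bij_compg1 : right_id bij_id bij_comp.
Proof. by move=> f; apply: bijection_ext. Qed.
Fact bij_compVg : left_inverse bij_id bij_inv bij_comp.
Proof. by move=> f; apply: bijection_ext => x /=; rewrite bfunK. Qed.
Fact bij_compgV : right_inverse bij_id bij_inv bij_comp.
Proof. by move=> f; apply: bijection_ext => x /=; rewrite binvK. Qed.

HB.instance Definition _ := isGroup.Build (bijection T)
  bij_compA bij_comp1g bij_compg1 bij_compVg bij_compgV.

End BijectionGroup.

Record normalSubgroup (G : groupType) := NormalSubgroup {
  nsg_set : G -> Prop;
  nsg1 : nsg_set 1%g;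
  nsgM : forall x y, nsg_set x -> nsg_set y -> nsg_set (x * y)%g;
  nsgV : forall x, nsg_set x -> nsg_set (x^-1)%g;
  nsgJ : forall x g, nsg_set x -> nsg_set (g * x * g^-1)%g }.

Section QuotientGroup.
Variables (G : groupType) (N : normalSubgroup G).

Definition coset_rel (x y : G) : bool := `[< nsg_set N (x^-1 * y)%g >].

Fact coset_rel_refl : reflexive coset_rel.
Proof. by move=> x; apply/asboolP; rewrite mulVg; exact: nsg1. Qed.
Fact coset_rel_sym : symmetric coset_rel.
Proof.
by move=> x y; apply/asboolP/asboolP => /nsgV; rewrite invgM invgK.
Qed.
Fact coset_rel_trans : transitive coset_rel.
Proof.
move=> y x z /asboolP xy /asboolP yz; apply/asboolP.
by move: (nsgM xy yz); rewrite -mulgA mulVKg.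
Qed.

Canonical coset_equiv :=
  EquivRel coset_rel coset_rel_refl coset_rel_sym coset_rel_trans.

Definition quotientGroup := {eq_quot coset_equiv}%qT.
HB.instance Definition _ := Choice.on quotientGroup.

Definition quot_one : quotientGroup := \pi_(quotientGroup) 1%g.
Definition quot_inv (a : quotientGroup) : quotientGroup :=
  \pi_(quotientGroup) ((repr a)^-1)%g.
Definition quot_mul (a b : quotientGroup) : quotientGroup :=
  \pi_(quotientGroup) (repr a * repr b)%g.

Fact quot_eq x y : \pi_(quotientGroup) x = \pi_(quotientGroup) y <-> nsg_set N (x^-1 * y)%g.
Proof.
split=> [/eqquotP /asboolP //|h].
by apply/eqquotP; apply/asboolP.
Qed.

Fact repr_coset x : nsg_set N (x^-1 * repr (\pi_(quotientGroup) x))%g.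
Proof. by apply/quot_eq; rewrite reprK. Qed.

Fact quot_mulE x y :
  quot_mul (\pi_(quotientGroup) x) (\pi_(quotientGroup) y) = \pi_(quotientGroup) (x * y)%g.
Proof.
apply/esym/quot_eq.
set x' := repr _; set y' := repr _.
have hx : nsg_set N (x^-1 * x')%g by exact: repr_coset.
have hy : nsg_set N (y^-1 * y')%g by exact: repr_coset.
have -> : ((x * y)^-1 * (x' * y') =
   (y^-1 * (x^-1 * x') * y^-1^-1) * (y^-1 * y'))%g.
  by rewrite invgM invgK !mulgA mulgK.
by apply: nsgM => //; exact: nsgJ.
Qed.

Fact quot_invE x :
  quot_inv (\pi_(quotientGroup) x) = \pi_(quotientGroup) (x^-1)%g.
Proof.
apply/quot_eq; set x' := repr _; rewrite invgK.
have hx : nsg_set N (x^-1 * x')%g by exact: repr_coset.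
have := nsgJ x' hx.
by rewrite !mulgA mulgK.
Qed.

Fact quot_surj (a : quotientGroup) : exists x, a = \pi_(quotientGroup) x.
Proof. by exists (repr a); rewrite reprK. Qed.

Fact quot_mulA : associative quot_mul.
Proof.
move=> a b c; have [x ->] := quot_surj a; have [y ->] := quot_surj b.
by have [z ->] := quot_surj c; rewrite !quot_mulE mulgA.
Qed.
Fact quot_mul1g : left_id quot_one quot_mul.
Proof. by move=> a; have [x ->] := quot_surj a; rewrite quot_mulE mul1g. Qed.
Fact quot_mulg1 : right_id quot_one quot_mul.
Proof. by move=> a; have [x ->] := quot_surj a; rewrite quot_mulE mulg1. Qed.
Fact quot_mulVg : left_inverse quot_one quot_inv quot_mul.
Proof.
by move=> a; have [x ->] := quot_surj a; rewrite quot_invE quot_mulE mulVg.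
Qed.
Fact quot_mulgV : right_inverse quot_one quot_inv quot_mul.
Proof.
by move=> a; have [x ->] := quot_surj a; rewrite quot_invE quot_mulE mulgV.
Qed.

HB.instance Definition _ := isGroup.Build quotientGroup
  quot_mulA quot_mul1g quot_mulg1 quot_mulVg quot_mulgV.

End QuotientGroup.

Definition group_isomorphic (G H : groupType) : Prop :=
  exists f : {multiplicative G -> H}, bijective f.

Section ZmodAutomorphisms.
Variable H : zmodType.

Definition zmod_aut_pred : {pred bijection H} :=
  fun f => `[< {morph f : x y / x + y} >].

Fact zmod_aut_closed : group_closed zmod_aut_pred.
Proof.
split; first exact/asboolP.
move=> f g /asboolP fD /asboolP gD; apply/asboolP => x y /=.
rewrite -fD; congr (f _); apply: (can_inj (@bfunK _ g)).
by rewrite gD !binvK.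
Qed.

Definition zmodAut := {f : bijection H | f \in zmod_aut_pred}.
HB.instance Definition _ := SubChoice.on zmodAut.
HB.instance Definition _ :=
  SubChoice_isSubGroup.Build _ _ zmodAut zmod_aut_closed.

End ZmodAutomorphisms.

(** * Complex *-algebras *)

HB.mixin Record isStarAlgebra (C : numClosedFieldType) A of GRing.Algebra C A := {
  star : A -> A;
  starK : involutive star;
  starD : {morph star : x y / x + y};
  starM : forall x y : A, star (x * y) = star y * star x;
  starZ : forall (a : C) x, star (a *: x) = a^* *: star x }.

#[short(type="starAlgType")]
HB.structure Definition StarAlgebra (C : numClosedFieldType) :=
  { A of GRing.Algebra C A & isStarAlgebra C A }.

Section ProductStar.
Variables (C : numClosedFieldType) (A B : starAlgType C).

Definition pstar (x : A * B) : A * B := (star x.1, star x.2).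

Fact pstarK : involutive pstar.
Proof. by case=> x y; rewrite /pstar /= !starK. Qed.
Fact pstarD : {morph pstar : x y / x + y}.
Proof. by case=> x y [x' y']; rewrite /pstar /= !starD. Qed.
Fact pstarM (x y : A * B) : pstar (x * y) = pstar y * pstar x.
Proof. by case: x y => x y [x' y']; rewrite /pstar /= !starM. Qed.
Fact pstarZ (a : C) (x : A * B) : pstar (a *: x) = a^* *: pstar x.
Proof. by case: x => x y; rewrite /pstar /= !starZ. Qed.
HB.instance Definition _ := isStarAlgebra.Build C (A * B)%type
  pstarK pstarD pstarM pstarZ.

End ProductStar.

(* Star homomorphisms are not required to be unital.  As ['M[C]_n] is an algebra
   of the library only for [n] a successor, the products and involutions are
   explicit parameters of the general definition. *)
Definition star_hom_for (C : numClosedFieldType) (A B : lmodType C)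
    (mulA : A -> A -> A) (starA : A -> A) (mulB : B -> B -> B) (starB : B -> B)
    (f : A -> B) : Prop :=
  [/\ linear f, forall x y, f (mulA x y) = mulB (f x) (f y) &
      forall x, f (starA x) = starB (f x)].

Definition star_hom (C : numClosedFieldType) (A B : starAlgType C) (f : A -> B) :=
  star_hom_for *%R star *%R star f.

Definition mxstar (C : numClosedFieldType) (n : nat) (a : 'M[C]_n) : 'M[C]_n :=
  a ^t*.

Definition mx_star_hom (C : numClosedFieldType) (n : nat) (D : starAlgType C)
    (f : 'M[C]_n -> D) :=
  star_hom_for mulmx (@mxstar C n) *%R star f.

Definition mx_mx_star_hom (C : numClosedFieldType) (n n' : nat)
    (f : 'M[C]_n -> 'M[C]_n') :=
  star_hom_for mulmx (@mxstar C n) mulmx (@mxstar C n') f.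

(* An inclusion with the presentation [generic_index4] below is automatically
   unital. *)
Record star_inclusion (C : numClosedFieldType) (A B : starAlgType C) :=
  StarInclusion {
    incl :> A -> B;
    incl_hom : star_hom incl;
    incl1 : incl 1 = 1;
    incl_inj : injective incl }.

Definition unitary (C : numClosedFieldType) (A : starAlgType C) (u : A) : Prop :=
  star u * u = 1 /\ u * star u = 1.

(** * Matroid algebras *)

Definition full_matrix_subalgebra (C : numClosedFieldType) (D : starAlgType C)
    (S : set D) : Prop :=
  exists (n : nat) (f : 'M[C]_n -> D),
    [/\ (0 < n)%N, mx_star_hom f, injective f & range f = S].

Definition matroid (C : numClosedFieldType) (D : starAlgType C) : Prop :=
  exists F : set (set D),
    [/\ forall S, F S -> full_matrix_subalgebra S,
        total_on F subset & \bigcup_(S in F) S = setT].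

(* The generalised integer (supernatural number) of a unital matroid algebra is
   the least common multiple of the sizes of its unital full matrix subalgebras,
   represented by its exponent at each prime [q]. *)
Definition unital_matrix_size (C : numClosedFieldType) (D : starAlgType C)
    (n : nat) : Prop :=
  exists f : 'M[C]_n -> D,
    [/\ (0 < n)%N, mx_star_hom f, injective f & f 1%:M = 1].

Definition generalised_integer (R : realType) (C : numClosedFieldType)
    (D : starAlgType C) (q : nat) : \bar R :=
  ereal_sup [set ((logn q n)%:R)%:E | n in @unital_matrix_size C D].

Definition even_matroid (R : realType) (D : starAlgType R[i]) : Prop :=
  matroid D /\ generalised_integer R D 2 = +oo%E.

(** * 4-cycle algebras *)

(* Blocks are indexed from 0: the blocks 1, 2, 3, 4 are [0, 1, 2, 3 : 'I_4], and
   [t12], [t34] below are the transpositions (12) and (34) in the usual 1-based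
   numbering. *)
Definition block12 (i : 'I_4) : bool := (i < 2)%N.
Definition block34 (i : 'I_4) : bool := (2 <= i)%N.

Section FourCycle.
Variable C : numClosedFieldType.

(* C*(A) for A = [cycle_algebra n] *)
Definition ambient (n : 'I_4 -> nat) := 'M[C]_(\sum_i n i).

Definition cycle_algebra (n : 'I_4 -> nat) : set (ambient n) :=
  [set a | forall i j, ~~ ((i == j) || (block12 i && block34 j)) ->
           submxblock a i j = 0].

(* the part of A \cap A^* supported by the blocks in [P] *)
Definition diagonal_part (n : 'I_4 -> nat) (P : pred 'I_4) : set (ambient n) :=
  [set a | [/\ cycle_algebra a, cycle_algebra (mxstar a) &
     forall i j, ~~ (P i && P j) -> submxblock a i j = 0]].

Definition block_projection (n : 'I_4 -> nat) (i : 'I_4) : ambient n :=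
  \mxdiag_(j < 4) (if j == i then 1%:M else 0 : 'M[C]_(n j)).

(* A *-homomorphism M_r -> M_r' of multiplicity m is unitarily equivalent to
   x |-> diag(x, .., x, 0) with m copies of x, so that its value at 1 has rank
   m r. *)
Definition multiplicity (n n' : 'I_4 -> nat) (f : ambient n -> ambient n') : nat :=
  (\rank (f 1%:M) %/ \sum_i n i)%N.

Definition t12 : 'S_4 := tperm (inord 0) (inord 1).
Definition t34 : 'S_4 := tperm (inord 2) (inord 3).

Definition rigid_type (theta : 'S_4) : Prop :=
  forall i, block12 (theta i) = block12 i.

(* Star extendible embeddings of 4-cycle algebras are given by their (unique)
   extensions to the ambient matrix algebras. *)
Definition rigid_of_type (n n' : 'I_4 -> nat) (theta : 'S_4)
    (f : ambient n -> ambient n') : Prop :=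
  [/\ mx_mx_star_hom f, forall a, cycle_algebra a -> cycle_algebra (f a),
      multiplicity f = 1%N, rigid_type theta &
      forall i j a, cycle_algebra a ->
        exists2 a', cycle_algebra a' &
          f (block_projection n i *m a *m block_projection n j) =
          block_projection n' (theta i) *m a' *m block_projection n' (theta j)].

Record rigid_embedding (n n' : 'I_4 -> nat) := RigidEmbedding {
  rmap :> ambient n -> ambient n';
  rmap_hom : mx_mx_star_hom rmap;
  rmap_inj : injective rmap;
  rmap_cycle : forall a, cycle_algebra a -> cycle_algebra (rmap a);
  rsize : nat;
  rtype : 'I_rsize -> 'S_4;
  rsummand : 'I_rsize -> ambient n -> ambient n';
  rsummandP : forall s, rigid_of_type (rtype s) (rsummand s);
  rsummand_orth : forall s t, s != t ->
    forall a b, rsummand s a *m rsummand t b = 0;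
  rmapE : forall a, rmap a = \sum_s rsummand s a }.

Definition generic n n' (f : rigid_embedding n n') : Prop :=
  forall theta, rigid_type theta -> exists s : 'I_(rsize f), rtype s = theta.

(* H_1 f : H_1 = Z -> H_1 = Z is multiplication by [delta f] *)
Definition delta n n' (f : rigid_embedding n n') : int :=
  #|[pred s : 'I_(rsize f) | rtype s \in [:: 1%g; (t12 * t34)%g]]|%:Z
  - #|[pred s : 'I_(rsize f) | rtype s \in [:: t12; t34]]|%:Z.

Record generic_system := GenericSystem {
  gsize : nat -> 'I_4 -> nat;
  gsize_gt0 : forall k i, (0 < gsize k i)%N;
  gmap : forall k, rigid_embedding (gsize k) (gsize k.+1);
  gmap_generic : forall k, generic (gmap k) }.

End FourCycle.

(** * Direct limits *)

Fixpoint transition (T : nat -> Type) (f : forall k, T k -> T k.+1) (k m : nat) :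
    T k -> T (m + k)%N :=
  if m is m'.+1 then fun x => f (m' + k)%N (transition f m' x) else id.

(* [L], with the maps [g k], is a direct limit of the sequence [(T k, f k)]; when
   the [f k] and [g k] are homomorphisms this characterises the algebraic direct
   limit up to isomorphism. *)
Definition is_direct_limit (T : nat -> Type) (f : forall k, T k -> T k.+1)
    (L : Type) (g : forall k, T k -> L) : Prop :=
  [/\ forall k x, g k.+1 (f k x) = g k x,
      forall y, exists k x, g k x = y &
      forall k x y, g k x = g k y ->
        exists m, transition f m x = transition f m y].

Definition is_H1_limit (C : numClosedFieldType) (S : generic_system C)
    (H : zmodType) (h : nat -> {additive int -> H}) : Prop :=
  @is_direct_limit (fun=> int) (fun k x => delta (gmap S k) * x) H
    (fun k => h k).

(* kappa = 0, where kappa is the class of the products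
   \prod_(k >= l) |delta_k| / p_k for large l *)
Definition coupling_zero (R : realType) (C : numClosedFieldType)
    (S : generic_system C) : Prop :=
  \forall l \near \oo,
    (fun N : nat => \prod_(l <= k < N)
        ((`|delta (gmap S k)|%N)%:R / (multiplicity (gmap S k))%:R) : R)
      @ \oo --> (0 : R).

(** * Index 4 inclusions *)

(* A presentation of [pi : D1 (+) D2 -> D] as the inclusion A \cap A^* -> B of a
   generic system, B being the direct limit of the ambient matrix algebras. *)
Record generic_index4 (C : numClosedFieldType) (D1 D2 D : starAlgType C)
    (pi : star_inclusion (D1 * D2)%type D) := GenericIndex4 {
  gi_matroid1 : matroid D1;
  gi_matroid2 : matroid D2;
  gi_matroid : matroid D;
  gi_system : generic_system C;
  gi_map : forall k, ambient C (gsize gi_system k) -> D;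
  gi_hom : forall k, mx_star_hom (@gi_map k);
  gi_limit : is_direct_limit (fun k => gmap gi_system k : _ -> _) gi_map;
  gi_D1 : [set pi (x, 0) | x in setT] =
    \bigcup_k (@gi_map k @` @diagonal_part C (gsize gi_system k) block12);
  gi_D2 : [set pi (0, y) | y in setT] =
    \bigcup_k (@gi_map k @` @diagonal_part C (gsize gi_system k) block34) }.

(** * The outer automorphism group of an inclusion *)

Section Out.
Variables (R : realType) (D1 D2 D : starAlgType R[i]).
Variable pi : star_inclusion (D1 * D2)%type D.

(* A matroid algebra carries exactly one C*-norm. *)
Definition cstar_norm (N : D -> R) : Prop :=
  [/\ forall x, N x = 0 -> x = 0,
      forall x y, N (x + y) <= N x + N y,
      forall (a : R[i]) x, N (a *: x) = complex.Re `|a| * N x,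
      forall x y, N (x * y) <= N x * N y &
      forall x, N (star x * x) = N x ^+ 2].

(* the *-automorphisms of D preserving each of the summands D1 and D2 *)
Definition rel_aut_pred : {pred bijection D} := fun f =>
  `[< [/\ star_hom f,
          f @` [set pi (x, 0) | x in setT] = [set pi (x, 0) | x in setT] &
          f @` [set pi (0, y) | y in setT] = [set pi (0, y) | y in setT]] >].

Fact rel_aut_closed : group_closed rel_aut_pred.
Proof.
have image_inv (f : bijection D) S : f @` S = S -> binv f @` S = S.
  move=> fS; rewrite -{1}fS image_comp.
  have -> : binv f \o f = id by apply/funext => x /=; rewrite bfunK.
  by rewrite image_id.
split; first by apply/asboolP; split; rewrite ?image_id.
move=> f g /asboolP[[fL fM fS] f1 f2] /asboolP[[gL gM gS] g1 g2].
apply/asboolP; split.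
- have gI := can_inj (@bfunK _ g); split=> [a x y|x y|x] /=.
  + by rewrite -fL; congr (f _); apply: gI; rewrite gL !binvK.
  + by rewrite -fM; congr (f _); apply: gI; rewrite gM !binvK.
  + by rewrite -fS; congr (f _); apply: gI; rewrite gS !binvK.
- by rewrite -[bfun _]/(f \o binv g) -image_comp (image_inv _ _ g1).
- by rewrite -[bfun _]/(f \o binv g) -image_comp (image_inv _ _ g2).
Qed.

Definition relAut := {f : bijection D | f \in rel_aut_pred}.
HB.instance Definition _ := SubChoice.on relAut.
HB.instance Definition _ :=
  SubChoice_isSubGroup.Build _ _ relAut rel_aut_closed.

(* The unitaries lie in D1 (+) D2, but the pointwise convergence is on all of D
   (hence also on D1 (+) D2).  Convergence on D1 (+) D2 alone would be no
   condition: every *-automorphism of a unital matroid algebra is a pointwise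
   limit of inner ones, and the quotient would always be trivial. *)
Definition approx_inner (f : relAut) : Prop :=
  exists u : nat -> D1 * D2,
    (forall n, unitary (u n)) /\
    forall N, cstar_norm N -> forall x,
      (fun n => N (pi (u n) * x * star (pi (u n)) - val f x)) @ \oo --> (0 : R).

Section NormFacts.
Variables (N : D -> R) (NP : cstar_norm N).
Implicit Types x u : D.

Fact cstar_norm0 : N 0 = 0.
Proof.
by case: NP => _ _ NZ _ _; rewrite -(scale0r (0 : D)) NZ normr0 mul0r.
Qed.

Fact cstar_normN x : N (- x) = N x.
Proof. by case: NP => _ _ NZ _ _; rewrite -scaleN1r NZ normrN1 mul1r. Qed.

Fact cstar_norm_ge0 x : 0 <= N x.
Proof.
case: NP => _ ND _ _ _; have := ND x (- x).
by rewrite subrr cstar_norm0 cstar_normN -mulr2n pmulrn_lge0.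
Qed.

Fact cstar_norm_star x : N (star x) = N x.
Proof.
have le y : N y <= N (star y).
  have [->|y0] := eqVneq (N y) 0; first exact: cstar_norm_ge0.
  case: NP => _ _ _ NM NS; have := NM (star y) y.
  by rewrite NS expr2 ler_pM2r// lt_def y0 cstar_norm_ge0.
by apply/eqP; rewrite eq_le le -{2}(starK x) le.
Qed.

Fact cstar_norm_mulul u x : star u * u = 1 -> N (u * x) = N x.
Proof.
move=> uu; apply/eqP; rewrite -(@eqrXn2 _ 2) ?cstar_norm_ge0//.
by case: NP => _ _ _ _ NS; rewrite -!NS starM mulrA -(mulrA _ (star u)) uu mulr1.
Qed.

Fact cstar_norm_conj u x : unitary u -> N (u * x * star u) = N x.
Proof.
move=> [uu _]; rewrite -cstar_norm_star starM starK cstar_norm_mulul//.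
by rewrite cstar_norm_star cstar_norm_mulul.
Qed.

End NormFacts.

Fact star1 (A : starAlgType R[i]) : star (1 : A) = 1.
Proof. by rewrite -[LHS]mulr1 -[1 in X in _ * X](@starK _ A) -starM mulr1 starK. Qed.

Fact unitary_incl u : unitary u -> unitary (pi u).
Proof.
case: (incl_hom pi) => _ pM pS [u1 u2].
by split; rewrite -pS -pM ?u1 ?u2 incl1.
Qed.

Fact unitary_star (A : starAlgType R[i]) (u : A) : unitary u -> unitary (star u).
Proof. by case=> u1 u2; split; rewrite starK. Qed.

Fact unitary_mul (A : starAlgType R[i]) (u v : A) :
  unitary u -> unitary v -> unitary (u * v).
Proof.
move=> [u1 u2] [v1 v2]; split; rewrite starM.
- by rewrite mulrA -(mulrA _ (star u)) u1 mulr1.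
- by rewrite mulrA -(mulrA u) v2 mulr1.
Qed.

Fact approx_inner1 : approx_inner 1%g.
Proof.
exists (fun=> 1); split=> [n|N NP x]; first by split; rewrite star1 mulr1.
rewrite incl1 star1 mul1r mulr1 /= subrr (cstar_norm0 NP); exact: cvg_cst.
Qed.

Fact relAutP (f : relAut) : star_hom (val f).
Proof. by have /asboolP[] := valP f. Qed.

Fact relAutMv (f g : relAut) x : val (f * g)%g x = val f (val g x).
Proof. by []. Qed.

Fact relAutVK (f : relAut) x : val f (val (f^-1)%g x) = x.
Proof. exact: binvK. Qed.

Fact relAutKV (f : relAut) x : val (f^-1)%g (val f x) = x.
Proof. exact: bfunK. Qed.

Fact approx_innerM f g :
  approx_inner f -> approx_inner g -> approx_inner (f * g)%g.
Proof.
move=> [u [uU uf]] [v [vU vg]]; exists (fun n => u n * v n); split.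
  by move=> n; exact: unitary_mul.
move=> N NP x; case: (incl_hom pi) => _ pM _.
have h := cvgD (vg N NP x) (uf N NP (val g x)); rewrite addr0 in h.
apply: (squeeze_cvgr (f := fun=> 0) _ _ (h _)); last exact: cvg_cst.
apply: nearW => n.
rewrite (cstar_norm_ge0 NP) andTb relAutMv pM starM.
set U := pi (u n); set V := pi (v n); set y := val g x; set z := val f y.
have -> : U * V * x * (star V * star U) - z =
   U * (V * x * star V - y) * star U + (U * y * star U - z).
  by rewrite mulrBr mulrBl !mulrA addrA subrK.
case: (NP) => _ ND _ _ _; apply: le_trans (ND _ _) _.
by rewrite (cstar_norm_conj NP)//; exact: unitary_incl.
Qed.

Fact approx_innerV f : approx_inner f -> approx_inner (f^-1)%g.
Proof.
move=> [u [uU uf]]; exists (fun n => star (u n)); split.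
  by move=> n; exact: unitary_star.
move=> N NP x; have := uf N NP (val (f^-1)%g x).
apply: cvg_trans; apply: near_eq_cvg; apply: nearW => n /=.
case: (incl_hom pi) => _ _ pS; rewrite pS starK -/(val (f^-1)%g x).
have [U1 U2] := unitary_incl (uU n); move: U1 U2.
set U := pi (u n) => U1 U2; set y := val (f^-1)%g x.
have -> : val f y = x by exact: relAutVK.
rewrite -(cstar_norm_conj NP (u := U) (star U * x * U - y))//.
rewrite mulrBr mulrBl !mulrA U2 mul1r -(mulrA x) U2 mulr1.
by rewrite -(cstar_normN NP) opprB.
Qed.

Fact relAut_range (g : relAut) z : exists w, pi w = val g (pi z).
Proof.
have /asboolP[[gL _ _] g1 g2] := valP g.
case: (incl_hom pi) => pL _ _.
have addE (A B : starAlgType R[i]) (k : A -> B) : linear k -> {morph k : x y / x + y}.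
  by move=> kL x y; have := kL 1 x y; rewrite !scale1r.
have [x _ xE] : [set pi (x, 0) | x in setT] (val g (pi (z.1, 0))).
  by rewrite -g1; exists (pi (z.1, 0)) => //; exists z.1.
have [y _ yE] : [set pi (0, y) | y in setT] (val g (pi (0, z.2))).
  by rewrite -g2; exists (pi (0, z.2)) => //; exists z.2.
exists ((x, 0) + (0, y)); rewrite (addE _ _ _ pL) xE yE -(addE _ _ _ gL).
rewrite -(addE _ _ _ pL); congr (val g (pi _)).
by case: z {xE yE} => z1 z2; rewrite /= -[LHS]/(z1 + 0, 0 + z2) addr0 add0r.
Qed.

Fact relAut_1 (g : relAut) : val g 1 = 1.
Proof.
case: (relAutP g) => _ gM _.
by rewrite -[LHS]mulr1 -{2}(relAutVK g 1) -gM mul1r relAutVK.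
Qed.

Fact approx_innerJ f g : approx_inner f -> approx_inner (g * f * g^-1)%g.
Proof.
move=> [u [uU uf]]; have [w wE] := choice (fun n => relAut_range g (u n)).
case: (relAutP g) => gL gM gS; case: (incl_hom pi) => _ pM pS.
exists w; split=> [n|N NP x].
  have [u1 u2] := unitary_incl (uU n); split; apply: (@incl_inj _ _ _ pi).
    by rewrite pM pS wE -gS -gM u1 relAut_1 incl1.
  by rewrite pM pS wE -gS -gM u2 relAut_1 incl1.
have gB y z : val g (y - z) = val g y - val g z.
  by have := gL (- 1) z y; rewrite !scaleN1r => h; rewrite addrC h addrC.
have g0 : val g 0 = 0 by have := gB 0 0; rewrite !subrr.
have NgP : cstar_norm (N \o val g).
  case: NP => N0 ND NZ NM NS; split=> [y /N0 gy0|y z|a y|y z|y] /=.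
  - by apply: (can_inj (@bfunK _ (val g))); rewrite gy0 g0.
  - by have := gL 1 y z; rewrite !scale1r => ->.
  - by have := gL a y 0; rewrite !addr0 g0 addr0 => ->.
  - by rewrite gM.
  - by rewrite gM gS.
have := uf _ NgP (val (g^-1)%g x).
apply: cvg_trans; apply: near_eq_cvg; apply: nearW => n /=.
rewrite wE gB !gM gS; congr (N (_ * _ * _ - _)).
by rewrite [LHS]relAutVK.
Qed.

Definition approx_inner_subgroup := NormalSubgroup
  approx_inner1 approx_innerM approx_innerV approx_innerJ.

Definition Out := quotientGroup approx_inner_subgroup.

End Out.

(* Main.v *)
Require Import Defs.
From HB Require Import structures.
From mathcomp Require Import all_boot all_order all_algebra perm spectral.
From mathcomp Require Import all_classical all_reals.
From mathcomp Require Import ereal topology normedtype sequences.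
From mathcomp Require Import ring.
From mathcomp.real_closed Require Import complex.
Import Order.TTheory GRing.Theory Num.Theory numFieldNormedType.Exports.

Set Implicit Arguments.
Unset Strict Implicit.
Unset Printing Implicit Defensive.

Local Open Scope classical_set_scope.
Local Open Scope ring_scope.
Local Open Scope sesquilinear_scope.

(* Identify D with the limit of the ambient matrix algebras of the 4-cycle
   algebras A_k.  An automorphism f of D preserving both summands maps level k into
   some level m and there it is rigid: the differences of the block projections
   1, 2 and of the block projections 3, 4 are carried to those of level m up to two
   commuting symmetries w, w' in the relative commutant (a general embedding is
   excluded because f has an inverse and H_1 <> 0).  As D_1 and D_2 are matroid, w
   and w' have trace 0 for large m, so only tau(w w') remains; normalised by the
   same quantity for the inclusion of level k in level m it is a complex number, the
   degree of f, independent of k and m, and f acts on H_1 as multiplication by it.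

   The degree is multiplicative.  If it is 1, then w, w' and the symmetries of the
   inclusion have joint eigenprojections of equal traces, so f is conjugation by a
   unitary of D_1 (+) D_2 on each level.  Conversely, in the C*-norm the degree
   cannot jump under approximation: the image of a matrix unit between the two
   halves is cut by the block projections into partial isometries, and close
   projections have equal trace.  Hence Out embeds in the multiplicative group of
   C by the degree, and its image has to be computed.

   The degree c and its inverse preserve the rank one group H_1.  Conversely such a
   c is realised by a two-sided intertwining of unitary conjugations as soon as
   |c| |delta_k ... delta_m| <= p_k ... p_m for large m, which is automatic when the
   products of the |delta_j| / p_j vanish, and which holds for c = -1 in any case.
   When these products are bounded below, the degrees of all powers of f are
   uniformly bounded, so that degrees are real of modulus 1. *)

(** * Complex matrices *)

(** Commuting symmetries of a matrix algebra are conjugate as soon as their joint spectral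
    projections have equal traces, and for [w], [w'] those traces are combinations of 1, tau(w),
    tau(w') and tau(w w'). This replaces the K_0- and H_1-data of a rigid map by three numbers.
    Coding the four blocks by one projection [q] and two signs [s], [t] makes these numbers
    multiplicative: composition multiplies symmetries, one of which commutes with a level containing
    the other, so traces factor.

    The arithmetic obstacle is parity. With tau(w) = tau(w') = 0 the four types occur with
    multiplicities A, B, B, A, so a map acts on H_1 by 2 (A - B) and has multiplicity 2 (A + B); to
    realise a prescribed integer, the right divisibility must come from passing through further
    levels.

    [approx_inner] refers to all C*-norms at once. The approximation obtained from degree 1 is
    eventually constant on each element, so it works for any norm; the converse needs some C*-norm
    to exist, and the operator norm on the pre-Hilbert space of the trace is constructed for it. *)

Section ComplexMatrices.
Variable C : numClosedFieldType.

Lemma adjmxM m n p (A : 'M[C]_(m, n)) (B : 'M[C]_(n, p)) :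
  (A *m B) ^t* = B ^t* *m A ^t*.
Proof. by rewrite trmx_mul map_mxM. Qed.

Lemma mxtrace_adj_mul m n (A : 'M[C]_(m, n)) :
  \tr (A ^t* *m A) = \sum_j \sum_i `|A i j| ^+ 2.
Proof.
apply: eq_bigr => j _; rewrite mxE; apply: eq_bigr => i _.
by rewrite !mxE mulrC normCK.
Qed.

Lemma mxtrace_adj_mul_ge0 m n (A : 'M[C]_(m, n)) : 0 <= \tr (A ^t* *m A).
Proof.
by rewrite mxtrace_adj_mul; do 2!apply: sumr_ge0 => ? _; rewrite exprn_ge0.
Qed.

Lemma mxtrace_adj_mul_eq0 m n (A : 'M[C]_(m, n)) :
  \tr (A ^t* *m A) = 0 -> A = 0.
Proof.
rewrite mxtrace_adj_mul => /eqP; rewrite psumr_eq0; last first.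
  by move=> j _; apply: sumr_ge0 => i _; rewrite exprn_ge0.
move=> /allP h; apply/matrixP => i j; rewrite mxE.
have := h j (mem_index_enum _); rewrite psumr_eq0; last first.
  by move=> k _; rewrite exprn_ge0.
move=> /allP /(_ i (mem_index_enum _)) /=.
by rewrite expf_eq0 normr_eq0 => /eqP.
Qed.

(* Orthonormal rows spanning the row space of a projection, by Gram-Schmidt. *)
Lemma projection_mx_decomp r (P : 'M[C]_r) : P *m P = P -> P ^t* = P ->
  exists X : 'M[C]_(\rank P, r),
    [/\ X *m X ^t* = 1%:M, X ^t* *m X = P & \tr P = (\rank P)%:R].
Proof.
move=> PP Ps; pose X := schmidt (row_base P); exists X.
have XU : X *m X ^t* = 1%:M.
  by apply/unitarymxP; apply: schmidt_unitarymx; exact: rank_leq_col.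
have XE : (X :=: P)%MS.
  apply: eqmx_trans (eq_row_base P).
  by apply: eqmx_schmidt_free; exact: row_base_free.
have /submxP[Y XY] : (X <= P)%MS by rewrite XE.
have /submxP[Z PZ] : (P <= X)%MS by rewrite XE.
have XP : X *m P = X by rewrite XY -mulmxA PP.
have PX : P *m X ^t* = X ^t* by rewrite -[in RHS]XP adjmxM Ps.
have XXP : X ^t* *m X = P.
  have -> : X ^t* *m X = P *m (X ^t* *m X) by rewrite mulmxA PX.
  have h (M : 'M[C]_r) : M = Z *m X -> M *m (X ^t* *m X) = Z *m X.
    by move=> ->; rewrite mulmxA -(mulmxA Z) XU mulmx1.
  by rewrite (h P PZ) -PZ.
split=> //; rewrite -{1}XXP mxtrace_mulC XU.
exact: mxtrace1.
Qed.

(** [e_ij] equals [e_i,i0 e_i0,j]; commuting the factors kills the off-diagonal units and equates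
    the diagonal ones. The comparisons of traces between levels rest on this. *)
Lemma mx_trace_unique n (t : 'M[C]_n -> C) (i0 : 'I_n) :
  scalar t -> (forall a b, t (a *m b) = t (b *m a)) ->
  forall a, t a = \tr a * t (delta_mx i0 i0).
Proof.
move=> tL tC a.
have t0 : t 0 = 0 by have := tL (-1) 0 0; rewrite scaler0 addr0 mulN1r addNr.
have tD x y : t (x + y) = t x + t y by have := tL 1 x y; rewrite scale1r mul1r.
have tZ c x : t (c *: x) = c * t x by have := tL c x 0; rewrite !addr0 t0 addr0.
have td i j : t (delta_mx i j) = (i == j)%:R * t (delta_mx i0 i0).
  rewrite -(mul_delta_mx i0 i j) tC mul_delta_mx_cond eq_sym.
  by case: eqP => _; rewrite ?mulr1n ?mulr0n ?mul1r ?mul0r.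
rewrite {1}[a]matrix_sum_delta (big_morph t tD t0) mulr_suml.
apply: eq_bigr => i _; rewrite (big_morph t tD t0) (bigD1 i) //= big1 ?addr0.
  by rewrite tZ td eqxx mul1r.
by move=> j ji; rewrite tZ td eq_sym (negPf ji) mul0r mulr0.
Qed.

End ComplexMatrices.

(** * Star algebras and their matrix subalgebras *)

Section StarAlgebra.
Variables (C : numClosedFieldType) (D : starAlgType C).
Implicit Types x y p q : D.

Lemma star_0 : star (0 : D) = 0.
Proof. by apply: (addrI (star 0)); rewrite -starD !addr0. Qed.

Lemma star_N x : star (- x) = - star x.
Proof. by apply: (addrI (star x)); rewrite -starD !subrr star_0. Qed.

Lemma star_B x y : star (x - y) = star x - star y.
Proof. by rewrite starD star_N. Qed.

Lemma star_1 : star (1 : D) = 1.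
Proof. by rewrite -[LHS]mulr1 -[1 in X in _ * X](@starK _ D) -starM mulr1 starK. Qed.

Lemma star_sum I (r : seq I) (P : pred I) (F : I -> D) :
  star (\sum_(i <- r | P i) F i) = \sum_(i <- r | P i) star (F i).
Proof. exact: (big_morph _ (@starD _ D) star_0). Qed.

Definition projection p := star p = p /\ p * p = p.
Definition symmetry (s : D) := star s = s /\ s * s = 1.

Lemma projection1 : projection (1 : D).
Proof. by split; rewrite ?star_1 ?mulr1. Qed.

Lemma unitaryM (u v : D) : unitary u -> unitary v -> unitary (u * v).
Proof.
move=> [u1 u2] [v1 v2]; split; rewrite starM.
  by rewrite mulrA -(mulrA _ (star u)) u1 mulr1.
by rewrite mulrA -(mulrA u) v2 mulr1.
Qed.

Definition commutes_with (X : set D) y := forall x, X x -> y * x = x * y.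

Lemma commutes_withM X y z :
  commutes_with X y -> commutes_with X z -> commutes_with X (y * z).
Proof. by move=> yX zX x Xx; rewrite -mulrA zX // !mulrA yX. Qed.

Lemma commutes_withD X y z :
  commutes_with X y -> commutes_with X z -> commutes_with X (y + z).
Proof. by move=> yX zX x Xx; rewrite mulrDl mulrDr yX ?zX. Qed.

Lemma commutes_withN X y : commutes_with X y -> commutes_with X (- y).
Proof. by move=> yX x Xx; rewrite mulNr mulrN yX. Qed.

Lemma commutes_withZ X a y : commutes_with X y -> commutes_with X (a *: y).
Proof. by move=> yX x Xx; rewrite -scalerAl -scalerAr yX. Qed.

Lemma commutes_with1 X : commutes_with X (1 : D).
Proof. by move=> x _; rewrite mul1r mulr1. Qed.

End StarAlgebra.

Lemma scaler_half (K : numFieldType) (V : lmodType K) (x : V) :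
  2^-1 *: (x + x) = x.
Proof. by rewrite -mulr2n -(scaler_nat 2 x) scalerA mulVf ?scale1r ?pnatr_eq0. Qed.

Section LinearFun.
Variables (K : pzRingType) (U V : lmodType K) (f : U -> V).
Hypothesis fL : linear f.

Lemma linear_fun0 : f 0 = 0.
Proof. by have := fL (-1) 0 0; rewrite scaler0 addr0 scaleN1r addNr. Qed.
Lemma linear_funD x y : f (x + y) = f x + f y.
Proof. by have := fL 1 x y; rewrite !scale1r. Qed.
Lemma linear_funZ a x : f (a *: x) = a *: f x.
Proof. by have := fL a x 0; rewrite !addr0 linear_fun0 addr0. Qed.
Lemma linear_funN x : f (- x) = - f x.
Proof. by rewrite -scaleN1r linear_funZ scaleN1r. Qed.
Lemma linear_funB x y : f (x - y) = f x - f y.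
Proof. by rewrite linear_funD linear_funN. Qed.
Lemma linear_fun_sum I (r : seq I) (P : pred I) (F : I -> U) :
  f (\sum_(i <- r | P i) F i) = \sum_(i <- r | P i) f (F i).
Proof. exact: (big_morph _ linear_funD linear_fun0). Qed.
End LinearFun.

Definition mx_embedding (C : numClosedFieldType) (D : starAlgType C) r
    (g : 'M[C]_r -> D) :=
  [/\ (0 < r)%N, mx_star_hom g & g 1%:M = 1].

Definition normalised_trace (C : numClosedFieldType) (D : starAlgType C)
    (tau : D -> C) :=
  [/\ scalar tau, forall x y, tau (x * y) = tau (y * x) & tau 1 = 1].

Section MatrixSubalgebra.
Variables (C : numClosedFieldType) (D : starAlgType C) (r : nat).
Variables (g : 'M[C]_r -> D).
Hypothesis gP : mx_embedding g.
Implicit Types x y z p q : D.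
Local Notation B := (range g).
Local Notation e i j := (g (delta_mx i j)).

Let gL : linear g. Proof. by case: gP => _ []. Qed.
Let gM a b : g (a *m b) = g a * g b. Proof. by case: gP => _ []. Qed.
Let gS a : g (a ^t*) = star (g a).
Proof. by case: gP => _ [_ _ gS] _; exact: gS. Qed.
Let g1 : g 1%:M = 1. Proof. by case: gP. Qed.

Lemma range_emb1 : B 1. Proof. by exists 1%:M. Qed.
Lemma range_emb0 : B 0. Proof. by exists 0; rewrite ?linear_fun0. Qed.
Lemma range_embD x y : B x -> B y -> B (x + y).
Proof. by move=> [a _ <-] [b _ <-]; exists (a + b); rewrite ?linear_funD. Qed.
Lemma range_embM x y : B x -> B y -> B (x * y).
Proof. by move=> [a _ <-] [b _ <-]; exists (a *m b). Qed.
Lemma range_embZ c x : B x -> B (c *: x).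
Proof. by move=> [a _ <-]; exists (c *: a); rewrite ?linear_funZ. Qed.
Lemma range_embN x : B x -> B (- x).
Proof. by move=> [a _ <-]; exists (- a); rewrite ?linear_funN. Qed.
Lemma range_embB x y : B x -> B y -> B (x - y).
Proof. by move=> Bx By; apply: range_embD => //; exact: range_embN. Qed.
Lemma range_emb_star x : B x -> B (star x).
Proof. by move=> [a _ <-]; exists (a ^t*). Qed.
Lemma range_emb_sum I (s : seq I) (P : pred I) (F : I -> D) :
  (forall i, P i -> B (F i)) -> B (\sum_(i <- s | P i) F i).
Proof.
by move=> BF; apply: (big_ind B) => //; [exact: range_emb0 | exact: range_embD].
Qed.

Lemma munitM i j k l : e i j * e k l = (j == k)%:R *: e i l.
Proof.
rewrite -gM mul_delta_mx_cond; case: eqP => _.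
  by rewrite scale1r.
by rewrite scale0r linear_fun0.
Qed.

Lemma munitMid i j l : e i j * e j l = e i l.
Proof. by rewrite munitM eqxx scale1r. Qed.

Lemma star_munit i j : star (e i j) = e j i.
Proof. by rewrite -gS trmx_delta map_delta_mx. Qed.

Lemma range_munit i j : B (e i j). Proof. by exists (delta_mx i j). Qed.

Lemma munit_projection i : projection (e i i).
Proof. by split; [exact: star_munit | exact: munitMid]. Qed.

Lemma emb_sum_munit a : g a = \sum_i \sum_j a i j *: e i j.
Proof.
rewrite {1}[a]matrix_sum_delta linear_fun_sum //; apply: eq_bigr => i _.
by rewrite linear_fun_sum //; apply: eq_bigr => j _; rewrite linear_funZ.
Qed.

Lemma sum_munit : \sum_i e i i = 1.
Proof.
rewrite -g1 emb_sum_munit; apply: eq_bigr => i _.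
rewrite (bigD1 i) //= big1 ?addr0 ?mxE ?eqxx ?scale1r // => j ji.
by rewrite mxE eq_sym (negPf ji) scale0r.
Qed.

Lemma sum_munit_col (i0 : 'I_r) : \sum_i e i i0 * e i0 i = 1.
Proof. by rewrite -sum_munit; apply: eq_bigr => i _; rewrite munitMid. Qed.

Lemma munit_sandwich a i j k l : e k i * g a * e j l = a i j *: e k l.
Proof.
rewrite -!gM -linear_funZ //; congr g; apply/matrixP => u v; rewrite !mxE.
rewrite (bigD1 j) //= big1 => [|w wj]; last first.
  by rewrite !mxE (negPf wj) mulr0.
rewrite addr0 !mxE (bigD1 i) //= big1 => [|w wi]; last first.
  by rewrite !mxE (negPf wi) andbF mul0r.
rewrite addr0 !mxE !eqxx /= andbT.
by case: eqP => _; rewrite /= ?mul1r ?mulr1 ?mul0r ?mulr0.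
Qed.

Lemma commutes_emb z : (forall i j, z * e i j = e i j * z) -> commutes_with B z.
Proof.
move=> ze _ [a _ <-]; rewrite emb_sum_munit mulr_sumr mulr_suml.
apply: eq_bigr => i _; rewrite mulr_sumr mulr_suml; apply: eq_bigr => j _.
by rewrite -scalerAr -scalerAl ze.
Qed.

(* Simplicity of the matrix algebra. *)
Lemma commutant_annihil z q : commutes_with B z -> B q -> q != 0 -> z * q = 0 ->
  z = 0.
Proof.
move=> zB [a _ <-] qn0 zq.
have [i [j aij]] : exists i j, a i j != 0.
  apply/not_existsP => h; case/negP: qn0.
  suff -> : a = 0 by rewrite linear_fun0.
  apply/matrixP => i j; rewrite mxE; apply/eqP; apply/negPn/negP => aij.
  by apply: (h i); exists j.
have zl l : z * e l l = 0.
  have := munit_sandwich a i j l l => h.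
  have -> : e l l = (a i j)^-1 *: (e l i * g a * e j l).
    by rewrite h scalerA mulVf ?scale1r.
  rewrite -scalerAr !mulrA (zB _ (range_munit l i)) -(mulrA (e l i)) zq.
  by rewrite mulr0 mul0r scaler0.
by rewrite -[z]mulr1 -sum_munit mulr_sumr big1.
Qed.

Lemma emb_inj : injective g.
Proof.
move=> a b /eqP; rewrite -subr_eq0 -linear_funB // => /eqP gab.
apply/eqP; rewrite -subr_eq0; apply/eqP; apply/matrixP => i j; rewrite [RHS]mxE.
have h l : (a - b) i j *: e l l = 0.
  by rewrite -(munit_sandwich (a - b) i j l l) gab mulr0 mul0r.
apply/eqP/negPn/negP => n0; case/negP: (oner_neq0 D).
rewrite -sum_munit big1 // => l _.
by rewrite -[e l l]scale1r -(mulVf n0) -scalerA h scaler0.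
Qed.

Lemma emb_center z : B z -> commutes_with B z -> exists c : C, z = c *: 1.
Proof.
case: gP => r0 _ _ [a _ <-] zB; pose i0 := Ordinal r0.
exists (a i0 i0); rewrite -[LHS]mulr1 -{1}(sum_munit_col i0) mulr_sumr -sum_munit.
rewrite scaler_sumr; apply: eq_bigr => i _.
by rewrite mulrA (zB _ (range_munit i i0)) -munit_sandwich.
Qed.

(* The element of the commutant of [B] whose compression by [e i0 i0] is [c]. *)
Definition amplify (i0 : 'I_r) (c : D) : D := \sum_i e i i0 * c * e i0 i.

Lemma amplify_commutes i0 c : commutes_with B (amplify i0 c).
Proof.
apply: commutes_emb => i j; rewrite /amplify mulr_suml mulr_sumr.
rewrite (bigD1 i) //= big1 => [|k ki]; last first.
  by rewrite -mulrA munitM (negPf ki) scale0r mulr0.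
rewrite [RHS](bigD1 j) //= [X in _ = _ + X]big1 => [|k kj]; last first.
  by rewrite !mulrA munitM eq_sym (negPf kj) scale0r !mul0r.
by rewrite !addr0 -mulrA munitMid !mulrA munitMid.
Qed.

Lemma star_amplify i0 c : star (amplify i0 c) = amplify i0 (star c).
Proof.
by rewrite star_sum; apply: eq_bigr => i _; rewrite !starM !star_munit mulrA.
Qed.

Lemma munit_amplify i0 c : e i0 i0 * amplify i0 c = e i0 i0 * c * e i0 i0.
Proof.
rewrite mulr_sumr (bigD1 i0) //= big1 => [|k ki]; last first.
  by rewrite !mulrA munitM eq_sym (negPf ki) scale0r !mul0r.
by rewrite addr0 !mulrA munitMid.
Qed.

Lemma amplifyM i0 c d : c * e i0 i0 = c ->
  amplify i0 c * amplify i0 d = amplify i0 (c * d).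
Proof.
move=> ce; rewrite [LHS]mulr_suml; apply: eq_bigr => i _.
rewrite -[LHS]mulrA -(amplify_commutes i0 d (range_munit i0 i)) mulrA.
rewrite -[in LHS]ce -(mulrA (e i i0)) -(mulrA c) munit_amplify !mulrA.
by rewrite -(mulrA _ c) ce -mulrA munitMid.
Qed.

Lemma amplify_munit i0 : amplify i0 (e i0 i0) = 1.
Proof.
by rewrite -sum_munit; apply: eq_bigr => i _; rewrite munitMid munitMid.
Qed.

End MatrixSubalgebra.

(** * Traces and projections in matrix subalgebras *)

Section Trace.
Variables (C : numClosedFieldType) (D : starAlgType C) (tau : D -> C).
Hypothesis tauP : normalised_trace tau.
Implicit Types x y p q : D.

Let tauL : linear (tau : D -> C^o). Proof. by case: tauP. Qed.
Lemma tauC x y : tau (x * y) = tau (y * x). Proof. by case: tauP. Qed.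
Lemma tau1 : tau 1 = 1. Proof. by case: tauP. Qed.
Lemma tau0 : tau 0 = 0. Proof. exact: (linear_fun0 tauL). Qed.
Lemma tauD x y : tau (x + y) = tau x + tau y.
Proof. exact: (linear_funD tauL). Qed.
Lemma tauZ a x : tau (a *: x) = a * tau x.
Proof. exact: (linear_funZ tauL). Qed.
Lemma tauN x : tau (- x) = - tau x.
Proof. exact: (linear_funN tauL). Qed.
Lemma tauB x y : tau (x - y) = tau x - tau y.
Proof. exact: (linear_funB tauL). Qed.
Lemma tau_sum I (r : seq I) (P : pred I) (F : I -> D) :
  tau (\sum_(i <- r | P i) F i) = \sum_(i <- r | P i) tau (F i).
Proof. exact: (linear_fun_sum tauL). Qed.

Variables (r : nat) (g : 'M[C]_r -> D).
Hypothesis gP : mx_embedding g.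
Local Notation B := (range g).
Local Notation e i j := (g (delta_mx i j)).

Let r_gt0 : (0 < r)%N. Proof. by case: gP. Qed.
Let gL : linear g. Proof. by case: gP => _ []. Qed.
Let gM a b : g (a *m b) = g a * g b. Proof. by case: gP => _ []. Qed.
Let gS a : g (a ^t*) = star (g a).
Proof. by case: gP => _ [_ _ gS] _; exact: gS. Qed.

Lemma natr_size_neq0 : r%:R != 0 :> C.
Proof. by rewrite pnatr_eq0 -lt0n. Qed.

Lemma tau_munit i : tau (e i i) = r%:R^-1.
Proof.
have h j : tau (e j j) = tau (e i i).
  by rewrite -{1}(munitMid gP j i j) tauC munitMid.
have : \sum_(j < r) tau (e j j) = 1 by rewrite -tau_sum (sum_munit gP) tau1.
rewrite (eq_bigr _ (fun j _ => h j)) sumr_const card_ord => hr.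
by apply: (mulfI natr_size_neq0); rewrite mulfV ?natr_size_neq0 // mulr_natl.
Qed.

Lemma tau_emb a : tau (g a) = \tr a / r%:R.
Proof.
rewrite -(tau_munit (Ordinal r_gt0)).
apply: (@mx_trace_unique _ _ (fun a => tau (g a))).
  by move=> c x y; rewrite gL tauD tauZ.
by move=> x y; rewrite !gM tauC.
Qed.

(** For fixed [y] in the commutant, [x |-> tau (x * y)] is again a trace on the matrix algebra,
    hence proportional to [tau]; [x = 1] gives the factor. *)
Lemma tau_mul_commutant x y : B x -> commutes_with B y ->
  tau (x * y) = tau x * tau y.
Proof.
move=> [a _ <-] yB; pose t b := tau (g b * y).
have h b : t b = \tr b * t (delta_mx (Ordinal r_gt0) (Ordinal r_gt0)).
  apply: mx_trace_unique => [c u v|u v]; rewrite /t.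
    by rewrite gL mulrDl -scalerAl tauD tauZ.
  by rewrite !gM -!mulrA tauC -mulrA (yB (g u)) //; exists u.
have := h 1%:M; rewrite /t; case: gP => _ _ ->; rewrite mul1r mxtrace1 => ->.
rewrite -/(t a) h tau_emb [RHS]mulrA; congr (_ * _).
by rewrite mulfVK ?natr_size_neq0.
Qed.

Lemma tau_star_mul_ge0 x : B x -> 0 <= tau (star x * x).
Proof.
move=> [a _ <-]; rewrite -gS -gM tau_emb divr_ge0 //.
exact: mxtrace_adj_mul_ge0.
Qed.

Lemma tau_star_mul_eq0 x : B x -> tau (star x * x) = 0 -> x = 0.
Proof.
move=> [a _ <-]; rewrite -gS -gM tau_emb => /eqP.
rewrite mulf_eq0 invr_eq0 (negPf natr_size_neq0) orbF => /eqP.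
by move=> /mxtrace_adj_mul_eq0 ->; rewrite linear_fun0.
Qed.

Lemma projection_decomp p : B p -> projection p ->
  exists n (X : 'M[C]_(n, r)),
    [/\ X *m X ^t* = 1%:M, g (X ^t* *m X) = p & tau p = n%:R / r%:R].
Proof.
move=> [a _ <-] [ps pp].
have aa : a *m a = a by apply: (emb_inj gP); rewrite gM.
have sa : a ^t* = a by apply: (emb_inj gP); rewrite gS.
have [X [XU XX tn]] := projection_mx_decomp aa sa.
by exists (\rank a), X; split; rewrite ?XX // tau_emb tn.
Qed.

Lemma projection_equiv p q : B p -> B q -> projection p -> projection q ->
  tau p = tau q -> exists v, [/\ B v, star v * v = p & v * star v = q].
Proof.
move=> Bp Bq pP qP.
have [n [X [XU <- ->]]] := projection_decomp Bp pP.
have [m [Y [YU <- ->]]] := projection_decomp Bq qP.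
move=> /(mulIf (invr_neq0 natr_size_neq0)) /eqP; rewrite eqr_nat => /eqP nm.
subst m; exists (g (Y ^t* *m X)); rewrite -gS -!gM adjmxM trmxCK; split.
- by exists (Y ^t* *m X).
- by rewrite mulmxA -(mulmxA (X ^t*)) YU mulmx1.
- by rewrite mulmxA -(mulmxA (Y ^t*)) XU mulmx1.
Qed.

(** Dimension count: the range of [p] is larger than that of [q], so it meets the kernel of [q]. The
    common vector is coded as an element of the algebra, built from the kernel [K] of
    [X *m Y ^t*]. *)
Lemma projection_common_vector p q : B p -> B q -> projection p ->
  projection q -> tau q < tau p -> exists x, [/\ x != 0, p * x = x & q * x = 0].
Proof.
move=> Bp Bq pP qP.
have [n [X [XU <- ->]]] := projection_decomp Bp pP.
have [m [Y [YU <- ->]]] := projection_decomp Bq qP.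
rewrite ltr_pM2r ?invr_gt0 ?ltr0n // ltr_nat => mn.
pose K := kermx (X *m Y ^t*).
have KXY : K *m (X *m Y ^t*) = 0 by exact: mulmx_ker.
have Kn0 : K != 0.
  rewrite -mxrank_eq0 mxrank_ker subn_eq0 -ltnNge.
  by apply: leq_ltn_trans mn; exact: rank_leq_col.
have YXK : Y *m X ^t* *m K ^t* = 0.
  by rewrite -[Y](trmxCK) -!adjmxM KXY trmx0 map_mx0.
exists (g (X ^t* *m K ^t* *m K *m X)); split.
- apply: contraNneq Kn0 => h; apply/eqP/mxtrace_adj_mul_eq0.
  have : X ^t* *m K ^t* *m K *m X = 0.
    by apply: (emb_inj gP); rewrite h linear_fun0.
  move=> /(congr1 (fun M => X *m M *m X ^t*)).
  rewrite !mulmxA XU mul1mx -!mulmxA XU mulmx1 mul0mx mulmx0 => ->.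
  exact: mxtrace0.
- by rewrite -gM !mulmxA -(mulmxA (X ^t*)) XU mulmx1.
- by rewrite -gM !mulmxA -(mulmxA (Y ^t* *m Y)) -(mulmxA (Y ^t*)) (mulmxA Y)
    YXK mulmx0 !mul0mx linear_fun0.
Qed.

End Trace.

Section UnitalStarHom.
Variables (C : numClosedFieldType) (D : starAlgType C).
Implicit Types (f : D -> D) (u x : D).

Definition unital_star_hom f := star_hom f /\ f 1 = 1.

Lemma unital_star_hom_id : unital_star_hom id.
Proof. by split=> //; split. Qed.

Lemma unital_star_hom_comp f1 f2 :
  unital_star_hom f1 -> unital_star_hom f2 -> unital_star_hom (f1 \o f2).
Proof.
move=> [[l1 m1 s1] u1] [[l2 m2 s2] u2]; split; last by rewrite /= u2.
split=> [a x y|x y|x] /=; first by rewrite l2 l1.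
  by rewrite m2 m1.
by rewrite s2 s1.
Qed.

Lemma mx_embedding_comp f r (g : 'M[C]_r -> D) :
  unital_star_hom f -> mx_embedding g -> mx_embedding (f \o g).
Proof.
move=> [[fL fM fS] f1] [r0 [gL gM gS] g1]; split=> //=; last by rewrite g1.
split=> [a x y|x y|x] /=; first by rewrite gL fL.
  by rewrite gM fM.
by rewrite gS fS.
Qed.

Lemma normalised_trace_comp tau f :
  unital_star_hom f -> normalised_trace tau -> normalised_trace (tau \o f).
Proof.
move=> [[fL fM _] f1] [tL tC t1]; split=> [a x y|x y|] /=.
- by rewrite fL tL.
- by rewrite !fM tC.
- by rewrite f1.
Qed.

Definition Ad u x := u * x * star u.

Lemma unital_star_hom_Ad u : unitary u -> unital_star_hom (Ad u).
Proof.
move=> [u1 u2]; split; last by rewrite /Ad mulr1.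
split=> [a x y|x y|x]; rewrite /Ad.
- by rewrite mulrDr mulrDl -scalerAr -scalerAl.
- by rewrite !mulrA -(mulrA _ (star u) u) u1 mulr1.
- by rewrite !starM starK mulrA.
Qed.

Lemma Ad_mul u v x : Ad (u * v) x = Ad u (Ad v x).
Proof. by rewrite /Ad starM !mulrA. Qed.

End UnitalStarHom.

(** * Sign elements of one half of the blocks *)

Section HalfSign.
Variables (C : numClosedFieldType) (D : starAlgType C).
Implicit Types (x y z p q s X : D).

(* [s] has eigenvalues 1, -1 on the range of the projection [q] and vanishes on
   the complement; both eigenprojections dominate a diagonal matrix unit. *)
Definition half_sign r (g : 'M[C]_r -> D) q s :=
  [/\ range g s, star s = s, s * s = q, q * s = s &
      (exists i, s * g (delta_mx i i) = g (delta_mx i i)) /\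
      exists i, s * g (delta_mx i i) = - g (delta_mx i i)].

(* the part of A \cap A^* under [q], for the 4-cycle algebra A inside [B] *)
Definition in_blocks (B : set D) q s x :=
  [/\ B x, q * x = x, x * q = x & x * s = s * x].

Variables (r : nat) (g : 'M[C]_r -> D) (q s : D).
Hypotheses (gP : mx_embedding g) (sP : half_sign g q s).
Local Notation B := (range g).
Local Notation e i j := (g (delta_mx i j)).

Let Bs : B s. Proof. by case: sP. Qed.
Let ss : star s = s. Proof. by case: sP. Qed.
Let s2 : s * s = q. Proof. by case: sP. Qed.
Let qs : q * s = s. Proof. by case: sP. Qed.

Lemma half_sign_range : B q.
Proof. by rewrite -s2; exact: range_embM. Qed.

Lemma half_sign_mulr : s * q = s.
Proof. by rewrite -s2 mulrA s2. Qed.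

Lemma half_sign_projection : projection q.
Proof. by split; rewrite -s2 ?starM ?ss // mulrA s2 qs. Qed.

Lemma half_signN : half_sign g q (- s).
Proof.
case: sP => _ _ _ _ [ep em]; split.
- exact: range_embN.
- by rewrite star_N ss.
- by rewrite mulrNN.
- by rewrite mulrN qs.
- split.
    by case: em => i h; exists i; rewrite mulNr h opprK.
  by case: ep => i h; exists i; rewrite mulNr h.
Qed.

(** Under a unit with [s e_ii = e_ii] the relation says that [x + y] vanishes on [e_ii], under one
    with [s e_jj = - e_jj] that [x - y] vanishes on [e_jj]; simplicity of the matrix algebra removes
    the units. Both eigenvalues of [s] must occur. *)
Lemma half_sign_ann x y : commutes_with B x -> commutes_with B y ->
  q * x + s * y = 0 -> x = 0 /\ y = 0.
Proof.
move=> xB yB h; case: sP => _ _ _ _ [[i hi] [j hj]].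
have munit_neq0 k : e k k != 0.
  apply/eqP => /(congr1 (fun d => \sum_l e l k * d * e k l)).
  rewrite (eq_bigr (fun l => e l l)) => [|l _]; last by rewrite !munitMid.
  rewrite (sum_munit gP) big1 => [/eqP|l _]; first by rewrite oner_eq0.
  by rewrite mulr0 mul0r.
have ann k z : commutes_with B z -> e k k * z = 0 -> z = 0.
  move=> zB ez; apply: (commutant_annihil gP zB (range_munit g k k)) => //.
  by rewrite zB //; exact: range_munit.
have xy : x + y = 0.
  apply: (ann i); first exact: commutes_withD.
  have := congr1 (fun d => d * e i i) h; rewrite mul0r mulrDl -!mulrA.
  rewrite (xB _ (range_munit g i i)) (yB _ (range_munit g i i)) !mulrA -s2.
  by rewrite -(mulrA s s) hi hi -mulrDr.
have xNy : x - y = 0.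
  apply: (ann j); first by apply: commutes_withD => //; exact: commutes_withN.
  have := congr1 (fun d => d * e j j) h; rewrite mul0r mulrDl -!mulrA.
  rewrite (xB _ (range_munit g j j)) (yB _ (range_munit g j j)) !mulrA -s2.
  by rewrite -(mulrA s s) hj mulrN hj opprK mulNr -mulrBr.
have x0 : x = 0 by rewrite -[x]scaler_half -{1}[x](addrK y) xy sub0r addrC xNy scaler0.
by split=> //; move: xy; rewrite x0 add0r.
Qed.

Lemma half_sign_inj x y x' y' :
  commutes_with B x -> commutes_with B y ->
  commutes_with B x' -> commutes_with B y' ->
  q * x + s * y = q * x' + s * y' -> x = x' /\ y = y'.
Proof.
move=> xB yB x'B y'B h.
have [] := @half_sign_ann (x - x') (y - y').
- by apply: commutes_withD => //; exact: commutes_withN.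
- by apply: commutes_withD => //; exact: commutes_withN.
- by rewrite !mulrBr addrACA -opprD h subrr.
by move=> /eqP; rewrite subr_eq0 => /eqP -> /eqP; rewrite subr_eq0 => /eqP ->.
Qed.

Lemma half_sign_eq x y : commutes_with B x -> commutes_with B y ->
  s * x = s * y -> x = y.
Proof.
move=> xB yB h; have [] := @half_sign_inj 0 x 0 y => //.
- by move=> d _; rewrite mul0r mulr0.
- by move=> d _; rewrite mul0r mulr0.
- by rewrite !mulr0 !add0r.
Qed.

End HalfSign.

Lemma half_sign_comp (C : numClosedFieldType) (D : starAlgType C) (f : D -> D) r
    (g : 'M[C]_r -> D) q s :
  unital_star_hom f -> half_sign g q s -> half_sign (f \o g) (f q) (f s).
Proof.
move=> [[fL fM fS] f1] [[a _ <-] ss s2 qs [[i hi] [j hj]]].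
split; rewrite -?fS -?fM ?ss ?s2 ?qs //.
split; [exists i | exists j]; rewrite /= -fM ?hi ?hj //.
by rewrite (linear_funN fL).
Qed.

(** * Relative commutant of the diagonal blocks *)

Section BlockCommutant.
Variables (C : numClosedFieldType) (D : starAlgType C).
Variables (r : nat) (g : 'M[C]_r -> D).
Hypothesis gP : mx_embedding g.
Local Notation B := (range g).
Local Notation e i j := (g (delta_mx i j)).
Implicit Types (x y z p q s X : D).

(** [q + s] is twice the projection onto one block, and [e i i] lies under it. As [X] commutes with
    every [(q + s) * e j i], on this block it is determined by its corner at [i]. *)
Lemma block_commutant_half q s X i : half_sign g q s -> s * e i i = e i i ->
  q * X = X -> X * q = X ->
  (forall x, in_blocks B q s x -> X * x = x * X) ->
  X * (q + s) = (q + s) * amplify g i X.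
Proof.
move=> sP si qX Xq Xc; have [Bs ss s2 qs _] := sP.
have sq := half_sign_mulr sP; have [_ qq] := half_sign_projection sP.
have si' : e i i * s = e i i.
  by rewrite -{1}(star_munit gP i i) -{1}ss -starM si star_munit.
have sqs : s * (q + s) = q + s by rewrite mulrDr sq s2 addrC.
have qqs : q * (q + s) = q + s by rewrite mulrDr qq qs.
rewrite -[in LHS](mulr1 (q + s)) -(sum_munit_col gP i) !mulr_sumr.
apply: eq_bigr => j _; rewrite !mulrA.
have eis : e j i * s = e j i by rewrite -{1}(munitMid gP j i i) -mulrA si' munitMid.
have eiq : e j i * q = e j i by rewrite -s2 mulrA !eis.
congr (_ * _); rewrite -mulrA Xc //; split.
- apply: range_embM (range_munit _ _ _) => //.
  by apply: range_embD Bs => //; exact: half_sign_range sP.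
- by rewrite mulrA qqs.
- by rewrite -mulrA eiq.
- by rewrite -mulrA eis mulrA sqs.
Qed.

(** On each eigenspace of [s] the element [X] agrees with an element of the commutant of [B]; [a]
    and [b] are half the sum and half the difference of these two elements. *)
Lemma block_commutant n (g' : 'M[C]_n -> D) q s X : mx_embedding g' ->
  B `<=` range g' -> half_sign g q s -> range g' X ->
  q * X = X -> X * q = X ->
  (forall x, in_blocks B q s x -> X * x = x * X) ->
  exists a b, [/\ range g' a, range g' b, commutes_with B a, commutes_with B b &
    X = q * a + s * b].
Proof.
move=> g'P BB' sP BX qX Xq Xc; have [_ _ _ _ [[i hi] [j hj]]] := sP.
have h1 := block_commutant_half sP hi qX Xq Xc.
have h2 : X * (q - s) = (q - s) * amplify g j X.
  apply: block_commutant_half => //; first exact: half_signN.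
    by rewrite mulNr hj opprK.
  by move=> x [Bx qx xq xs]; apply: Xc; split=> //; apply: oppr_inj; rewrite -mulrN -mulNr.
have Ba k : range g' (amplify g k X).
  apply: range_emb_sum => // l _; apply: range_embM => //; last first.
    exact/BB'/range_munit.
  by apply: range_embM => //; exact/BB'/range_munit.
have Ca k : commutes_with B (amplify g k X) by exact: amplify_commutes.
exists (2^-1 *: (amplify g i X + amplify g j X)),
  (2^-1 *: (amplify g i X - amplify g j X)); split.
- by apply: range_embZ => //; exact: range_embD.
- by apply: range_embZ => //; exact: range_embB.
- by apply: commutes_withZ; exact: commutes_withD.
- by apply: commutes_withZ; apply: commutes_withD => //; exact: commutes_withN.
rewrite -!scalerAr -scalerDr.
rewrite -[LHS]scaler_half; congr (_ *: _); rewrite -{1 2}Xq.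
have -> : X * q + X * q = X * (q + s) + X * (q - s).
  by rewrite -!mulrDr addrACA subrr addr0.
by rewrite h1 h2 !(mulrDl, mulrDr, mulNr, mulrN) -!addrA; congr (_ + _); rewrite addrCA.
Qed.

End BlockCommutant.

(** * Conjugating families of projections and embeddings *)

Section Conjugation.
Variables (C : numClosedFieldType) (D : starAlgType C) (tau : D -> C).
Hypothesis tauP : normalised_trace tau.
Variables (n : nat) (g : 'M[C]_n -> D).
Hypothesis gP : mx_embedding g.
Local Notation B := (range g).
Implicit Types (x y z p q v V : D).

Lemma partial_isometry_mulr v p : B v -> projection p -> star v * v = p ->
  v * p = v.
Proof.
move=> Bv [ps pp] vv; apply/eqP; rewrite -subr_eq0; apply/eqP.
apply: (tau_star_mul_eq0 tauP gP).
  apply: range_embB => //; apply: range_embM => //; rewrite -vv.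
  by apply: range_embM => //; exact: range_emb_star.
rewrite star_B starM ps mulrBr !mulrBl !mulrA vv -(mulrA p) vv pp.
by rewrite pp !subrr tau0.
Qed.

Lemma orthogonal_families_conj (I : finType) (p q : I -> D) :
  (forall i, B (p i)) -> (forall i, B (q i)) ->
  (forall i, projection (p i)) -> (forall i, projection (q i)) ->
  (forall i j, i != j -> p i * p j = 0) -> (forall i j, i != j -> q i * q j = 0) ->
  (forall i, tau (p i) = tau (q i)) ->
  exists V, [/\ B V, star V * V = \sum_i p i, V * star V = \sum_i q i &
    forall i, V * p i = q i * V].
Proof.
move=> Bp Bq pP qP pO qO pq.
have [v vP] := choice (fun i =>
  projection_equiv tauP gP (Bp i) (Bq i) (pP i) (qP i) (pq i)).
have vp i : v i * p i = v i.
  by case: (vP i) => Bv vv _; exact: partial_isometry_mulr.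
have qv i : q i * v i = v i by case: (vP i) => _ vv <-; rewrite -mulrA vv.
exists (\sum_i v i); split.
- by apply: range_emb_sum => // i _; case: (vP i).
- rewrite star_sum mulr_suml; apply: eq_bigr => i _; case: (vP i) => _ vv _.
  rewrite mulr_sumr (bigD1 i) //= vv big1 ?addr0 // => j ji.
  have [qs _] := qP i.
  rewrite -(qv i) -(qv j) starM qs -mulrA (mulrA (q i)) qO 1?eq_sym //.
  by rewrite mul0r mulr0.
- rewrite star_sum mulr_suml; apply: eq_bigr => i _; case: (vP i) => _ _ vv.
  rewrite mulr_sumr (bigD1 i) //= vv big1 ?addr0 // => j ji.
  have [ps _] := pP j.
  rewrite -(vp i) -(vp j) starM ps -mulrA (mulrA (p i)) pO 1?eq_sym //.
  by rewrite mul0r mulr0.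
move=> i; rewrite mulr_suml mulr_sumr (bigD1 i) //= [RHS](bigD1 i) //= vp qv.
rewrite !big1 // => j ji.
  by rewrite -(qv j) mulrA qO 1?eq_sym // mul0r.
by rewrite -(vp j) -mulrA pO // mulr0.
Qed.

Variables (r : nat) (phi psi : 'M[C]_r -> D).
Hypotheses (phiP : mx_embedding phi) (psiP : mx_embedding psi).
Hypotheses (phiB : range phi `<=` B) (psiB : range psi `<=` B).
Variables (i0 : 'I_r) (V : D).
Hypotheses (BV : B V) (VV : star V * V = phi (delta_mx i0 i0)).
Hypothesis (VV' : V * star V = psi (delta_mx i0 i0)).

(** [V] links one corner of [phi] with the corresponding corner of [psi]; spreading it by matrix
    units gives a unitary. Elements of the commutants are determined by these corners, so relations
    between them need only be checked on [V]. *)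
Definition intertwiner := \sum_i psi (delta_mx i i0) * V * phi (delta_mx i0 i).

Lemma range_intertwiner : B intertwiner.
Proof.
apply: range_emb_sum => // i _; apply: range_embM => //; last first.
  exact/phiB/range_munit.
by apply: range_embM => //; exact/psiB/range_munit.
Qed.

Let Vphi : V * phi (delta_mx i0 i0) = V.
Proof. by apply: partial_isometry_mulr => //; exact: munit_projection. Qed.

Let psiV : psi (delta_mx i0 i0) * V = V.
Proof. by rewrite -VV' -mulrA VV. Qed.

Lemma unitary_intertwiner : unitary intertwiner.
Proof.
split; rewrite /intertwiner star_sum mulr_suml.
- rewrite -(sum_munit phiP); apply: eq_bigr => i _.
  rewrite mulr_sumr (bigD1 i) //= big1 ?addr0 => [|j ji].
    rewrite !starM !star_munit // !mulrA -(mulrA _ (psi _) (psi _)) munitMid //.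
    by rewrite -(mulrA _ (psi _)) psiV -(mulrA _ (star V)) VV !munitMid.
  rewrite !starM !star_munit // !mulrA -(mulrA _ (psi _) (psi _)) munitM //.
  by rewrite eq_sym (negPf ji) scale0r mulr0 !mul0r.
- rewrite -(sum_munit psiP); apply: eq_bigr => i _.
  rewrite mulr_sumr (bigD1 i) //= big1 ?addr0 => [|j ji].
    rewrite !starM !star_munit // !mulrA -(mulrA _ (phi _) (phi _)) munitMid //.
    by rewrite -(mulrA _ V) Vphi -(mulrA _ V) VV' !munitMid.
  rewrite !starM !star_munit // !mulrA -(mulrA _ (phi _) (phi _)) munitM //.
  by rewrite eq_sym (negPf ji) scale0r mulr0 !mul0r.
Qed.

Lemma intertwiner_emb a : intertwiner * phi a = psi a * intertwiner.
Proof.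
have h i j : intertwiner * phi (delta_mx i j) = psi (delta_mx i j) * intertwiner.
  rewrite mulr_suml mulr_sumr (bigD1 i) //= big1 ?addr0 => [|k ki]; last first.
    by rewrite -mulrA munitM // (negPf ki) scale0r mulr0.
  rewrite [RHS](bigD1 j) //= big1 ?addr0 => [|k kj]; last first.
    by rewrite !mulrA munitM // eq_sym (negPf kj) scale0r !mul0r.
  by rewrite -mulrA munitMid // !mulrA munitMid.
rewrite (emb_sum_munit phiP) (emb_sum_munit psiP) mulr_sumr mulr_suml.
apply: eq_bigr => i _; rewrite mulr_sumr mulr_suml; apply: eq_bigr => j _.
by rewrite -scalerAr -scalerAl h.
Qed.

Lemma intertwiner_commutant c d : commutes_with (range phi) c ->
  commutes_with (range psi) d -> V * c = d * V ->
  intertwiner * c = d * intertwiner.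
Proof.
move=> cC dC Vc; rewrite mulr_suml mulr_sumr; apply: eq_bigr => i _.
rewrite -mulrA -cC; last exact: range_munit.
rewrite !mulrA -(mulrA _ V) Vc mulrA -dC //.

Qed.

End Conjugation.

(** * Towers of matrix algebras with rigid connecting maps *)

(* [w] records on which part of the multiplicity space of [f] the two blocks
   distinguished by [s] and [s'] are exchanged. *)
Definition sign_change (C : numClosedFieldType) (D : starAlgType C)
    (B B' : set D) (f : D -> D) (s s' w : D) :=
  [/\ B' w, symmetry w, commutes_with (f @` B) w & s' = f s * w].

(* An internal form of a generic system.  With the blocks 1, 2, 3, 4 at level [k],
   [tw_q] is the unit of the blocks 1, 2, and [tw_s k], [tw_t k] are the
   differences of the block projections 1, 2 and 3, 4. *)
Record tower (C : numClosedFieldType) (D : starAlgType C) := Tower {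
  tw_tau : D -> C;
  tw_size : nat -> nat;
  tw_emb : forall k, 'M[C]_(tw_size k) -> D;
  tw_q : D;
  tw_s : nat -> D;
  tw_t : nat -> D;
  tw_w : nat -> D;
  tw_w' : nat -> D;
  tw_tauP : normalised_trace tw_tau;
  tw_embP : forall k, mx_embedding (@tw_emb k);
  tw_incr : forall k, range (@tw_emb k) `<=` range (@tw_emb k.+1);
  tw_exhaust : forall x, exists k, range (@tw_emb k) x;
  tw_sP : forall k, half_sign (@tw_emb k) tw_q (tw_s k);
  tw_tP : forall k, half_sign (@tw_emb k) (1 - tw_q) (tw_t k);
  tw_wP : forall k, sign_change (range (@tw_emb k)) (range (@tw_emb k.+1)) id
    (tw_s k) (tw_s k.+1) (tw_w k);
  tw_w'P : forall k, sign_change (range (@tw_emb k)) (range (@tw_emb k.+1)) id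
    (tw_t k) (tw_t k.+1) (tw_w' k);
  tw_wC : forall k, tw_w k * tw_w' k = tw_w' k * tw_w k;
  tw_deg_neq0 : forall k, tw_tau (tw_w k * tw_w' k) != 0 }.

Arguments tw_emb {C D} t k _.

Section Tower.
Variables (C : numClosedFieldType) (D : starAlgType C) (T : tower D).
Implicit Types (f : D -> D) (x y u w : D) (k m l : nat).

Local Notation tau := (tw_tau T).
Local Notation q := (tw_q T).
Local Notation s := (tw_s T).
Local Notation t := (tw_t T).

Definition lvl k : set D := range (tw_emb T k).

Let tauP := tw_tauP T.
Let embP := tw_embP T.

Lemma lvl_mono k m : (k <= m)%N -> lvl k `<=` lvl m.
Proof.
move=> /subnK <-; elim: (m - k)%N => [|j IH] //.
by apply: subset_trans IH _; rewrite addSn; exact: tw_incr.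
Qed.

Lemma lvl_ex2 x y : exists k, lvl k x /\ lvl k y.
Proof.
have [i ix] := tw_exhaust T x; have [j jy] := tw_exhaust T y.
exists (maxn i j); split.
  exact: (lvl_mono (leq_maxl i j)).
exact: (lvl_mono (leq_maxr i j)).
Qed.

Lemma lvl_q k : lvl k q. Proof. exact: half_sign_range (embP k) (tw_sP T k). Qed.
Lemma lvl_s k : lvl k (s k). Proof. by case: (tw_sP T k). Qed.
Lemma lvl_t k : lvl k (t k). Proof. by case: (tw_tP T k). Qed.

Lemma q_projection : projection q.
Proof. exact: half_sign_projection (tw_sP T 0). Qed.

(** [tau \o f] is another normalised trace, and each matrix algebra carries only one. *)
Lemma tau_star_hom f x : unital_star_hom f -> tau (f x) = tau x.
Proof.
move=> fP; have [k [a _ <-]] := tw_exhaust T x.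
have -> : tau (f (tw_emb T k a)) = \tr a / (tw_size T k)%:R.
  exact: (tau_emb (normalised_trace_comp fP tauP) (embP k)).
by rewrite (tau_emb tauP (embP k)).
Qed.

Lemma tau_ge0 x : 0 <= tau (star x * x).
Proof.
by have [k kx] := tw_exhaust T x; exact: (tau_star_mul_ge0 tauP (embP k)).
Qed.

Lemma tau_eq0 x : tau (star x * x) = 0 -> x = 0.
Proof.
by have [k kx] := tw_exhaust T x; exact: (tau_star_mul_eq0 tauP (embP k)).
Qed.

Lemma lvl_image_emb f k : range (f \o tw_emb T k) = f @` lvl k.
Proof. by rewrite /lvl image_comp. Qed.

Lemma tau_mul_image f k x y : unital_star_hom f -> lvl k x ->
  commutes_with (f @` lvl k) y -> tau (f x * y) = tau x * tau y.
Proof.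
move=> fP kx yC; rewrite -(tau_star_hom x fP).
apply: (tau_mul_commutant tauP (mx_embedding_comp fP (embP k))).
  by rewrite lvl_image_emb; exists x.
by rewrite lvl_image_emb.
Qed.

(** The joint eigenprojections of [w] and [w'] correspond to the four types of summands of [f], and
    [tau (w * w')] is the degree divided by the multiplicity. *)
Definition rigid f k m w w' :=
  [/\ forall x, lvl k x -> lvl m (f x), f q = q,
      sign_change (lvl k) (lvl m) f (s k) (s m) w,
      sign_change (lvl k) (lvl m) f (t k) (t m) w' & w * w' = w' * w].

Lemma sign_change_comp f g (B1 B2 B3 : set D) s1 s2 s3 w v :
  unital_star_hom f -> unital_star_hom g ->
  (forall x y, B3 x -> B3 y -> B3 (x * y)) ->
  (forall x, B1 x -> B2 (f x)) -> (forall x, B2 x -> B3 (g x)) ->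
  sign_change B1 B2 f s1 s2 w -> sign_change B2 B3 g s2 s3 v ->
  sign_change B1 B3 (g \o f) s1 s3 (g w * v).
Proof.
move=> fP [[gL gM gS] g1] B3M fB gB [Bw [ws ww] wC ->] [Bv [vs vv] vC ->].
have vw : v * g w = g w * v by apply: vC; exists w.
split.
- by apply: B3M => //; exact: gB.
- split; first by rewrite starM vs -gS ws vw.
  by rewrite -mulrA (mulrA v) vw -(mulrA (g w)) vv mulr1 -gM ww g1.
- move=> _ [x B1x <-] /=; rewrite -mulrA vC; last by exists (f x) => //; exact: fB.
  by rewrite !mulrA -!gM wC //; exists x.
- by rewrite /= gM mulrA.
Qed.

Lemma lvlM k x y : lvl k x -> lvl k y -> lvl k (x * y).
Proof. exact: range_embM. Qed.

Lemma rigid_comp f g k m l w w' v v' :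
  unital_star_hom f -> unital_star_hom g ->
  rigid f k m w w' -> rigid g m l v v' ->
  rigid (g \o f) k l (g w * v) (g w' * v').
Proof.
move=> fP gP [fB fq fs ft ww] [gB gq gs gt vv]; split.
- by move=> x kx; apply: gB; exact: fB.
- by rewrite /= fq.
- by apply: sign_change_comp fs gs => //; exact: lvlM.
- by apply: sign_change_comp ft gt => //; exact: lvlM.
case: fs ft gs gt => [wB _ _ _] [w'B _ _ _] [_ _ vC _] [_ _ v'C _].
case: gP => [[_ gM _] _].
have c1 : v * g w' = g w' * v by apply: vC; exists w'.
have c2 : v' * g w = g w * v' by apply: v'C; exists w.
rewrite -mulrA (mulrA v) c1 -(mulrA (g w')) vv -[RHS]mulrA (mulrA v') c2.
by rewrite -(mulrA (g w)) !mulrA -!gM ww.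
Qed.

(** [v] and [v'] commute with the image of [lvl m] under [g], which contains [g w] and [g w'], so
    each trace factors by [tau_mul_image]. *)
Lemma tau_rigid_comp f g k m l w w' v v' :
  unital_star_hom f -> unital_star_hom g ->
  rigid f k m w w' -> rigid g m l v v' ->
  [/\ tau (g w * v) = tau w * tau v, tau (g w' * v') = tau w' * tau v' &
      tau (g w * v * (g w' * v')) = tau (w * w') * tau (v * v')].
Proof.
move=> fP gP [_ _ [wB _ _ _] [w'B _ _ _] _] [_ _ [_ _ vC _] [_ _ v'C _] _].
split; [exact: (tau_mul_image gP wB vC) | exact: (tau_mul_image gP w'B v'C) |].
rewrite -mulrA (mulrA v) vC; last by exists w'.
rewrite -(mulrA (g w')) mulrA; case: (gP) => [[_ gM _] _]; rewrite -gM.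
apply: (tau_mul_image gP); first exact: (lvlM wB w'B).
exact: (commutes_withM vC v'C).
Qed.

Lemma rigid_step k : rigid id k k.+1 (tw_w T k) (tw_w' T k).
Proof.
split=> //; [exact: lvl_mono | exact: tw_wP | exact: tw_w'P | exact: tw_wC].
Qed.

(** For a generic system the factors are [delta_j / p_j]: these are the partial products behind the
    coupling invariant, with signs kept. *)
Definition rho k m : C := \prod_(k <= j < m) tau (tw_w T j * tw_w' T j).

Lemma rho_neq0 k m : rho k m != 0.
Proof. by rewrite prodf_seq_neq0; apply/allP => j _; exact: tw_deg_neq0. Qed.

Lemma rhoM k m l : (k <= m)%N -> (m <= l)%N -> rho k m * rho m l = rho k l.
Proof. by move=> km ml; apply/esym/big_cat_nat. Qed.

Lemma rigid_id k m : (k <= m)%N ->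
  exists w w', rigid id k m w w' /\ tau (w * w') = rho k m.
Proof.
move=> /subnK <-; elim: (m - k)%N => [|j [w [w' [h tw]]]].
  exists 1, 1; rewrite /rho big_geq // mulr1 (tau1 tauP); split=> //.
  have h s0 : sign_change (lvl k) (lvl k) id s0 s0 1.
    split; rewrite ?mulr1 //; first exact: range_emb1.
      by split; rewrite ?star_1 ?mulr1.
    exact: commutes_with1.
  by split; rewrite ?mulr1.
have := rigid_comp (unital_star_hom_id _) (unital_star_hom_id _) h (rigid_step _).
have [] := tau_rigid_comp (unital_star_hom_id _) (unital_star_hom_id _) h
  (rigid_step _).
move=> _ _ /= E h'; eexists; eexists; split; first exact: h'.
by rewrite E tw /rho addSn big_nat_recr //= leq_addl.
Qed.

(* rigid, with trivial K_0-part: only the homology class is left *)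
Definition rigid_deg f k m c := exists w w',
  [/\ rigid f k m w w', tau w = 0, tau w' = 0 & tau (w * w') = c].

Lemma rigid_unique f k m w w' v v' : unital_star_hom f ->
  rigid f k m w w' -> rigid f k m v v' -> w = v /\ w' = v'.
Proof.
move=> fP [_ fq [_ _ wC ws] [_ _ w'C wt] _] [_ _ [_ _ vC vs] [_ _ v'C vt] _].
have eP := mx_embedding_comp fP (embP k).
split.
- apply: (half_sign_eq eP (half_sign_comp fP (tw_sP T k))); rewrite ?lvl_image_emb //.
  by rewrite -ws -vs.
- apply: (half_sign_eq eP (half_sign_comp fP (tw_tP T k))); rewrite ?lvl_image_emb //.
  by rewrite -wt -vt.
Qed.

Lemma rigid_deg_unique f k m c d : unital_star_hom f ->
  rigid_deg f k m c -> rigid_deg f k m d -> c = d.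
Proof.
move=> fP [w [w' [h _ _ <-]]] [v [v' [h' _ _ <-]]].
by have [-> ->] := rigid_unique fP h h'.
Qed.

Lemma rigid_deg_compr f g k m l c v v' :
  unital_star_hom f -> unital_star_hom g ->
  rigid_deg f k m c -> rigid g m l v v' ->
  rigid_deg (g \o f) k l (c * tau (v * v')).
Proof.
move=> fP gP [w [w' [h w0 w'0 <-]]] h'.
have [E1 E2 E3] := tau_rigid_comp fP gP h h'.
exists (g w * v), (g w' * v'); split=> //; first exact: (rigid_comp fP gP h h').
  by rewrite E1 w0 mul0r.
by rewrite E2 w'0 mul0r.
Qed.

Lemma rigid_deg_compl f g k m l c w w' :
  unital_star_hom f -> unital_star_hom g ->
  rigid f k m w w' -> rigid_deg g m l c ->
  rigid_deg (g \o f) k l (tau (w * w') * c).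
Proof.
move=> fP gP h [v [v' [h' v0 v'0 <-]]].
have [E1 E2 E3] := tau_rigid_comp fP gP h h'.
exists (g w * v), (g w' * v'); split=> //; first exact: (rigid_comp fP gP h h').
  by rewrite E1 v0 mulr0.
by rewrite E2 v'0 mulr0.
Qed.

Lemma rigid_deg_comp f g k m l c d :
  unital_star_hom f -> unital_star_hom g ->
  rigid_deg f k m c -> rigid_deg g m l d -> rigid_deg (g \o f) k l (c * d).
Proof.
by move=> fP gP fc [v [v' [h _ _ <-]]]; exact: rigid_deg_compr h.
Qed.

Lemma rigid_deg_widen f k m l c : unital_star_hom f -> (m <= l)%N ->
  rigid_deg f k m c -> rigid_deg f k l (c * rho m l).
Proof.
move=> fP /rigid_id[v [v' [h <-]]] fc.
exact: (rigid_deg_compr fP (unital_star_hom_id _) fc h).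
Qed.

Lemma rigid_deg_restrict f k j m c : unital_star_hom f -> (k <= j)%N ->
  rigid_deg f j m c -> rigid_deg f k m (rho k j * c).
Proof.
move=> fP /rigid_id[v [v' [h <-]]] fc.
exact: (rigid_deg_compl (unital_star_hom_id _) fP h fc).
Qed.

Lemma eq_rigid f g k m w w' : (forall x, lvl k x -> f x = g x) ->
  rigid f k m w w' -> rigid g k m w w'.
Proof.
move=> fg [fB fq [wB wS wC ws] [w'B w'S w'C wt] ww]; split=> //.
- by move=> x kx; rewrite -fg //; exact: fB.
- by rewrite -fg //; exact: lvl_q.
- split=> //; last by rewrite -fg //; exact: lvl_s.
  by move=> _ [x kx <-]; rewrite -fg //; apply: wC; exists x.
- split=> //; last by rewrite -fg //; exact: lvl_t.
  by move=> _ [x kx <-]; rewrite -fg //; apply: w'C; exists x.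
Qed.

Lemma eq_rigid_deg f g k m c : (forall x, lvl k x -> f x = g x) ->
  rigid_deg f k m c -> rigid_deg g k m c.
Proof.
by move=> fg [w [w' [h ? ? ?]]]; exists w, w'; split=> //; exact: eq_rigid h.
Qed.

End Tower.

(* the K_0-part of long compositions is trivial, as [D1] and [D2] are matroid *)
Record balanced_tower (C : numClosedFieldType) (D : starAlgType C) := BalancedTower {
  bt_tower :> tower D;
  bt_balanced_s : forall k, exists m w, [/\ (k <= m)%N, tw_tau bt_tower w = 0 &
    sign_change (lvl bt_tower k) (lvl bt_tower m) id
      (tw_s bt_tower k) (tw_s bt_tower m) w];
  bt_balanced_t : forall k, exists m w, [/\ (k <= m)%N, tw_tau bt_tower w = 0 &
    sign_change (lvl bt_tower k) (lvl bt_tower m) id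
      (tw_t bt_tower k) (tw_t bt_tower m) w] }.

Section Balanced.
Variables (C : numClosedFieldType) (D : starAlgType C) (T : balanced_tower D).
Implicit Types (f : D -> D) (k m : nat).
Local Notation tau := (tw_tau T).
Local Notation s := (tw_s T).
Local Notation t := (tw_t T).
Local Notation lvl := (lvl T).
Local Notation rho := (rho T).
Local Notation rigid := (rigid T).
Local Notation rigid_deg := (rigid_deg T).
Let tauP := tw_tauP T.
Let embP := tw_embP T.

(** Composing with an inclusion whose symmetries have trace zero makes both traces vanish. Trace
    zero for [s] and for [t] may occur at different levels; uniqueness of the symmetries makes each
    a factor of those of every later level. *)
Lemma balanced_deg k : exists2 m0, (k <= m0)%N &
  forall f j m w w', unital_star_hom f -> (m0 <= m)%N -> rigid f j k w w' ->
  rigid_deg f j m (tau (w * w') * rho k m).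
Proof.
have [m1 [v1 [km1 v10 h1]]] := bt_balanced_s T k.
have [m2 [v2 [km2 v20 h2]]] := bt_balanced_t T k.
exists (maxn m1 m2); first by rewrite leq_max km1.
move=> f j m w w' fP; rewrite geq_max => /andP[m1m m2m] h.
suff hid : rigid_deg id k m (rho k m).
  exact: (rigid_deg_compl fP (unital_star_hom_id _) h hid).
have idP := unital_star_hom_id D.
have km : (k <= m)%N by exact: leq_trans m1m.
have [w0 [w0' [h0 t0]]] := rigid_id T km.
have lm k1 k2 : (k1 <= k2)%N -> forall x, lvl k1 x -> lvl k2 (id x) by exact: lvl_mono.
have [z1 [z1' [hz1 _]]] := rigid_id T m1m.
have [z2 [z2' [hz2 _]]] := rigid_id T m2m.
exists w0, w0'; split=> //.
- case: hz1 => _ _ hz _ _.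
  have : sign_change (lvl k) (lvl m) id (s k) (s m) (v1 * z1).
    exact: (sign_change_comp idP idP (@lvlM _ _ T m) (lm _ _ km1) (lm _ _ m1m) h1 hz).
  case: (h0) => _ _ [_ _ c0 e0] _ _ [_ _ c1 e1].
  rewrite image_id in c0 c1.
  rewrite (half_sign_eq (embP k) (tw_sP T k) c0 c1) -?e0 //.
  case: hz h1 => _ _ cz _ [Bv _ _ _]; rewrite image_id in cz.
  by rewrite (tau_mul_commutant tauP (embP m1)) // v10 mul0r.
- case: hz2 => _ _ _ hz _.
  have : sign_change (lvl k) (lvl m) id (t k) (t m) (v2 * z2').
    exact: (sign_change_comp idP idP (@lvlM _ _ T m) (lm _ _ km2) (lm _ _ m2m) h2 hz).
  case: (h0) => _ _ _ [_ _ c0 e0] _ [_ _ c1 e1].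
  rewrite image_id in c0 c1.
  rewrite (half_sign_eq (embP k) (tw_tP T k) c0 c1) -?e0 //.
  case: hz h2 => _ _ cz _ [Bv _ _ _]; rewrite image_id in cz.
  by rewrite (tau_mul_commutant tauP (embP m2)) // v20 mul0r.
Qed.

Lemma rigid_deg_id k : exists2 m0, (k <= m0)%N &
  forall m, (m0 <= m)%N -> rigid_deg id k m (rho k m).
Proof.
have [m0 km0 h] := balanced_deg k; exists m0 => // m m0m.
have [w [w' [hw tw]]] := rigid_id T (leqnn k).
have := h _ _ _ _ _ (unital_star_hom_id _) m0m hw.
by rewrite tw rhoM //; exact: leq_trans m0m.
Qed.

End Balanced.

(** * Spectral projections of commuting symmetries *)

Section Halves.
Variables (C : numClosedFieldType) (D : starAlgType C).
Implicit Types (x y w v p q : D) (a b : bool).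

Lemma projectionM p q : projection p -> projection q -> p * q = q * p ->
  projection (p * q).
Proof.
move=> [ps pp] [qs qq] pq; split; first by rewrite starM ps qs.
by rewrite mulrA -(mulrA p q) -pq mulrA pp -mulrA qq.
Qed.

(** The spectral projection of the symmetry [w] for the eigenvalue [(-1) ^+ a]. *)
Definition half w a : D := locked (2^-1 *: (1 + (-1) ^+ a *: w)).

Lemma halfE w a : half w a = 2^-1 *: (1 + (-1) ^+ a *: w).
Proof. by rewrite /half -lock. Qed.

Lemma star_half w a : star w = w -> star (half w a) = half w a.
Proof.
move=> ws; rewrite halfE starZ starD star_1 starZ ws rmorph_sign.
by rewrite conj_Creal ?realV ?realn.
Qed.

Lemma halfM w a : w * w = 1 -> w * half w a = (-1) ^+ a *: half w a.
Proof.
move=> ww; rewrite halfE -scalerAr scalerA mulrC -scalerA; congr (_ *: _).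
rewrite mulrDr mulr1 -scalerAr ww scalerDr scalerA -signr_addb addbb scale1r.
by rewrite addrC.
Qed.

Lemma half_half w a b : w * w = 1 ->
  half w a * half w b = (a == b)%:R *: half w b.
Proof.
move=> ww; rewrite [half w a]halfE -scalerAl mulrDl mul1r -scalerAl halfM //.
rewrite scalerA -{1}[half w b]scale1r -scalerDl scalerA; congr (_ *: _).
by case: a b => [] []; rewrite /= ?expr1 ?expr0 ?mulNr ?mulrN ?mulr1 ?mul1r
  ?opprK ?subrr ?addNr ?mulr0 // mulVf // pnatr_eq0.
Qed.

Lemma half_projection w a : symmetry w -> projection (half w a).
Proof.
by move=> [ws ww]; split; rewrite ?star_half // half_half // eqxx scale1r.
Qed.

Lemma sum_half w : \sum_a half w a = 1.
Proof.
rewrite big_bool /= !halfE -scalerDr /= expr1 expr0 scaleN1r scale1r.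
by rewrite addrACA addNr addr0 scaler_half.
Qed.

Lemma range_half r (g : 'M[C]_r -> D) w a : mx_embedding g -> range g w ->
  range g (half w a).
Proof.
move=> gP Bw; rewrite halfE; apply: range_embZ => //; apply: range_embD => //.
  exact: range_emb1.
exact: range_embZ.
Qed.

Lemma half_commutes X w a : commutes_with X w -> commutes_with X (half w a).
Proof.
move=> wX; rewrite halfE; apply/commutes_withZ/commutes_withD; last exact: commutes_withZ.
exact: commutes_with1.
Qed.

Lemma half_commute w v a : w * v = v * w -> half w a * v = v * half w a.
Proof.
by move=> wv; have := @half_commutes [set v] w a; apply=> // _ ->.
Qed.

Lemma tau_half2 tau w v a b : normalised_trace tau ->
  tau (half w a * half v b) = 4^-1 * (1 + (-1) ^+ a * tau w +
    (-1) ^+ b * tau v + (-1) ^+ a * (-1) ^+ b * tau (w * v)).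
Proof.
move=> tauP; rewrite !halfE -scalerAl -scalerAr scalerA (tauZ tauP); congr (_ * _).
  by rewrite -invfM -natrM.
rewrite mulrDl mul1r mulrDr mulr1 -scalerAl -scalerAr scalerA.
by rewrite !(tauD tauP) !(tauZ tauP) (tau1 tauP) addrACA -!addrA; congr (_ + _); rewrite addrCA.
Qed.

End Halves.

Section JointProjections.
Variables (C : numClosedFieldType) (D : starAlgType C).
Variables (e w w' : D).
Hypotheses (eP : projection e) (wP : symmetry w) (w'P : symmetry w').
Hypotheses (ww' : w * w' = w' * w) (we : w * e = e * w) (w'e : w' * e = e * w').
Local Notation p ab := (e * (half w ab.1 * half w' ab.2)).

Let hh a b : half w a * half w' b = half w' b * half w a.
Proof. by apply: half_commute; apply/esym/half_commute. Qed.

Let hC ab : (half w ab.1 * half w' ab.2) * e = e * (half w ab.1 * half w' ab.2).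
Proof. by rewrite -mulrA (half_commute _ w'e) !mulrA (half_commute _ we). Qed.

Lemma joint_projection ab : projection (p ab).
Proof.
apply: projectionM; rewrite ?hC //.
by apply: projectionM => //; exact: half_projection.
Qed.

Lemma joint_mul ab cd : p ab * p cd = (ab == cd)%:R *: p cd.
Proof.
rewrite mulrA -(mulrA e) hC (mulrA e e); case: (eP) => _ ->.
rewrite -!mulrA scalerAr; congr (e * _).
rewrite (mulrA (half w' _)) -hh -!mulrA [in LHS]half_half; last by case: w'P.
rewrite -!scalerAr mulrA half_half; last by case: wP.
by rewrite -scalerAl [LHS]scalerA -natrM mulnb andbC.
Qed.

Lemma joint_orthogonal ab cd : ab != cd -> p ab * p cd = 0.
Proof. by move=> /negPf abcd; rewrite joint_mul abcd scale0r. Qed.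

Lemma sum_joint : \sum_ab p ab = e.
Proof.
rewrite -mulr_sumr -(pair_bigA _ (fun a b => half w a * half w' b)) /=.
rewrite (eq_bigr (fun a => half w a)) => [|a _]; last first.
  by rewrite -mulr_sumr sum_half mulr1.
by rewrite sum_half mulr1.
Qed.

Lemma joint_w ab : w * p ab = (-1) ^+ ab.1 *: p ab.
Proof.
rewrite mulrA we -mulrA (mulrA w) halfM; last by case: wP.
by rewrite -scalerAl -scalerAr.
Qed.

Lemma joint_w' ab : w' * p ab = (-1) ^+ ab.2 *: p ab.
Proof.
rewrite mulrA w'e -mulrA hh (mulrA w') halfM; last by case: w'P.
by rewrite -scalerAl -scalerAr.
Qed.

Lemma joint_wr ab : p ab * w = (-1) ^+ ab.1 *: p ab.
Proof.
have [[ps _] [ws _]] := (joint_projection ab, wP).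
by have := congr1 star (joint_w ab); rewrite starM starZ ps ws rmorph_sign.
Qed.

Lemma joint_wr' ab : p ab * w' = (-1) ^+ ab.2 *: p ab.
Proof.
have [[ps _] [ws _]] := (joint_projection ab, w'P).
by have := congr1 star (joint_w' ab); rewrite starM starZ ps ws rmorph_sign.
Qed.

End JointProjections.

(* Commuting symmetries with the same spectral data are conjugate: match their
   joint spectral projections. *)
Lemma symmetry_pair_conj (C : numClosedFieldType) (D : starAlgType C)
    (tau : D -> C) n (g : 'M[C]_n -> D) (e w w' d v v' : D) :
  normalised_trace tau -> mx_embedding g ->
  range g e -> range g w -> range g w' -> range g d -> range g v -> range g v' ->
  projection e -> symmetry w -> symmetry w' ->
  projection d -> symmetry v -> symmetry v' ->
  w * w' = w' * w -> w * e = e * w -> w' * e = e * w' ->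
  v * v' = v' * v -> v * d = d * v -> v' * d = d * v' ->
  (forall a b, tau (e * (half w a * half w' b)) = tau (d * (half v a * half v' b))) ->
  exists V, [/\ range g V, star V * V = e, V * star V = d,
    V * w = v * V & V * w' = v' * V].
Proof.
move=> tauP gP Be Bw Bw' Bd Bv Bv' eP wP w'P dP vP v'P ww' we w'e vv' vd v'd tauE.
have Bp (e0 w0 w1 : D) (ab : bool * bool) : range g e0 -> range g w0 -> range g w1 ->
    range g (e0 * (half w0 ab.1 * half w1 ab.2)).
  move=> B0 B1 B2; apply: range_embM => //.
  by apply: range_embM => //; exact: range_half.
have [V [BV VV VV' pV]] := orthogonal_families_conj tauP gP
  (fun ab => Bp e w w' ab Be Bw Bw') (fun ab => Bp d v v' ab Bd Bv Bv')
  (joint_projection eP wP w'P ww' we w'e)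
  (joint_projection dP vP v'P vv' vd v'd)
  (joint_orthogonal eP wP w'P ww' we w'e)
  (joint_orthogonal dP vP v'P vv' vd v'd) (fun ab => tauE ab.1 ab.2).
rewrite sum_joint in VV; rewrite sum_joint in VV'.
have VP : V * e = V by exact: (partial_isometry_mulr tauP gP BV eP VV).
have PV : d * V = V by rewrite -VV' -mulrA VV.
exists V; split=> //.
- rewrite -{1}VP -{2}PV -{1}(sum_joint e w w') -(sum_joint d v v').
  rewrite mulr_sumr !mulr_suml mulr_sumr; apply: eq_bigr => ab _.
  rewrite -mulrA joint_wr // [RHS]mulrA joint_w // -scalerAl -scalerAr.
  by rewrite pV.
- rewrite -{1}VP -{2}PV -{1}(sum_joint e w w') -(sum_joint d v v').
  rewrite mulr_sumr !mulr_suml mulr_sumr; apply: eq_bigr => ab _.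
  rewrite -mulrA joint_wr' // [RHS]mulrA joint_w' // -scalerAl -scalerAr.
  by rewrite pV.
Qed.

(** * Rigid maps of equal degree are conjugate *)

Section TowerConj.
Variables (C : numClosedFieldType) (D : starAlgType C) (T : tower D).
Implicit Types (f : D -> D) (x y u z w : D) (k m l : nat).

Local Notation tau := (tw_tau T).
Local Notation q := (tw_q T).
Local Notation s := (tw_s T).
Local Notation t := (tw_t T).
Local Notation lvl := (lvl T).
Let tauP := tw_tauP T.
Let embP := tw_embP T.

(** The unitaries of the algebra of block diagonal matrices at level [m], hence of [D1 (+) D2]. *)
Definition diagonal_unitary m z :=
  [/\ unitary z, lvl m z, z * q = q * z, z * s m = s m * z & z * t m = t m * z].

(** The joint spectral projections of [w], [w'] under a minimal projection have traces depending
    only on [c], so they can be moved onto those of [v], [v'] inside [lvl m]. The resulting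
    intertwiner commutes with the signs of level [m] because [s m] is both [f (s k) * w] and
    [f' (s k) * v], and likewise for [t m]. *)
Lemma rigid_deg_conj f f' k m c : unital_star_hom f -> unital_star_hom f' ->
  rigid_deg T f k m c -> rigid_deg T f' k m c ->
  exists z, diagonal_unitary m z /\ forall x, lvl k x -> z * f x = f' x * z.
Proof.
move=> fP f'P [w [w' [h w0 w'0 wc]]] [v [v' [h' v0 v'0 vc]]].
have r0 : (0 < tw_size T k)%N by case: (embP k).
pose i0 := Ordinal r0.
case: h => fB fq [Bw wP wC ws] [Bw' w'P w'C wt] ww'.
case: h' => f'B f'q [Bv vP vC vs] [Bv' v'P v'C vt] vv'.
have phP := mx_embedding_comp fP (embP k).
have psP := mx_embedding_comp f'P (embP k).
have phB : range (f \o tw_emb T k) `<=` range (tw_emb T m).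
  by move=> _ [a _ <-]; apply: fB; exists a.
have psB : range (f' \o tw_emb T k) `<=` range (tw_emb T m).
  by move=> _ [a _ <-]; apply: f'B; exists a.
have ke0 : lvl k (tw_emb T k (delta_mx i0 i0)) by exact: range_munit.
have fe0 f0 : (f0 @` lvl k) (f0 (tw_emb T k (delta_mx i0 i0))).
  by exists (tw_emb T k (delta_mx i0 i0)).
have tauE f0 w1 w2 a b : unital_star_hom f0 -> commutes_with (f0 @` lvl k) w1 ->
    commutes_with (f0 @` lvl k) w2 -> tau w1 = 0 -> tau w2 = 0 ->
    tau (w1 * w2) = c ->
    tau (f0 (tw_emb T k (delta_mx i0 i0)) * (half w1 a * half w2 b)) =
    tau (tw_emb T k (delta_mx i0 i0)) * (4^-1 * (1 + (-1) ^+ a * (-1) ^+ b * c)).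
  move=> f0P c1 c2 t1 t2 t12.
  rewrite (tau_mul_image f0P ke0); last by apply: commutes_withM; exact: half_commutes.
  by rewrite tau_half2 // t1 t2 t12 !mulr0 !addr0.
have [V [BV VV VV' Vw Vw']] := symmetry_pair_conj tauP (embP m)
  (fB _ ke0) Bw Bw' (f'B _ ke0) Bv Bv' (munit_projection phP i0) wP w'P
  (munit_projection psP i0) vP v'P ww' (wC _ (fe0 f)) (w'C _ (fe0 f))
  vv' (vC _ (fe0 f')) (v'C _ (fe0 f'))
  (fun a b => etrans (tauE f w w' a b fP wC w'C w0 w'0 wc)
     (esym (tauE f' v v' a b f'P vC v'C v0 v'0 vc))).
pose z := intertwiner (f \o tw_emb T k) (f' \o tw_emb T k) i0 V.
have zf x : lvl k x -> z * f x = f' x * z.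
  by move=> [a _ <-]; exact: (intertwiner_emb phP psP i0 V a).
rewrite -lvl_image_emb in wC w'C; rewrite -lvl_image_emb in vC v'C.
have zw : z * w = v * z by exact: (intertwiner_commutant i0 wC vC Vw).
have zw' : z * w' = v' * z by exact: (intertwiner_commutant i0 w'C v'C Vw').
exists z; split=> //; split.
- exact: (unitary_intertwiner tauP (embP m) phP psP BV VV VV').
- exact: (range_intertwiner (embP m) phB psB i0 BV).
- by have := zf q (lvl_q T k); rewrite fq f'q.
- rewrite {1}ws vs mulrA zf ?mulrA; last exact: lvl_s.
  by rewrite -mulrA zw mulrA.
- rewrite {1}wt vt mulrA zf ?mulrA; last exact: lvl_t.
  by rewrite -mulrA zw' mulrA.
Qed.

Lemma rigid_Ad m z : diagonal_unitary m z -> rigid T (Ad z) m m 1 1.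
Proof.
move=> [[z1 z2] Bz zq zs zt].
have Azx x : z * x = x * z -> Ad z x = x by move=> zx; rewrite /Ad zx -mulrA z2 mulr1.
split; rewrite ?mulr1 //.
- move=> x Bx; apply: lvlM; first exact: lvlM.
  exact: range_emb_star.
- exact: Azx.
- split; rewrite ?mulr1 ?Azx //; first exact: range_emb1.
    by split; rewrite ?star_1 ?mulr1.
  exact: commutes_with1.
- split; rewrite ?mulr1 ?Azx //; first exact: range_emb1.
    by split; rewrite ?star_1 ?mulr1.
  exact: commutes_with1.
Qed.

End TowerConj.

(** * Automorphisms preserving the blocks are eventually rigid *)

Section BlockSign.
Variables (C : numClosedFieldType) (D : starAlgType C).
Implicit Types (x y w q s : D) (f g : D -> D).

Lemma commutes_with_star r (g : 'M[C]_r -> D) y : mx_embedding g ->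
  commutes_with (range g) y -> commutes_with (range g) (star y).
Proof.
move=> gP yC x Bx; apply: (inv_inj (@starK _ D)).
by rewrite !starM starK yC //; exact: range_emb_star.
Qed.

Lemma in_blocks_lin (B : set D) q s a x y :
  (forall c u v, B u -> B v -> B (c *: u + v)) ->
  in_blocks B q s x -> in_blocks B q s y -> in_blocks B q s (a *: x + y).
Proof.
move=> BL [Bx qx xq xs] [By qy yq ys]; split; first exact: BL.
- by rewrite mulrDr -scalerAr qx qy.
- by rewrite mulrDl -scalerAl xq yq.
- by rewrite mulrDl mulrDr -scalerAl -scalerAr xs ys.
Qed.

(* If [g \o f = id] and both maps respect the blocks, write the sign element of
   each level as [q a + f(s) b] with [a], [b] in the relative commutant.  The
   composite being rigid, both [a]-parts must vanish. *)
Lemma block_sign_change r1 r2 r3 (g1 : 'M[C]_r1 -> D) (g2 : 'M[C]_r2 -> D)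
    (g3 : 'M[C]_r3 -> D) f g q s1 s2 s3 w :
  mx_embedding g1 -> mx_embedding g2 -> mx_embedding g3 ->
  unital_star_hom f -> unital_star_hom g -> cancel f g -> injective g ->
  f q = q -> g q = q ->
  (forall x, range g1 x -> range g2 (f x)) -> (forall x, range g2 x -> range g3 (g x)) ->
  (forall x, in_blocks (range g1) q s1 x -> in_blocks (range g2) q s2 (f x)) ->
  (forall x, in_blocks (range g2) q s2 x -> in_blocks (range g3) q s3 (g x)) ->
  half_sign g1 q s1 -> half_sign g2 q s2 -> half_sign g3 q s3 ->
  sign_change (range g1) (range g3) id s1 s3 w ->
  exists b1 b2, [/\ sign_change (range g1) (range g2) f s1 s2 b1,
    sign_change (range g2) (range g3) g s2 s3 b2 & g b1 * b2 = w].
Proof.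
move=> e1 e2 e3 fP gP fgK gI fq gq f12 g23 fb gb h1 h2 h3.
move=> [Bw [ws ww] wC s3w]; rewrite image_id in wC.
have dec h r r' (k : 'M[C]_r -> D) (k' : 'M[C]_r' -> D) s s' :
    mx_embedding k -> mx_embedding k' -> unital_star_hom h -> injective h -> h q = q ->
    (forall x, range k x -> range k' (h x)) ->
    (forall x, in_blocks (range k) q s x -> in_blocks (range k') q s' (h x)) ->
    half_sign k q s -> half_sign k' q s' ->
    exists a b, [/\ range k' a, range k' b, commutes_with (range (h \o k)) a,
      commutes_with (range (h \o k)) b & s' = q * a + h s * b].
  move=> kP k'P hP hI hq hk hb ks k's.
  have hs' := half_sign_comp hP ks; rewrite hq in hs'.
  have [Bs' _ _ qs' _] := k's.
  apply: (block_commutant (mx_embedding_comp hP kP) k'P _ hs') => //.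
  - by move=> _ [a _ <-]; apply: hk; exists a.
  - exact: half_sign_mulr k's.
  move=> x [[a _ <-] qx xq xs].
  case: (hP) => [[_ hM _] _].
  have [_ _ _ ->] // : in_blocks (range k') q s' (h (k a)).
  apply: hb; split; first by exists a.
  - by apply: hI; rewrite hM hq.
  - by apply: hI; rewrite hM hq.
  - by apply: hI; rewrite !hM.
have fI : injective f := can_inj fgK.
have [a1 [b1 [Ba1 Bb1 a1C b1C s2E]]] := dec _ _ _ _ _ _ _ e1 e2 fP fI fq f12 fb h1 h2.
have [a2 [b2 [Ba2 Bb2 a2C b2C s3E]]] := dec _ _ _ _ _ _ _ e2 e3 gP gI gq g23 gb h2 h3.
have [[gL gM gS] g1'] := gP; have g0 := linear_fun0 gL.
have b2g y : range g2 y -> b2 * g y = g y * b2.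
  by move=> [a _ <-]; apply: b2C; exists a.
have a2g y : range g2 y -> a2 * g y = g y * a2.
  by move=> [a _ <-]; apply: a2C; exists a.
have incl1 x : range g1 x -> exists2 y, range g2 y & g y = x.
  by move=> rx; exists (f x); [exact: f12 | exact: fgK].
have comm1 y : commutes_with (range (g \o g2)) y -> commutes_with (range g1) y.
  by move=> yC _ /incl1[_ [a _ <-] <-]; apply: yC; exists a.
have gcomm1 y : commutes_with (range (f \o g1)) y -> commutes_with (range g1) (g y).
  by move=> yC _ [a _ <-]; rewrite -(fgK (g1 a)) -!gM yC.
have [c0 cw] : a2 + g a1 * b2 = 0 /\ g b1 * b2 = w.
  apply: (half_sign_inj e1 h1).
  - apply: commutes_withD; first exact: comm1.
    by apply: commutes_withM; [exact: gcomm1 | exact: comm1].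
  - by apply: commutes_withM; [exact: gcomm1 | exact: comm1].
  - by move=> x _; rewrite mul0r mulr0.
  - by [].
  rewrite mulr0 add0r -[RHS]s3w s3E s2E (linear_funD gL) !gM gq fgK.
  by rewrite mulrDl mulrDr !mulrA addrA.
have hg := half_sign_comp gP h2; rewrite gq in hg.
have geP := mx_embedding_comp gP e2.
have [Bs2 s2s s22 qs2 _] := h2; have [Bs3 s3s s33 qs3 _] := h3.
have [qq sq] : q * q = q /\ s2 * q = s2.
  split; first by case: (half_sign_projection h2).
  exact: half_sign_mulr h2.
have a2q : a2 * q = q * a2 by rewrite -{1}gq a2g ?gq //; exact: half_sign_range h2.
have b2q : b2 * q = q * b2 by rewrite -{1}gq b2g ?gq //; exact: half_sign_range h2.
(* The coefficients of [q] and [g s2] in [s3 * s3 = q]. *)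
have [sq1 sq2] : a2 * a2 + b2 * b2 = 1 /\ a2 * b2 + b2 * a2 = 0.
  apply: (half_sign_inj geP hg).
  - by apply: commutes_withD; apply: commutes_withM.
  - by apply: commutes_withD; apply: commutes_withM.
  - exact: commutes_with1.
  - by move=> x _; rewrite mul0r mulr0.
  have a2s : a2 * g s2 = g s2 * a2 by exact: a2g.
  have b2s' : b2 * g s2 = g s2 * b2 by exact: b2g.
  have qgs : q * g s2 = g s2 by rewrite -{1}gq -gM qs2.
  have gsq : g s2 * q = g s2 by rewrite -{1}gq -gM sq.
  have p1 : q * a2 * (q * a2) = q * (a2 * a2).
    by rewrite mulrA -(mulrA q) a2q mulrA qq -mulrA.
  have p2 : q * a2 * (g s2 * b2) = g s2 * (a2 * b2).
    by rewrite mulrA -(mulrA q) a2s mulrA qgs -mulrA.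
  have p3 : g s2 * b2 * (q * a2) = g s2 * (b2 * a2).
    by rewrite mulrA -(mulrA (g s2)) b2q mulrA gsq -mulrA.
  have p4 : g s2 * b2 * (g s2 * b2) = q * (b2 * b2).
    by rewrite mulrA -(mulrA (g s2)) b2s' mulrA -gM s22 gq -mulrA.
  rewrite mulr1 mulr0 addr0 -[RHS]s33 s3E mulrDl !mulrDr p1 p2 p3 p4.
  by rewrite [LHS]addrACA; congr (_ + _); exact: addrC.
have a2E : a2 = - (g a1 * b2) by apply/eqP; rewrite -addr_eq0 c0.
have ga1b2 : b2 * g a1 = g a1 * b2 by exact: b2g.
have wb : w * b2 = b2 * w by rewrite -cw mulrA -(b2g b1).
(* With [a2 = - g a1 * b2], the relation [a2 * b2 + b2 * a2 = 0] says that [g a1] annihilates the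
   square of [b2], which is invertible because [w * w = 1]. *)
have ga0 : g a1 = 0.
  have h0 : g a1 * (b2 * b2) = 0.
    have e0 : a2 * b2 = - (g a1 * (b2 * b2)) by rewrite a2E mulNr mulrA.
    have e4 : b2 * a2 = - (g a1 * (b2 * b2)).
      by rewrite a2E mulrN (mulrA b2) ga1b2 -mulrA.
    move: sq2; rewrite e0 e4 -opprD => /eqP; rewrite oppr_eq0 => /eqP hh.
    by rewrite -[LHS]scaler_half hh scaler0.
  have : b2 * b2 * (g b1 * g b1) = 1.
    have bw : b2 * g b1 = w by rewrite b2g.
    by rewrite -mulrA (mulrA b2 (g b1)) bw (mulrA b2 w) -wb -mulrA bw.
  move=> hb; rewrite -[g a1]mulr1 -hb mulrA h0 mul0r.
  by [].
have a10 : a1 = 0 by apply: gI; rewrite ga0 g0.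
have a20 : a2 = 0 by rewrite a2E ga0 mul0r oppr0.
have b22 : b2 * b2 = 1 by rewrite -sq1 a20 mul0r add0r.
have s3g : s3 = g s2 * b2 by rewrite s3E a20 mulr0 add0r.
have b2s : star b2 = b2.
  apply: (half_sign_eq geP hg) => //.
    exact: commutes_with_star.
  by rewrite -s3g -s3s s3g starM -gS s2s (commutes_with_star geP b2C) //; case: Bs2 => a _ <-; exists a.
have gb1 : g b1 = w * b2 by rewrite -cw -mulrA b22 mulr1.
exists b1, b2; split=> //.
- split=> //.
  + split; apply: gI.
      by rewrite gS gb1 starM ws b2s.
    by rewrite gM gb1 g1' -mulrA (mulrA b2) -wb -(mulrA w b2) b22 mulr1.
  + by move: b1C; rewrite image_comp.
  + by rewrite s2E a10 mulr0 add0r.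
- split=> //.
  by move: b2C; rewrite image_comp.
Qed.

End BlockSign.

Section BlockAutomorphism.
Variables (C : numClosedFieldType) (D : starAlgType C) (T : tower D).
Implicit Types (x y u z w : D) (k m l : nat).

Local Notation tau := (tw_tau T).
Local Notation q := (tw_q T).
Local Notation s := (tw_s T).
Local Notation t := (tw_t T).
Local Notation lvl := (lvl T).
Let tauP := tw_tauP T.
Let embP := tw_embP T.

Definition block1 x := exists k, in_blocks (lvl k) q (s k) x.
Definition block2 x := exists k, in_blocks (lvl k) (1 - q) (t k) x.
Definition block_preserving (f : D -> D) :=
  (forall x, block1 x -> block1 (f x)) /\ (forall x, block2 x -> block2 (f x)).

Lemma in_blocks_sign_change (B B' : set D) q0 s0 s1 w x : B `<=` B' ->
  sign_change B B' id s0 s1 w -> in_blocks B q0 s0 x -> in_blocks B' q0 s1 x.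
Proof.
move=> BB' [_ _ wC ->] [Bx qx xq xs]; split=> //; first exact: BB'.
by rewrite /= mulrA xs -!mulrA wC //; exists x.
Qed.

Lemma in_blocks_mono1 k m x : (k <= m)%N ->
  in_blocks (lvl k) q (s k) x -> in_blocks (lvl m) q (s m) x.
Proof.
move=> km; have [w [w' [[_ _ h _ _] _]]] := rigid_id T km.
by apply: in_blocks_sign_change h; exact: lvl_mono.
Qed.

Lemma in_blocks_mono2 k m x : (k <= m)%N ->
  in_blocks (lvl k) (1 - q) (t k) x -> in_blocks (lvl m) (1 - q) (t m) x.
Proof.
move=> km; have [w [w' [[_ _ _ h _] _]]] := rigid_id T km.
by apply: in_blocks_sign_change h; exact: lvl_mono.
Qed.

Lemma finite_level (P : nat -> D -> Prop) (I : finType) (F : I -> D) :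
  (forall k m x, (k <= m)%N -> P k x -> P m x) -> (forall i, exists k, P k (F i)) ->
  exists m0, forall m i, (m0 <= m)%N -> P m (F i).
Proof.
move=> Pm /choice[h hP]; exists (\max_i h i) => m i hm.
by apply: Pm (hP i); apply: leq_trans hm; exact: leq_bigmax.
Qed.

Lemma lvl_lin k c x y : lvl k x -> lvl k y -> lvl k (c *: x + y).
Proof. by move=> kx ky; apply: range_embD => //; exact: range_embZ. Qed.

Lemma lvl_sum_munit k x : lvl k x -> exists a : 'M[C]_(tw_size T k),
  x = \sum_ij a ij.1 ij.2 *: tw_emb T k (delta_mx ij.1 ij.2).
Proof.
move=> [a _ <-]; exists a; rewrite (emb_sum_munit (embP k)).
exact: (pair_bigA _ (fun i j => a i j *: tw_emb T k (delta_mx i j))).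
Qed.

(** Preservation of the blocks yields a level depending on the element; finite dimension of the
    block part makes it uniform over a level. *)
Lemma in_blocks_level (f : D -> D) q0 (s0 : nat -> D) :
  unital_star_hom f ->
  (forall k, half_sign (tw_emb T k) q0 (s0 k)) ->
  (forall k m x, (k <= m)%N ->
     in_blocks (lvl k) q0 (s0 k) x -> in_blocks (lvl m) q0 (s0 m) x) ->
  (forall x, (exists k, in_blocks (lvl k) q0 (s0 k) x) ->
     exists k, in_blocks (lvl k) q0 (s0 k) (f x)) ->
  forall k, exists m0, forall m x, (m0 <= m)%N ->
    in_blocks (lvl k) q0 (s0 k) x -> in_blocks (lvl m) q0 (s0 m) (f x).
Proof.
move=> [[fL fM fS] f1] hs mono fb k.
have [Bs ss s2 qs _] := hs k.
have Bq := half_sign_range (embP k) (hs k).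
have sq := half_sign_mulr (hs k); have [_ qq] := half_sign_projection (hs k).
pose e ij := tw_emb T k (delta_mx (ij.1 : 'I_(tw_size T k)) ij.2).
(* The conditional expectation of the matrix units onto the block part under [q0]; it fixes that
   part, so the [b ij] span it. *)
pose b ij := 2^-1 *: (q0 * e ij * q0 + s0 k * e ij * s0 k).
have Be ij : lvl k (e ij) by exact: range_munit.
have bP ij : in_blocks (lvl k) q0 (s0 k) (b ij).
  split.
  - apply: range_embZ => //; apply: range_embD => //.
      by do 2!apply: lvlM => //.
    by do 2!apply: lvlM => //.
  - by rewrite /b -scalerAr mulrDr !mulrA qq qs.
  - by rewrite /b -scalerAl mulrDl -!mulrA qq sq.
  - rewrite /b -scalerAl -scalerAr mulrDl mulrDr; congr (_ *: _).
    by rewrite !mulrA sq s2 -!mulrA s2 qs addrC.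
have [m0 h] := finite_level (fun j m x jm => @mono j m x jm)
  (fun ij => fb _ (ex_intro _ k (bP ij))).
exists m0 => m x mm0 [kx qx xq xs]; have [a xE] := lvl_sum_munit kx.
have -> : x = \sum_ij a ij.1 ij.2 *: b ij.
  have -> : x = 2^-1 *: (q0 * x * q0 + s0 k * x * s0 k).
    by rewrite qx xq -xs -mulrA s2 xq scaler_half.
  rewrite [in LHS]xE !mulr_sumr !mulr_suml -big_split scaler_sumr.
  apply: eq_bigr => ij _; rewrite /b /= -!scalerAr -!scalerAl -scalerDr !scalerA.
  by rewrite [2^-1 * _]mulrC.
rewrite (linear_fun_sum fL); apply: (big_ind (in_blocks (lvl m) q0 (s0 m))).
- by split; rewrite ?mulr0 ?mul0r //; exact: range_emb0.
- move=> y z yb zb; rewrite -[y]scale1r.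
  by apply: in_blocks_lin => // c u v; exact: lvl_lin.
move=> ij _; rewrite (linear_funZ fL) -[_ *: _]addr0.
apply: in_blocks_lin; first by move=> c u v; exact: lvl_lin.
  exact: h.
by split; rewrite ?mulr0 ?mul0r //; exact: range_emb0.
Qed.

Lemma lvl_image (f : D -> D) k : unital_star_hom f ->
  exists m0, forall m x, (m0 <= m)%N -> lvl k x -> lvl m (f x).
Proof.
move=> [[fL fM fS] f1].
pose e ij := tw_emb T k (delta_mx (ij.1 : 'I_(tw_size T k)) ij.2).
have [m0 h] := finite_level (P := lvl) (F := fun ij => f (e ij))
  (fun j m x jm jx => lvl_mono jm jx) (fun ij => tw_exhaust T _).
exists m0 => m x mm0 /lvl_sum_munit[a ->]; rewrite (linear_fun_sum fL).
apply: range_emb_sum => // ij _; rewrite (linear_funZ fL).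
by apply: range_embZ => //; exact: h.
Qed.

(** [q] is the unit of the first block algebra, so [f q] lies below [q]; the inverse map gives the
    reverse inequality. *)
Lemma block_preserving_q (f g : D -> D) : unital_star_hom f -> cancel g f ->
  block_preserving f -> block_preserving g -> f q = q.
Proof.
move=> [[_ fM _] _] gK [f1 _] [g1 _].
have bq : block1 q.
  have [_ qq] := half_sign_projection (tw_sP T 0).
  have [_ _ _ qs _] := tw_sP T 0.
  exists 0%N; split=> //; first exact: lvl_q.
  by rewrite qs (half_sign_mulr (tw_sP T 0)).
have [_ [_ _ fqq _]] := f1 _ bq.
have [_ [_ qgq _ _]] := g1 _ bq.
by rewrite -[RHS](gK q) -qgq fM gK.
Qed.

(** [block_sign_change], applied to [f] followed by its inverse, treats each half separately. What
    remains is that the symmetries [b], [c] of the two halves commute: they commute up to a scalar 1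
    or -1, and the trace excludes -1. *)
Lemma aut_rigid (f g : D -> D) : unital_star_hom f -> unital_star_hom g ->
  cancel f g -> cancel g f -> block_preserving f -> block_preserving g ->
  forall k, exists m w w', [/\ (k <= m)%N, rigid T f k m w w' & tau (w * w') != 0].
Proof.
move=> fP gP fK gK fb gb k.
have fq := block_preserving_q fP gK fb gb.
have gq := block_preserving_q gP fK gb fb.
have level h j : unital_star_hom h -> block_preserving h -> exists2 m, (j <= m)%N &
    [/\ forall x, lvl j x -> lvl m (h x),
       forall x, in_blocks (lvl j) q (s j) x -> in_blocks (lvl m) q (s m) (h x) &
       forall x, in_blocks (lvl j) (1 - q) (t j) x ->
         in_blocks (lvl m) (1 - q) (t m) (h x)].
  move=> hP [hb1 hb2].
  have [m0 h0] := lvl_image j hP.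
  have [m1 h1] := in_blocks_level hP (tw_sP T) in_blocks_mono1 hb1 j.
  have [m2 h2] := in_blocks_level hP (tw_tP T) in_blocks_mono2 hb2 j.
  exists (maxn j (maxn m0 (maxn m1 m2))); first exact: leq_maxl.
  split=> x jx; [apply: h0 | apply: h1 | apply: h2] => //;
    by rewrite !leq_max leqnn ?orbT.
have [m km [f0 fs ft]] := level f k fP fb.
have [l ml [g0 gs gt]] := level g m gP gb.
have [w [w' [[_ _ hs ht ww'] tww']]] := rigid_id T (leq_trans km ml).
have [[fL _ _] f1] := fP; have [[gL gM gS] g1] := gP.
have f1q : f (1 - q) = 1 - q.
  by rewrite (linear_funB fL) fq f1.
have g1q : g (1 - q) = 1 - q by rewrite (linear_funB gL) gq g1.
have gI := can_inj gK.
have [b [v [hb hv gbv]]] := block_sign_change (embP k) (embP m) (embP l) fP gP fK gI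
  fq gq f0 g0 fs gs (tw_sP T k) (tw_sP T m) (tw_sP T l) hs.
have [c [v' [hc hv' gcv]]] := block_sign_change (embP k) (embP m) (embP l) fP gP fK gI
  f1q g1q f0 g0 ft gt (tw_tP T k) (tw_tP T m) (tw_tP T l) ht.
have [Bb [bs bb] bC smE] := hb; have [Bc [cs cc] cC tmE] := hc.
have [Bv [vs vv] vC slE] := hv; have [Bv' [vs' vv'] vC' tlE] := hv'.
have vg y : lvl m y -> v * g y = g y * v by move=> my; apply: vC; exists y.
have vg' y : lvl m y -> v' * g y = g y * v' by move=> my; apply: vC'; exists y.
(* The degree [rho T k l] of the inclusion is a product with [tau (b * c)] as a factor; its
   nonvanishing comes from that of H_1. *)
have tbc : tau (b * c) != 0.
  have : rho T k l != 0 by exact: rho_neq0.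
  rewrite -tww' -gbv -gcv -mulrA (mulrA v) vg // -mulrA mulrA -gM.
  rewrite (tau_mul_image gP (lvlM Bb Bc)); last exact: commutes_withM.
  by rewrite mulf_eq0 negb_or => /andP[].
exists m, b, c; split=> //; split=> //.
have ZY : g (b * c) * (v * v') = g (c * b) * (v' * v).
  have E1 : w * w' = g (b * c) * (v * v').
    by rewrite -gbv -gcv -mulrA (mulrA v) vg // -mulrA mulrA -gM.
  have E2 : w' * w = g (c * b) * (v' * v).
    by rewrite -gbv -gcv -mulrA (mulrA v') vg' // -mulrA mulrA -gM.
  by rewrite -E1 -E2.
have ZZ : g ((b * c) * (b * c)) = (v' * v) * (v' * v).
  have h1 : g (b * c) * (g (b * c) * (v * v')) = v' * v.
    by rewrite ZY mulrA -gM -!mulrA (mulrA c c) cc mul1r bb g1 mul1r.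
  have h2 : (v * v') * (v' * v) = 1 by rewrite -mulrA (mulrA v') vv' mul1r vv.
  by rewrite -{1}h1 -[RHS]mulrA -(mulrA _ (v * v')) h2 mulr1 gM.
(* By [ZZ] the map [g] sends the square of [b * c] to an element commuting with the image of level
   [m]; so this square is central in level [m], hence a scalar. *)
have Bcom : commutes_with (range (tw_emb T m)) ((b * c) * (b * c)).
  move=> y my; apply: gI; rewrite (gM _ y) (gM y) ZZ.
  have vvg : v' * v * g y = g y * (v' * v).
    by rewrite -mulrA vg // !mulrA vg'.
  by rewrite -(mulrA (v' * v)) vvg (mulrA (v' * v)) vvg -mulrA.
have [mu muE] := emb_center (embP m) (lvlM (lvlM Bb Bc) (lvlM Bb Bc)) Bcom.
have cb : c * b = mu *: (b * c).
  have : b * ((b * c) * (b * c)) * c = mu *: (b * c).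
    by rewrite muE -scalerAr mulr1 -scalerAl.
  by move=> <-; rewrite !mulrA bb mul1r -(mulrA _ c c) cc mulr1.
have bc0 : b * c != 0.
  by apply: contraNneq tbc => ->; rewrite (tau0 tauP).
have mu2 : mu * mu = 1.
  have h : b * c = (mu * mu) *: (b * c).
    have : c * (c * b) * c = mu *: (c * b).
      by rewrite {1}cb -scalerAr -scalerAl -!mulrA cc mulr1.
    by rewrite mulrA cc mul1r cb scalerA.
  apply/eqP; rewrite -subr_eq0; apply/eqP; apply: contraTeq isT => n0.
  case/negP: bc0; rewrite -[b * c]scale1r -(mulVf n0) -scalerA scalerBl scale1r -h.
  by rewrite subrr scaler0.
have /eqP : mu ^+ 2 = 1 by rewrite expr2.
rewrite sqrf_eq1 => /orP[] /eqP muE1; first by rewrite cb muE1 scale1r.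
(* Anticommuting [b] and [c] would give [tau (b * c) = 0]. *)
case/negP: tbc; have : tau (c * b) = - tau (b * c).
  by rewrite cb muE1 scaleN1r (tauN tauP).
rewrite (tauC tauP) => /eqP; rewrite -addr_eq0 -mulr2n.
by rewrite mulrn_eq0.
Qed.

End BlockAutomorphism.

Lemma aut_rigid_deg (C : numClosedFieldType) (D : starAlgType C) (T : balanced_tower D)
    (f g : D -> D) : unital_star_hom f -> unital_star_hom g ->
  cancel f g -> cancel g f -> block_preserving T f -> block_preserving T g ->
  forall k, exists2 m0, (k <= m0)%N & forall m, (m0 <= m)%N ->
  exists2 c, rigid_deg T f k m c & c != 0.
Proof.
move=> fP gP fK gK fb gb k.
have [l [w [w' [kl h n0]]]] := aut_rigid fP gP fK gK fb gb k.
have [m0 lm0 hm] := balanced_deg T l.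
exists m0 => [|m m0m]; first exact: leq_trans lm0.
exists (tw_tau T (w * w') * rho T l m); first exact: hm.
by rewrite mulf_neq0 // rho_neq0.
Qed.

(** * Degrees *)

Section Degree.
Variables (C : numClosedFieldType) (D : starAlgType C) (T : balanced_tower D).
Implicit Types (f g : D -> D) (x y u v z w : D) (k m l : nat) (c d : C).

Local Notation tau := (tw_tau T).
Local Notation s := (tw_s T).
Local Notation t := (tw_t T).
Local Notation lvl := (lvl T).
Local Notation rho := (rho T).
Local Notation size k := (tw_size T k).
Let tauP := tw_tauP T.
Let embP := tw_embP T.

Lemma size_neq0 k : (size k)%:R != 0 :> C.
Proof. exact: natr_size_neq0 (embP k). Qed.

Definition bijective_star_hom f g := [/\ unital_star_hom f, unital_star_hom g,
  cancel f g, cancel g f & block_preserving T f /\ block_preserving T g].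

(* [f] acts on the H_1 of the system, made a subgroup of [C], as multiplication
   by [c]. *)
Definition has_degree f c := exists k m, (k <= m)%N /\ rigid_deg T f k m (c * rho k m).

Lemma has_degree0 f c : unital_star_hom f -> has_degree f c ->
  exists m0, forall m, (m0 <= m)%N -> rigid_deg T f 0 m (c * rho 0 m).
Proof.
move=> fP [k [m0 [km h]]]; exists m0 => m m0m.
have := rigid_deg_restrict fP (leq0n k) (rigid_deg_widen fP m0m h).
by rewrite -(mulrA c) rhoM // mulrCA rhoM // (leq_trans km).
Qed.

Lemma has_degree_unique f c d : unital_star_hom f ->
  has_degree f c -> has_degree f d -> c = d.
Proof.
move=> fP /(has_degree0 fP)[m0 h0] /(has_degree0 fP)[m1 h1].
have := rigid_deg_unique fP (h0 _ (leq_maxl m0 m1)) (h1 _ (leq_maxr m0 m1)).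
exact: (mulIf (rho_neq0 _ _ _)).
Qed.

Lemma has_degree_ex f g : bijective_star_hom f g ->
  exists2 c, has_degree f c & c != 0.
Proof.
move=> [fP gP fK gK [fb gb]].
have [m0 _ h] := aut_rigid_deg fP gP fK gK fb gb 0.
have [c hc c0] := h _ (leqnn m0).
exists (c / rho 0 m0); last by rewrite mulf_neq0 ?invr_eq0 ?rho_neq0.
by exists 0%N, m0; split=> //; rewrite mulfVK ?rho_neq0.
Qed.

(** Some degree exists from every level by [aut_rigid_deg]; the normalisation by [rho] makes it
    independent of the level. *)
Lemma has_degree_lvl f g c : bijective_star_hom f g -> has_degree f c ->
  forall k, exists2 m0, (k <= m0)%N &
  forall m, (m0 <= m)%N -> rigid_deg T f k m (c * rho k m).
Proof.
move=> [fP gP fK gK [fb gb]] fc k.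
have [m0 km0 h] := aut_rigid_deg fP gP fK gK fb gb k.
exists m0 => // m m0m; have [d hd d0] := h _ m0m.
suff -> : c = d / rho k m by rewrite mulfVK ?rho_neq0.
apply: (has_degree_unique fP fc); exists k, m; split; first exact: leq_trans m0m.
by rewrite mulfVK ?rho_neq0.
Qed.

Lemma has_degree_comp f f' g g' c d : bijective_star_hom f f' ->
  bijective_star_hom g g' -> has_degree f c -> has_degree g d ->
  has_degree (g \o f) (c * d).
Proof.
move=> fP gP fc gd.
have [m0 _ hf] := has_degree_lvl fP fc 0.
have [m1 m01 hg] := has_degree_lvl gP gd m0.
exists 0%N, m1; split=> //.
rewrite -(rhoM _ (leq0n m0) m01) mulrACA.
by case: fP gP => fP _ _ _ _ [gP _ _ _ _]; apply: rigid_deg_comp (hg _ _) => //; exact: hf.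
Qed.

Lemma has_degree_id : has_degree id 1.
Proof.
have [m0 _ h] := rigid_deg_id T 0.
by exists 0%N, m0; split=> //; rewrite mul1r; exact: h.
Qed.

(** From level [k] to a late level, [f] and the inclusion are rigid with the same degree, so a
    diagonal unitary carries one to the other. *)
Lemma has_degree1_inner f g : bijective_star_hom f g -> has_degree f 1 ->
  forall k, exists m z, diagonal_unitary T m z /\ forall x, lvl k x -> Ad z x = f x.
Proof.
move=> fP f1 k; have [m0 _ h0] := has_degree_lvl fP f1 k.
have [m1 _ h1] := rigid_deg_id T k.
have := h0 _ (leq_maxl m0 m1); rewrite mul1r; case: (fP) => fP' _ _ _ _.
move=> /(rigid_deg_conj (unital_star_hom_id _) fP' (h1 _ (leq_maxr m0 m1))).
move=> [z [zP zf]]; exists (maxn m0 m1), z; split=> // x kx.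
by rewrite /Ad zf //; case: zP => [[_ zz]] _ _ _ _; rewrite -mulrA zz mulr1.
Qed.

(* The joint eigenspaces of the two sign symmetries of a rigid map have
   multiplicities [A], [B], [B], [A]. *)
Lemma rigid_deg_multiplicities f k m c : unital_star_hom f -> rigid_deg T f k m c ->
  exists A B : nat, size m = ((A + B).*2 * size k)%N /\
    c * (A + B)%:R = A%:R - B%:R.
Proof.
move=> fP [w [w' [[fB fq [Bw wP wC _] [Bw' w'P w'C _] ww'] w0 w'0 wc]]].
have r0 : (0 < size k)%N by case: (embP k).
pose e := tw_emb T k (delta_mx (Ordinal r0) (Ordinal r0)).
have ke : lvl k e by exact: range_munit.
have eP : projection (f e).
  exact: (munit_projection (mx_embedding_comp fP (embP k)) (Ordinal r0)).
(* Traces of projections in [lvl m] are multiples of the reciprocal of [size m]; the joint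
   eigenprojections under a minimal projection of level [k] therefore count multiplicities. *)
have rk (a b : bool) : exists n : nat,
    (size k)%:R^-1 * (4^-1 * (1 + (-1) ^+ a * (-1) ^+ b * c)) = n%:R / (size m)%:R.
  pose p := f e * (half w (a, b).1 * half w' (a, b).2).
  have pP : projection p by apply: joint_projection => //; [exact: wC | exact: w'C].
  have Bp : lvl m p.
    by apply: lvlM; [exact: fB | apply: lvlM; exact: range_half].
  have [n [X [_ _ tn]]] := projection_decomp tauP (embP m) Bp pP.
  exists n; rewrite -tn /p (tau_mul_image fP ke) /=; last first.
    by apply: commutes_withM; exact: half_commutes.
  by rewrite (tau_munit tauP (embP k)) tau_half2 // w0 w'0 wc !mulr0 !addr0.
have [A hA] := rk false false; have [B hB] := rk false true.
rewrite /= expr0 !mul1r in hA; rewrite /= expr0 expr1 mul1r mulN1r in hB.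
have sm := size_neq0 m; have sk := size_neq0 k.
have hS : (A + B)%:R / (size m)%:R = (size k)%:R^-1 * 2^-1 :> C.
  by rewrite natrD mulrDl -hA -hB; field.
have hD : (A%:R - B%:R) / (size m)%:R = (size k)%:R^-1 * 2^-1 * c :> C.
  by rewrite mulrBl -hA -hB; field.
exists A, B; split.
  apply/eqP; rewrite -(eqr_nat C) -muln2 !natrM -(mulfVK sm (A + B)%:R) hS.
  by apply/eqP; field; rewrite sk.
by rewrite -(mulfVK sm (A + B)%:R) hS -(mulfVK sm (A%:R - B%:R)) hD; ring.
Qed.

(** Past a balanced inclusion the two blocks of a half have equal size, a hypothesis of
    [rigid_deg_exists]. *)
Lemma unital_star_hom_tau_s k m c : rigid_deg T id k m c -> tau (s m) = 0.
Proof.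
move=> [w [w' [[_ _ [_ _ wC ->] _ _] w0 _ _]]].
rewrite (tau_mul_image (unital_star_hom_id _) (lvl_s T k) wC).
by rewrite w0 mulr0.
Qed.

Lemma unital_star_hom_tau_t k m c : rigid_deg T id k m c -> tau (t m) = 0.
Proof.
move=> [w [w' [[_ _ _ [_ _ wC ->] _] _ w0 _]]].
rewrite (tau_mul_image (unital_star_hom_id _) (lvl_t T k) wC).
by rewrite w0 mulr0.
Qed.

End Degree.

(** * Realising degrees *)

Section CornerSigns.
Variable C : numClosedFieldType.

Lemma sum_sign_even n : \sum_(i < n.*2) (-1) ^+ i = 0 :> C.
Proof.
elim: n => [|n IH]; first by rewrite big_ord0.
rewrite doubleS !big_ord_recr /= IH add0r exprS -signr_odd odd_double.
by rewrite expr0 mulr1 subrr.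
Qed.

Lemma corner_signs (D : starAlgType C) (tau : D -> C) r (g : 'M[C]_r -> D)
    (e : D) (A B : nat) :
  normalised_trace tau -> mx_embedding g -> range g e -> projection e ->
  tau e = (A + B).*2%:R / r%:R ->
  exists x y : D, [/\ range g x /\ range g y, star x = x /\ star y = y,
    [/\ x * e = x, y * e = y, x * x = e & y * y = e],
    x * y = y * x & [/\ tau x = 0, tau y = 0 &
      tau (x * y) = (A%:R - B%:R) *+ 2 / r%:R]].
Proof.
move=> tauP gP Be eP; have [n [X [XU Xe ->]]] := projection_decomp tauP gP Be eP.
have rn := natr_size_neq0 gP.
move=> /(mulIf (invr_neq0 rn)) /eqP; rewrite eqr_nat => /eqP hn; subst n.
case: (gP) => _ [gL gM gS] _.
pose F (d : 'rV[C]_((A + B).*2)) := g (X ^t* *m diag_mx d *m X).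
have FM d d' : F d * F d' = F (\row_j (d 0 j * d' 0 j)).
  rewrite -gM !mulmxA -(mulmxA (_ *m diag_mx d)) XU mulmx1.
  by rewrite -(mulmxA _ (diag_mx d)) mulmx_diag.
have F1 : F (const_mx 1) = e by rewrite /F diag_const_mx mulmx1.
have Fs (d : 'rV[C]_((A + B).*2)) : (forall j, (d 0 j)^* = d 0 j) -> star (F d) = F d.
  move=> dr; rewrite -gS /mxstar !adjmxM trmxCK mulmxA; congr (g (_ *m _ *m _)).
  apply/matrixP => i j; rewrite !mxE; case: eqP => [->|ij].
    by rewrite eqxx !mulr1n dr.
  by rewrite eq_sym; case: eqP => // _; rewrite !mulr0n conjC0.
have tF d : tau (F d) = (\sum_j d 0 j) / r%:R.
  by rewrite (tau_emb tauP gP) mxtrace_mulC mulmxA XU mul1mx mxtrace_diag.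
(* Alternating signs, and the same signs reversed from position 2A on. Both segments have even
   length, so each family sums to 0, while the products are 2A times 1 and 2B times -1. *)
pose d1 : 'rV[C]_((A + B).*2) := \row_j (-1) ^+ j.
pose d2 : 'rV[C]_((A + B).*2) := \row_j ((-1) ^+ (A.*2 <= j)%N * (-1) ^+ j).
have sg n : (-1) ^+ n * (-1) ^+ n = 1 :> C by rewrite -expr2 sqrr_sign.
exists (F d1), (F d2); split.
- by [].
- split; apply: Fs => j; rewrite !mxE ?rmorphM ?rmorph_sign //.
- split; rewrite -1?F1 FM ?F1 // -?F1; congr F; apply/rowP => j; rewrite !mxE.
  + by rewrite mulr1.
  + by rewrite mulr1.
  + exact: sg.
  + by rewrite mulrACA !sg mulr1.
- by rewrite !FM; congr F; apply/rowP => j; rewrite !mxE mulrC.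
split.
- by rewrite tF (eq_bigr (fun j : 'I__ => (-1) ^+ j)) ?sum_sign_even ?mul0r // => j _; rewrite mxE.
- rewrite tF; apply/eqP; rewrite mulf_eq0; apply/orP; left; apply/eqP.
  rewrite (eq_bigr (fun j : 'I__ => (-1) ^+ (A.*2 <= j)%N * (-1) ^+ j)) => [|j _].
    rewrite doubleD big_split_ord /= (eq_bigr (fun j : 'I__ => (-1) ^+ j)) => [|j _].
      rewrite sum_sign_even add0r (eq_bigr (fun j : 'I__ => - (-1) ^+ j)) => [|j _].
        by rewrite sumrN sum_sign_even oppr0.
      rewrite leq_addr exprD -(signr_odd _ A.*2) odd_double mul1r.
      by rewrite expr1 mulN1r.
    by rewrite leqNgt ltn_ord mul1r.
  by rewrite mxE.
rewrite FM tF; congr (_ / _).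
rewrite (eq_bigr (fun j : 'I__ => (-1) ^+ (A.*2 <= j)%N)) => [|j _]; last first.
  by rewrite !mxE mulrCA sg mulr1.
rewrite doubleD big_split_ord /= (eq_bigr (fun=> 1)) => [|j _]; last first.
  by rewrite leqNgt ltn_ord.
rewrite sumr_const card_ord (eq_bigr (fun=> -1)) => [|j _]; last first.
  by rewrite leq_addr.
by rewrite sumr_const card_ord -!muln2 !mulrnA mulNrn -mulrnDl.
Qed.

End CornerSigns.

Section Realisation.
Variables (C : numClosedFieldType) (D : starAlgType C) (T : balanced_tower D).
Implicit Types (f g : D -> D) (x y u v z w : D) (k m l : nat) (c d : C).

Local Notation tau := (tw_tau T).
Local Notation q := (tw_q T).
Local Notation s := (tw_s T).
Local Notation t := (tw_t T).
Local Notation lvl := (lvl T).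
Local Notation rho := (rho T).
Local Notation size k := (tw_size T k).
Let tauP := tw_tauP T.
Let embP := tw_embP T.

(* A unital copy of level [k] in level [m] whose sign symmetries are prescribed:
   move the symmetries [s_k w + t_k w'] and [s_m + t_m], which have the same trace
   on [q] and on [1 - q], onto each other. *)
Lemma rigid_deg_exists k m (A B : nat) : (k <= m)%N ->
  size m = ((A + B).*2 * size k)%N -> tau (s m) = 0 -> tau (t m) = 0 ->
  exists u, [/\ unitary u, lvl m u, u * q = q * u &
    rigid_deg T (Ad u) k m ((A%:R - B%:R) / (A + B)%:R)].
Proof.
move=> km hsize ts tt.
have r0 : (0 < size k)%N by case: (embP k).
pose i0 := Ordinal r0; pose e := tw_emb T k (delta_mx i0 i0).
have ke : lvl k e by exact: range_munit.
have te : tau e = (A + B).*2%:R / (size m)%:R.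
  rewrite (tau_munit tauP (embP k)).
  have := size_neq0 T m; rewrite hsize natrM mulf_eq0 negb_or => /andP[h1 h2].
  by field; rewrite h1 h2.
have [c [c' [[mc mc'] [cs cs'] [ce ce' cc cc'] ccC [tc tc' tcc]]]] :=
  corner_signs tauP (embP m) (lvl_mono km ke) (munit_projection (embP k) i0) te.
pose w := amplify (tw_emb T k) i0 c; pose w' := amplify (tw_emb T k) i0 c'.
have kB i j : lvl m (tw_emb T k (delta_mx i j)).
  by apply: (lvl_mono km); exact: range_munit.
have ampl x : lvl m x -> lvl m (amplify (tw_emb T k) i0 x).
  by move=> mx; apply: range_emb_sum => // i _; do 2!apply: lvlM => //.
have mw : lvl m w by exact: ampl.
have mw' : lvl m w' by exact: ampl.
have tau_ampl x : x * e = x -> tau (amplify (tw_emb T k) i0 x) = (size k)%:R * tau x.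
  move=> xe; rewrite /amplify (tau_sum tauP) (eq_bigr (fun=> tau x)).
    by rewrite sumr_const card_ord mulr_natl.
  by move=> i _; rewrite -mulrA (tauC tauP) -mulrA munitMid // xe.
have wP : symmetry w.
  split; first by rewrite star_amplify // cs.
  by rewrite amplifyM // cc amplify_munit.
have w'P : symmetry w'.
  split; first by rewrite star_amplify // cs'.
  by rewrite amplifyM // cc' amplify_munit.
have ww' : w * w' = w' * w by rewrite !amplifyM // ccC.
have wC : commutes_with (lvl k) w by exact: amplify_commutes.
have w'C : commutes_with (lvl k) w' by exact: amplify_commutes.
have tw : tau w = 0 by rewrite tau_ampl // tc mulr0.
have tw' : tau w' = 0 by rewrite tau_ampl // tc' mulr0.
have tww : tau (w * w') = (A%:R - B%:R) / (A + B)%:R.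
  rewrite amplifyM // tau_ampl ?tcc; last by rewrite -mulrA ce'.
  have := size_neq0 T m; rewrite hsize !natrM -muln2 natrM !mulf_eq0 !negb_or.
  by move=> /andP[/andP[h1 _] h2]; field; rewrite -natrD h1 h2.
have [qs qq] := q_projection T.
have [ks ss s2 qsk _] := tw_sP T k; have [kt st t2 qtk _] := tw_tP T k.
have [ms ssm s2m qsm _] := tw_sP T m; have [mt stm t2m qtm _] := tw_tP T m.
have sqk := half_sign_mulr (tw_sP T k); have tqk := half_sign_mulr (tw_tP T k).
have sqm := half_sign_mulr (tw_sP T m); have tqm := half_sign_mulr (tw_tP T m).
have [ps pp] := half_sign_projection (tw_tP T 0).
have qp : q * (1 - q) = 0 by rewrite mulrBr mulr1 qq subrr.
have pq : (1 - q) * q = 0 by rewrite mulrBl mul1r qq subrr.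
have [p pE] : exists p, 1 - q = p by exists (1 - q).
rewrite pE in qtk qtm t2 t2m tqk tqm ps pp qp pq.
have qpE : q + p = 1 by rewrite -pE addrC subrK.
have mq : lvl m q by exact: lvl_q.
have mp : lvl m p by rewrite -pE; apply: range_embB => //; exact: range_emb1.
have kq : lvl k q by exact: lvl_q.
have kp : lvl k p by rewrite -pE; apply: range_embB => //; exact: range_emb1.
(* [q] is recorded as a symmetry, so that [symmetry_pair_conj] yields a [V] that also respects the
   two halves. *)
pose kappa := q - p.
have kappaP : symmetry kappa.
  split; first by rewrite star_B qs ps.
  by rewrite /kappa mulrBr !mulrBl qq qp pq pp sub0r subr0 opprK.
have mkappa : lvl m kappa by exact: range_embB.
have [[qt pqs] [tq sp]] : (q * t k = 0 /\ p * s k = 0) /\ (t k * q = 0 /\ s k * p = 0).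
  split; split.
  - by rewrite -qtk mulrA qp mul0r.
  - by rewrite -qsk mulrA pq mul0r.
  - by rewrite -tqk -mulrA pq mulr0.
  - by rewrite -sqk -mulrA qp mulr0.
have [[qtm' psm] [tqm' spm]] :
    (q * t m = 0 /\ p * s m = 0) /\ (t m * q = 0 /\ s m * p = 0).
  split; split.
  - by rewrite -qtm mulrA qp mul0r.
  - by rewrite -qsm mulrA pq mul0r.
  - by rewrite -tqm -mulrA pq mulr0.
  - by rewrite -sqm -mulrA qp mulr0.
have st0 : s k * t k = 0 by rewrite -qtk mulrA -sqk -(mulrA (s k)) qp mulr0 mul0r.
have ts0 : t k * s k = 0 by rewrite -qsk mulrA -tqk -(mulrA (t k)) pq mulr0 mul0r.
have stm0 : s m * t m = 0 by rewrite -qtm mulrA -sqm -(mulrA (s m)) qp mulr0 mul0r.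
have tsm0 : t m * s m = 0 by rewrite -qsm mulrA -tqm -(mulrA (t m)) pq mulr0 mul0r.
(* The prescribed and the actual signs of level [m]. Each of [a], [b], [kappa * a], [kappa * b] has
   trace zero, so the pairs [kappa, a] and [kappa, b] have the same joint traces. *)
pose a := s k * w + t k * w'; pose b := s m + t m.
have bP : symmetry b.
  split; first by rewrite starD ssm stm.
  by rewrite mulrDl !mulrDr s2m t2m stm0 tsm0 addr0 add0r.
have mks : lvl m (s k) by exact: (lvl_mono km ks).
have mkt : lvl m (t k) by exact: (lvl_mono km kt).
have ws := wC _ ks; have wt := wC _ kt; have ws' := w'C _ ks; have wt' := w'C _ kt.
have [[wsm ww] [wsm' wwm']] := (wP, w'P).
have aP : symmetry a.
  split; first by rewrite starD !starM ss st wsm wsm' ws wt'.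
  rewrite mulrDl !mulrDr.
  rewrite !mulrA -(mulrA (s k) w (s k)) ws mulrA s2 -(mulrA q w w) ww mulr1.
  rewrite -(mulrA (s k) w (t k)) wt mulrA st0 !mul0r addr0.
  rewrite -(mulrA (t k) w' (s k)) ws' mulrA ts0 !mul0r add0r.
  by rewrite -(mulrA (t k) w' (t k)) wt' mulrA t2 -(mulrA p w' w') wwm' mulr1.
have ma : lvl m a by apply: range_embD => //; exact: lvlM.
have mb : lvl m b by exact: range_embD.
have kb : kappa * b = s m - t m.
  by rewrite /kappa /b mulrBl !mulrDr qsm qtm qtm' psm addr0 add0r.
have bk : b * kappa = s m - t m.
  by rewrite /kappa /b mulrDl !mulrBr sqm tqm tqm' spm subr0 sub0r.
have ka : kappa * a = s k * w - t k * w'.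
  by rewrite /kappa /a mulrBl !mulrDr !mulrA qsk qtk qt pqs !mul0r addr0 add0r.
have ak : a * kappa = s k * w - t k * w'.
  rewrite /kappa /a mulrDl !mulrBr -!mulrA (wC _ kq) (wC _ kp) (w'C _ kq) (w'C _ kp).
  by rewrite !mulrA sqk tqk tq sp !mul0r subr0 sub0r.
have tsw : tau (s k * w) = 0.
  by rewrite (tau_mul_commutant tauP (embP k)) // tw mulr0.
have ttw : tau (t k * w') = 0.
  by rewrite (tau_mul_commutant tauP (embP k)) // tw' mulr0.
have [V [mV VV VV' Vk Va]] : exists V, [/\ lvl m V, star V * V = 1, V * star V = 1,
    V * kappa = kappa * V & V * a = b * V].
  apply: (symmetry_pair_conj tauP (embP m)) => //; try exact: projection1;
    try (by rewrite mul1r mulr1); try exact: range_emb1.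
  - by rewrite ka ak.
  - by rewrite kb bk.
  move=> x y; rewrite !mul1r !tau_half2 //; congr (_ * (_ + _ + _ + _)).
    by rewrite /a /b !(tauD tauP) tsw ttw ts tt.
  by rewrite ka kb !(tauB tauP) tsw ttw ts tt.
have Vq : V * q = q * V.
  have qE : q = 2^-1 *: (1 + kappa).
    by rewrite /kappa addrA -qpE addrAC addrK scaler_half.
  by rewrite qE -scalerAr -scalerAl mulrDr mulrDl mulr1 mul1r Vk.
have Vp : V * p = p * V by rewrite -pE mulrBr mulrBl mulr1 mul1r Vq.
have Vs : V * (s k * w) = s m * V.
  have -> : s k * w = q * a by rewrite /a mulrDr !mulrA qsk qt mul0r addr0.
  have -> : s m = q * b by rewrite /b mulrDr qsm qtm' addr0.
  by rewrite mulrA Vq -mulrA Va mulrA.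
have Vt : V * (t k * w') = t m * V.
  have -> : t k * w' = p * a by rewrite /a mulrDr !mulrA qtk pqs mul0r add0r.
  have -> : t m = p * b by rewrite /b mulrDr qtm psm add0r.
  by rewrite mulrA Vp -mulrA Va mulrA.
have VP : unitary V by [].
have [[AL AM AS] A1] := unital_star_hom_Ad VP.
have mA x : lvl m x -> lvl m (Ad V x).
  by move=> mx; apply: lvlM; [exact: lvlM | exact: range_emb_star].
have AdC z : commutes_with (lvl k) z -> commutes_with (Ad V @` lvl k) (Ad V z).
  by move=> zC _ [x kx <-]; rewrite -!AM zC.
have sgn s0 s1 w0 : lvl m w0 -> symmetry w0 -> commutes_with (lvl k) w0 ->
    V * (s0 * w0) = s1 * V ->
    sign_change (lvl k) (lvl m) (Ad V) s0 s1 (Ad V w0).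
  move=> mw0 [w0s w0w0] w0C h; split; [exact: mA | | exact: AdC |].
    by split; rewrite -?AS -?AM ?w0s ?w0w0.
  by rewrite -AM /Ad h -mulrA VV' mulr1.
exists V; split=> //; exists (Ad V w), (Ad V w'); split.
- split.
  + by move=> x kx; apply: mA; exact: (lvl_mono km kx).
  + by rewrite /Ad Vq -mulrA VV' mulr1.
  + exact: sgn.
  + exact: sgn.
  + by rewrite -!AM ww'.
- by rewrite (tau_star_hom _ w (unital_star_hom_Ad VP)).
- by rewrite (tau_star_hom _ w' (unital_star_hom_Ad VP)).
- by rewrite -AM (tau_star_hom _ (w * w') (unital_star_hom_Ad VP)).
Qed.

End Realisation.

(** * Two-sided intertwining *)

Section BackAndForth.
Variables (C : numClosedFieldType) (D : starAlgType C) (T : balanced_tower D).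
Implicit Types (f g : D -> D) (x y u v z w : D) (k m l : nat) (c d : C).

Local Notation q := (tw_q T).
Local Notation s := (tw_s T).
Local Notation t := (tw_t T).
Local Notation lvl := (lvl T).
Local Notation rho := (rho T).
Local Notation size k := (tw_size T k).
Let embP := tw_embP T.

(** The condition that [rigid_deg_multiplicities] imposes on a map of degree [c], demanded for all
    late levels. *)
Definition realisable c := forall k, exists m0, forall m, (m0 <= m)%N ->
  exists A B : nat, size m = ((A + B).*2 * size k)%N /\
    c * rho k m * (A + B)%:R = A%:R - B%:R.

Definition partial_aut c k m u := [/\ (k < m)%N, unitary u, u * q = q * u &
  rigid_deg T (Ad u) k m (c * rho k m)].

Lemma partial_aut_exists c k : realisable c ->
  exists m0, forall m, (m0 <= m)%N -> exists u, partial_aut c k m u.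
Proof.
move=> cr; have [m0 h0] := cr k; have [m1 km1 h1] := rigid_deg_id T k.
exists (maxn k.+1 (maxn m0 m1)) => m; rewrite !geq_max => /and3P[km m0m m1m].
have [A [B [hs hc]]] := h0 _ m0m; have hid := h1 _ m1m.
have [u [uP um uq ur]] := rigid_deg_exists (ltnW km) hs
  (unital_star_hom_tau_s hid) (unital_star_hom_tau_t hid).
exists u; split=> //; rewrite -hc mulfK // in ur.
have := size_neq0 T m; rewrite hs natrM mulf_eq0 negb_or -muln2 natrM mulf_eq0.
by rewrite negb_or => /andP[/andP[]].
Qed.

(** Followed by any partial map of degree [c^-1], [Ad u] acquires the degree of the inclusion, so it
    differs from the inclusion by a diagonal unitary [z]; absorbing [z] into [v] keeps the
    degree. *)
Lemma partial_aut_step c k m u : c != 0 -> realisable c^-1 -> partial_aut c k m u ->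
  exists l v, partial_aut c^-1 m l v /\ forall x, lvl k x -> Ad v (Ad u x) = x.
Proof.
move=> c0 cr [km uP uq ur].
have [l0 h0] := partial_aut_exists m cr; have [l1 _ h1] := rigid_deg_id T k.
pose l := maxn l0 l1; have [v [ml vP vq vr]] := h0 l (leq_maxl _ _).
have uA := unital_star_hom_Ad uP; have vA := unital_star_hom_Ad vP.
have vu : rigid_deg T (Ad v \o Ad u) k l (rho k l).
  have := rigid_deg_comp uA vA ur vr.
  by rewrite mulrACA divff // mul1r rhoM // ltnW.
have idP := unital_star_hom_id D.
have [z [zD zf]] := rigid_deg_conj (unital_star_hom_comp vA uA) idP vu
  (h1 l (leq_maxr _ _)).
have [zP lz zq _ _] := zD.
exists l, (z * v); split; last first.
  move=> x kx; rewrite Ad_mul {1}/Ad zf //=.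
  by case: zP => _ zz; rewrite -mulrA zz mulr1.
split=> //; first exact: unitaryM.
  by rewrite -mulrA vq mulrA zq mulrA.
have := rigid_deg_compr vA (unital_star_hom_Ad zP) vr (rigid_Ad zD).
rewrite mulr1 (tau1 (tw_tauP T)) mulr1.
by apply: eq_rigid_deg => x _; rewrite /= Ad_mul.
Qed.

Lemma rigid_in_blocks f k m w w' : unital_star_hom f -> rigid T f k m w w' ->
  (forall x, in_blocks (lvl k) q (s k) x -> in_blocks (lvl m) q (s m) (f x)) /\
  (forall x, in_blocks (lvl k) (1 - q) (t k) x ->
     in_blocks (lvl m) (1 - q) (t m) (f x)).
Proof.
move=> [[fL fM fS] f1] [fB fq hs ht _].
have f1q : f (1 - q) = 1 - q by rewrite (linear_funB fL) fq f1.
have gen p s0 s1 w0 : f p = p -> sign_change (lvl k) (lvl m) f s0 s1 w0 ->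
    forall x, in_blocks (lvl k) p s0 x -> in_blocks (lvl m) p s1 (f x).
  move=> fp [_ _ wC ->] x [kx px xp xs]; split; first exact: fB.
  - by rewrite -fp -fM px.
  - by rewrite -fp -fM xp.
  - by rewrite mulrA -fM xs fM -!mulrA wC //; exists x.
by split; [exact: gen hs | exact: gen ht].
Qed.

(* Two-sided intertwining: [u 0, u 1, ...] conjugate each level into the next
   one, two consecutive conjugations cancelling. *)
Lemma realise_degree c : c != 0 -> realisable c -> realisable c^-1 ->
  exists f g, bijective_star_hom T f g /\ has_degree T f c.
Proof.
move=> c0 cr cVr.
(* Even steps build the automorphism of degree [c], odd steps its inverse. *)
pose cc (b : bool) := if b then c^-1 else c.
have ccr b : cc b != 0 /\ realisable (cc b)^-1.
  by case: b; rewrite /cc ?invrK ?invr_eq0.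
have ccV b : (cc b)^-1 = cc (~~ b) by case: b; rewrite /cc /= ?invrK.
pose good (b : bool) (p : nat * nat * D) := partial_aut (cc b) p.1.1 p.1.2 p.2.
(* Made total for the sake of [choice]: a triple that is not [good] is sent to itself. *)
have step (bp : bool * (nat * nat * D)) : exists p', good bp.1 bp.2 ->
    [/\ good (~~ bp.1) p', p'.1.1 = bp.2.1.2 &
      forall x, lvl bp.2.1.1 x -> Ad p'.2 (Ad bp.2.2 x) = x].
  case: bp => b p; case: (pselect (good b p)) => [gp|ng]; last first.
    by exists p => /= gp; case: (ng gp).
  have [n0 rV] := ccr b.
  have [l [v [vP vx]]] := partial_aut_step n0 rV gp.
  by exists (p.1.2, l, v) => _; split=> //; rewrite /good -ccV.
have [F FP] := choice step.
have [m0 h0] := partial_aut_exists 0 cr; have [u0 u0P] := h0 _ (leqnn m0).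
pose sq := fix sq j := if j is j'.+1 then F (odd j', sq j') else (0%N, m0, u0).
have sqP j : good (odd j) (sq j).
  by elim: j => [|j IH] //=; case: (FP (odd j, sq j) IH).
pose lev j := (sq j).1.1; pose u j := (sq j).2.
have levS j : lev j.+1 = (sq j).1.2 by case: (FP (odd j, sq j) (sqP j)).
have uS j x : lvl (lev j) x -> Ad (u j.+1) (Ad (u j) x) = x.
  by case: (FP (odd j, sq j) (sqP j)) => _ _ h; exact: h.
have uP j : partial_aut (cc (odd j)) (lev j) (lev j.+1) (u j).
  by rewrite levS; exact: sqP.
have uU j : unital_star_hom (Ad (u j)) by apply: unital_star_hom_Ad; case: (uP j).
have ulev j x : lvl (lev j) x -> lvl (lev j.+1) (Ad (u j) x).
  by case: (uP j) => _ _ _ [w [w' [[h _ _ _ _] _ _ _]]]; exact: h.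
have lev_lt j : (lev j < lev j.+1)%N by case: (uP j).
have lev_mono i j : (i <= j)%N -> (lev i <= lev j)%N.
  move=> /subnK <-; elim: (j - i)%N => [|n IH] //.
  by rewrite addSn (leq_trans IH) // ltnW.
have lev_ge j : (j <= lev j)%N.
  by elim: j => // j IH; exact: leq_ltn_trans (lev_lt j).
(* Conjugation by [u j] and by [u j.+2] are both inverse to that by [u j.+1] on the relevant levels,
   so each parity class stabilises on every level. *)
have ustep j x : lvl (lev j) x -> Ad (u j.+2) x = Ad (u j) x.
  move=> jx; rewrite -{1}(uS j x jx).
  by rewrite uS //; exact: ulev.
have ueven j n x : lvl (lev j) x -> Ad (u (j + n.*2)%N) x = Ad (u j) x.
  move=> jx; elim: n => [|n IH]; first by rewrite addn0.
  rewrite doubleS !addnS ustep //; apply: lvl_mono jx.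
  by apply: lev_mono; exact: leq_addr.
have ulim (b : bool) x : exists y, forall j, odd j = b -> lvl (lev j) x -> Ad (u j) x = y.
  have [i ix] := tw_exhaust T x.
  have [j0 [bj0 jx0]] : exists j0, odd j0 = b /\ lvl (lev j0) x.
    exists (i.*2 + b)%N; rewrite oddD odd_double; split; first by case: (b).
    apply: lvl_mono ix; apply: leq_trans (lev_ge _).
    by rewrite -addnn -addnA leq_addr.
  exists (Ad (u j0) x) => j bj jx.
  wlog jj : j j0 bj jx bj0 jx0 / (j <= j0)%N => [h|].
    by case: (leqP j j0) => hj; [exact: h | rewrite -(h j0 j) // ltnW].
  have : ~~ odd (j0 - j) by rewrite oddB // bj bj0 addbb.
  by move=> /even_halfK hj; rewrite -(subnKC jj) -hj ueven.
have [phi phiP] := choice (fun bx : bool * D => ulim bx.1 bx.2).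
have phiE b j x : odd j = b -> lvl (lev j) x -> phi (b, x) = Ad (u j) x.
  by move=> bj jx; rewrite -(phiP (b, x) j).
have big b x y : exists j, [/\ odd j = b, lvl (lev j) x & lvl (lev j) y].
  have [i [ix iy]] := lvl_ex2 T x y.
  have ile : (i <= lev (i.*2 + b))%N.
    by apply: leq_trans (lev_ge _); rewrite -addnn -addnA leq_addr.
  exists (i.*2 + b)%N; rewrite oddD odd_double; split; first by case: (b).
    exact: lvl_mono ix.
  exact: lvl_mono iy.
have phiH b : unital_star_hom (fun x => phi (b, x)).
  split; last first.
    by have [j [bj j1 _]] := big b 1 1; rewrite (phiE b j) //; case: (uU j).
  split=> [a x y|x y|x].
  - have [j [bj jx jy]] := big b x y; case: (uU j) => [[uL _ _] _].
    by rewrite !(phiE b j) ?uL //; exact: (lvl_lin a jx jy).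
  - have [j [bj jx jy]] := big b x y; case: (uU j) => [[_ uM _] _].
    by rewrite !(phiE b j) ?uM //; exact: (lvlM jx jy).
  - have [j [bj jx jy]] := big b x x; case: (uU j) => [[_ _ uS'] _].
    by rewrite !(phiE b j) ?uS' //; exact: (range_emb_star (embP _) jx).
have phiK b x : phi (~~ b, phi (b, x)) = x.
  have [j [bj jx _]] := big b x x.
  rewrite (phiE b j) // (phiE (~~ b) j.+1) ?uS //= ?bj //.
  exact: ulev.
have phiR j : rigid_deg T (fun x => phi (odd j, x)) (lev j) (lev j.+1)
    (cc (odd j) * rho (lev j) (lev j.+1)).
  case: (uP j) => _ _ _; apply: eq_rigid_deg => x jx.
  by rewrite (phiE _ j).
have phiB b : block_preserving T (fun x => phi (b, x)).
  have jb i : exists j, odd j = b /\ (i <= lev j)%N.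
    exists (i.*2 + b)%N; rewrite oddD odd_double; split; first by case: (b).
    by apply: leq_trans (lev_ge _); rewrite -addnn -addnA leq_addr.
  split=> x [i ix]; have [j [bj ij]] := jb i; have := phiR j; rewrite bj;
    move=> [w [w' [hr _ _ _]]]; have [h1 h2] := rigid_in_blocks (phiH b) hr.
    by exists (lev j.+1); apply: h1; exact: in_blocks_mono1 ix.
  by exists (lev j.+1); apply: h2; exact: in_blocks_mono2 ix.
exists (fun x => phi (false, x)), (fun x => phi (true, x)); split.
  by split=> //; [move=> x; exact: (phiK false) | move=> x; exact: (phiK true)].
by exists (lev 0), (lev 1); split; [exact: ltnW | exact: (phiR 0%N)].
Qed.

End BackAndForth.

(** * Integrality and size of degrees *)

Section DegreeArithmetic.
Variables (C : numClosedFieldType) (D : starAlgType C) (T : balanced_tower D).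
Implicit Types (f g : D -> D) (k m l : nat) (c d : C).

Local Notation rho := (rho T).
Local Notation size k := (tw_size T k).

(* the integer by which a map of normalised degree [c * rho k m] acts on H_1 *)
Definition integral_degree c k m := c * rho k m * (size m)%:R / (size k)%:R.

(** The bound is [|A - B| <= A + B] for the multiplicities. Applied to all powers of an automorphism
    it limits its degree. *)
Lemma rho_norm_le1 f k m c : unital_star_hom f -> rigid_deg T f k m c -> `|c| <= 1.
Proof.
move=> fP /(rigid_deg_multiplicities fP)[A [B [hs hc]]].
have : (size m)%:R != 0 :> C by exact: size_neq0.
rewrite hs pnatr_eq0 muln_eq0 double_eq0 negb_or => /andP[AB0 _].
have AB : 0 < (A + B)%:R :> C by rewrite ltr0n lt0n.
rewrite -(ler_pM2r AB) mul1r -[X in _ * X](ger0_norm (ltW AB)) -normrM hc.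
by apply: le_trans (ler_normB _ _) _; rewrite !ger0_norm ?ler0n // natrD.
Qed.

Lemma integral_degree_multiplicities c k m (A B : nat) :
  size m = ((A + B).*2 * size k)%N -> c * rho k m * (A + B)%:R = A%:R - B%:R ->
  integral_degree c k m = (2 * (A%:Z - B%:Z))%:~R.
Proof.
move=> hs hc; rewrite intrM intrB /integral_degree hs -!pmulrn -hc.
by rewrite -muln2 !natrM; field; exact: size_neq0.
Qed.

Lemma rigid_deg_integral f k m c : unital_star_hom f ->
  rigid_deg T f k m (c * rho k m) -> exists z : int, integral_degree c k m = z%:~R.
Proof.
move=> fP /(rigid_deg_multiplicities fP)[A [B [hs hc]]].
by exists (2 * (A%:Z - B%:Z)); exact: integral_degree_multiplicities.
Qed.

Lemma integral_degreeM c k m l : (k <= m)%N -> (m <= l)%N ->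
  integral_degree c k l = integral_degree c k m * integral_degree 1 m l.
Proof.
move=> km ml; rewrite /integral_degree -(rhoM _ km ml) mul1r; field.
by rewrite !size_neq0.
Qed.

(* Two balanced steps supply the divisibility by 4. *)
Lemma realisable_of_integral c :
  (forall k, exists2 m, (k <= m)%N & exists z : int, integral_degree c k m = z%:~R) ->
  (forall k, exists m0, forall m, (m0 <= m)%N -> `|c * rho k m| <= 1) ->
  realisable T c.
Proof.
move=> cint cle k; have [m1 km1 [z1 hz1]] := cint k.
have idP := unital_star_hom_id D.
have [m2 m12 h12] := rigid_deg_id T m1; have [m3 m23 h23] := rigid_deg_id T m2.
have [m4 hle] := cle k; exists (maxn m3 m4) => m; rewrite geq_max => /andP[m3m m4m].
have m2m : (m2 <= m)%N by exact: leq_trans m3m.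
have [A1 [B1 [hs1 hc1]]] := rigid_deg_multiplicities idP (h12 _ (leqnn _)).
have [A2 [B2 [hs2 hc2]]] := rigid_deg_multiplicities idP (h23 _ m3m).
have [w [w' [hw _]]] := rigid_id T km1.
have [n hn] : exists n, size m1 = (n * size k)%N.
  have r0 : (0 < size k)%N by case: (tw_embP T k).
  pose e := tw_emb T k (delta_mx (Ordinal r0) (Ordinal r0)).
  have me : lvl T m1 e by apply: (lvl_mono km1); exact: range_munit.
  have [n [X [_ _ te]]] := projection_decomp (tw_tauP T) (tw_embP T m1) me
    (munit_projection (tw_embP T k) _).
  exists n; apply/eqP; rewrite -(eqr_nat C) natrM -[n%:R](mulfVK (size_neq0 T m1)) -te.
  rewrite (tau_munit (tw_tauP T) (tw_embP T k)).
  by apply/eqP; field; exact: size_neq0.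
(* With multiplicity 2 N and degree 2 Z one would need A + B = N and A - B = Z, where parities may
   clash. With 4 N and 4 Z the solution N + Z, N - Z is integral, and it is nonnegative by the bound
   on [c * rho k m]. *)
pose N := (n * (A1 + B1) * (A2 + B2))%N.
pose Z : int := z1 * (A1%:Z - B1%:Z) * (A2%:Z - B2%:Z).
have hm : size m = (4 * N * size k)%N.
  by rewrite hs2 hs1 hn /N -!muln2; ring.
have hZ : c * rho k m * (4 * N)%:R = (4 * Z)%:~R.
  have : integral_degree c k m = (4 * Z)%:~R.
    rewrite (integral_degreeM c km1 (leq_trans m12 m2m)) hz1.
    rewrite -(mul1r (rho _ _)) in hc1; rewrite -(mul1r (rho _ _)) in hc2.
    rewrite (integral_degreeM 1 m12 m2m) (integral_degree_multiplicities hs1 hc1).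
    by rewrite (integral_degree_multiplicities hs2 hc2) -!rmorphM /Z; congr _%:~R; ring.
  move=> <-; rewrite /integral_degree hm natrM.
  by field; exact: size_neq0.
have N0 : 0 < (4 * N)%:R :> C.
  rewrite ltr0n lt0n; have := size_neq0 T m.
  by rewrite hm pnatr_eq0 muln_eq0 negb_or => /andP[].
have ZN : `|Z| <= N%:Z.
  have : `|(4 * Z)%:~R| <= (4 * N)%:R :> C.
    by rewrite -hZ normrM (ger0_norm (ltW N0)) ler_piMl ?hle // ltW.
  rewrite -intr_norm -[(4 * N)%:R]/((4 * N)%N%:Z%:~R : C) ler_int normrM PoszM.
  by rewrite ler_pM2l.
move: ZN; rewrite ler_norml => /andP[ZN1 ZN2].
have hA : (absz (N%:Z + Z)%R)%:Z = N%:Z + Z by rewrite gez0_abs // addrC -lerBlDr sub0r.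
have hB : (absz (N%:Z - Z)%R)%:Z = N%:Z - Z by rewrite gez0_abs // subr_ge0.
exists (absz (N%:Z + Z)), (absz (N%:Z - Z)).
have hAB : (absz (N%:Z + Z)%R + absz (N%:Z - Z)%R = N.*2)%N.
  by apply/eqP; rewrite -eqz_nat PoszD hA hB -addnn PoszD addrACA subrr addr0.
split; first by rewrite hAB hm -!muln2; ring.
rewrite hAB -[X in _ = X - _]/((absz (N%:Z + Z)%R)%:Z%:~R) -[X in _ = _ - X]/((absz (N%:Z - Z)%R)%:Z%:~R).
rewrite hA hB -rmorphB /=.
have -> : N%:Z + Z - (N%:Z - Z) = 2 * Z by ring.
apply: (mulIf (x := 2)); first by rewrite pnatr_eq0.
have -> : (2 * Z)%:~R * 2 = (4 * Z)%:~R :> C by rewrite !rmorphM /=; ring.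
by rewrite -hZ -muln2 !natrM; ring.
Qed.

End DegreeArithmetic.

(** * Automorphisms of rank one direct limits *)

Section RankOneLimit.
Variables (C : numClosedFieldType) (H : zmodType) (h : nat -> {additive int -> H}).
Variable delta : nat -> int.
Hypotheses (delta_neq0 : forall k, delta k != 0)
  (hS : forall k x, h k.+1 (delta k * x) = h k x)
  (h_exhaust : forall y, exists k x, h k x = y)
  (h_inj : forall k, injective (h k)).
Implicit Types (c : C) (x y : H) (k m l : nat) (theta : zmodAut H).

Definition Delta k m : C := \prod_(k <= j < m) (delta j)%:~R.

Lemma Delta_neq0 k m : Delta k m != 0.
Proof.
by rewrite prodf_seq_neq0; apply/allP => j _; rewrite /= intr_eq0 delta_neq0.
Qed.

Lemma DeltaM k m l : (k <= m)%N -> (m <= l)%N -> Delta k m * Delta m l = Delta k l.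
Proof. by move=> km ml; apply/esym/big_cat_nat. Qed.

Lemma h_widen k m (n : int) : (k <= m)%N ->
  exists2 n' : int, h m n' = h k n & n'%:~R = n%:~R * Delta k m :> C.
Proof.
move=> /subnK <-; elim: (m - k)%N => [|i [n' IH1 IH2]].
  by exists n; rewrite /Delta ?big_geq ?mulr1.
exists (delta (i + k)%N * n'); first by rewrite addSn hS.
rewrite addSn /Delta big_nat_recr ?leq_addl //= rmorphM /= IH2 -/(Delta _ _).
by rewrite mulrC mulrA.
Qed.

Lemma h_common x y : exists k n n', h k n = x /\ h k n' = y.
Proof.
have [k [n <-]] := h_exhaust x; have [l [n' <-]] := h_exhaust y.
have [i hi _] := h_widen n (leq_maxl k l); have [j hj _] := h_widen n' (leq_maxr k l).
by exists (maxn k l), i, j.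
Qed.

Lemma coord_ex y : exists c, forall k n, h k n = y -> c = n%:~R / Delta 0 k.
Proof.
have [l [x <-]] := h_exhaust y; exists (x%:~R / Delta 0 l) => k n hkn.
have [i hi iE] := h_widen x (leq_maxl l k); have [j hj jE] := h_widen n (leq_maxr l k).
have ij : i = j by apply: (h_inj (k := maxn l k)); rewrite hi hj hkn.
apply: (mulIf (Delta_neq0 0 (maxn l k))).
rewrite -{1}(DeltaM (leq0n l) (leq_maxl l k)) -(DeltaM (leq0n k) (leq_maxr l k)).
by rewrite !mulrA !mulfVK ?Delta_neq0 // -iE -jE ij.
Qed.

Lemma coord_unique : exists coord : H -> C, forall k n, coord (h k n) = n%:~R / Delta 0 k.
Proof.
have [coord cP] := choice coord_ex.
by exists coord => k n; rewrite (cP (h k n) k n).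
Qed.

(** Identifies [H] with the increasing union in [C] of the groups of integral multiples of
    [1 / Delta 0 k]; [h 0 1] becomes 1. *)
Definition coord : H -> C := sval (cid coord_unique).

Lemma coordE k n : coord (h k n) = n%:~R / Delta 0 k.
Proof. exact: (svalP (cid coord_unique)). Qed.

Lemma coordD x y : coord (x + y) = coord x + coord y.
Proof.
have [k [n [n' [<- <-]]]] := h_common x y.
by rewrite -raddfD !coordE rmorphD /= mulrDl.
Qed.

Lemma coord_inj : injective coord.
Proof.
move=> x y; have [k [n [n' [<- <-]]]] := h_common x y.
rewrite !coordE => /(mulIf (invr_neq0 (Delta_neq0 0 k))) /eqP.
by rewrite eqr_int => /eqP ->.
Qed.

Lemma coord1 : coord (h 0 1) = 1.
Proof. by rewrite coordE /Delta big_geq // divr1. Qed.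

Lemma h_mulz k (n : int) : h k n = h k 1 *~ n.
Proof. by rewrite -raddfMz intz. Qed.

Definition aut_degree theta : C := coord (val theta (h 0 1)).

Lemma zmod_autD theta x y : val theta (x + y) = val theta x + val theta y.
Proof. by have /asboolP := valP theta; apply. Qed.

(** [h 0 1] is a nonzero integral multiple of each [h k 1], so an additive map is determined by its
    value there and acts as a multiplication. *)
Lemma coord_aut theta y : coord (val theta y) = aut_degree theta * coord y.
Proof.
have addMz (F : H -> C) (n : int) z : {morph F : x y / x + y} -> F (z *~ n) = n%:~R * F z.
  move=> FD; have F0 : F 0 = 0 by apply: (addrI (F 0)); rewrite -FD !addr0.
  have FN x : F (- x) = - F x by apply: (addrI (F x)); rewrite -FD !subrr F0.
  have Fn (i : nat) x : F (x *+ i) = i%:R * F x.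
    elim: i => [|i IH]; first by rewrite mulr0n mul0r F0.
    by rewrite mulrS FD IH -natr1 mulrDl mul1r addrC.
  case: n => n; first by rewrite -pmulrn Fn.
  by rewrite NegzE mulrNz FN -pmulrn Fn rmorphN /= mulNr.
have [k [n <-]] := h_exhaust y.
have cD : {morph (fun x => coord (val theta x)) : x y / x + y}.
  by move=> u v; rewrite zmod_autD coordD.
have [d hd dE] := h_widen 1 (leq0n k).
have -> : aut_degree theta = d%:~R * coord (val theta (h k 1)).
  by rewrite /aut_degree -hd h_mulz (addMz _ _ _ cD).
rewrite (h_mulz k n) (addMz _ _ _ cD) (addMz _ _ _ coordD) coordE dE mul1r.
rewrite mulr1z; field; exact: Delta_neq0.
Qed.

Lemma aut_degreeM theta1 theta2 :
  aut_degree (theta1 * theta2)%g = aut_degree theta1 * aut_degree theta2.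
Proof. exact: (coord_aut theta1 (val theta2 (h 0 1))). Qed.

Lemma aut_degree_inj : injective aut_degree.
Proof.
move=> theta1 theta2 h12; apply: val_inj; apply: bijection_ext => x.
by apply: coord_inj; rewrite !coord_aut h12.
Qed.

Lemma aut_degree1 : aut_degree 1%g = 1.
Proof. exact: coord1. Qed.

Lemma aut_degree_neq0 theta : aut_degree theta != 0.
Proof.
apply/eqP => h0; have := aut_degreeM theta (theta^-1)%g.
by rewrite mulgV aut_degree1 h0 mul0r => /eqP; rewrite oner_eq0.
Qed.

Lemma aut_degreeV theta : aut_degree (theta^-1)%g = (aut_degree theta)^-1.
Proof.
apply: (mulfI (aut_degree_neq0 theta)).
by rewrite -aut_degreeM mulgV aut_degree1 divff ?aut_degree_neq0.
Qed.

(** Says that multiplication by [c] maps the range of [coord] into itself. *)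
Definition integral_mult c :=
  forall k, exists2 m, (k <= m)%N & exists z : int, c * Delta k m = z%:~R.

Lemma aut_degree_integral theta : integral_mult (aut_degree theta).
Proof.
move=> k; have [l [n hn]] := h_exhaust (val theta (h k 1)).
have [z hz zE] := h_widen n (leq_maxr k l).
exists (maxn k l); first exact: leq_maxl.
exists z; have := coord_aut theta (h k 1); rewrite -hn -hz !coordE => E.
apply: (mulIf (invr_neq0 (Delta_neq0 0 (maxn k l)))); rewrite E mulr1z.
rewrite -(DeltaM (leq0n k) (leq_maxl k l)); field.
by rewrite !Delta_neq0.
Qed.

Lemma mult_aut_exists c : c != 0 -> integral_mult c -> integral_mult c^-1 ->
  exists theta, aut_degree theta = c.
Proof.
move=> c0 cZ cVZ.
have ex d : integral_mult d -> forall y, exists y', coord y' = d * coord y.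
  move=> dZ y; have [k [n <-]] := h_exhaust y; have [m km [z hz]] := dZ k.
  exists (h m (z * n)); rewrite !coordE rmorphM /= -hz -(DeltaM (leq0n k) km).
  by field; rewrite !Delta_neq0.
have [F FP] := choice (ex _ cZ); have [G GP] := choice (ex _ cVZ).
have FK : cancel F G by move=> y; apply: coord_inj; rewrite GP FP mulKf.
have GK : cancel G F by move=> y; apply: coord_inj; rewrite FP GP mulVKf.
have FA : Bijection FK GK \in @zmod_aut_pred H.
  by apply/asboolP => x y /=; apply: coord_inj; rewrite coordD !FP coordD mulrDr.
by exists (exist (fun f => f \in @zmod_aut_pred H) _ FA); rewrite /aut_degree /= FP coord1 mulr1.
Qed.

End RankOneLimit.

(** * The C*-norm *)

Section CstarNorm.
Variables (R : realType) (D : starAlgType R[i]) (T : tower D).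
Implicit Types (x y z : D) (a b c : R).

Local Notation tau := (tw_tau T).
Local Notation Re := (@complex.Re R).
Let tauP := tw_tauP T.

Lemma ReD (u v : R[i]) : Re (u + v) = Re u + Re v.
Proof. by case: u v => [? ?] [? ?]. Qed.

Lemma ReZ a (u : R[i]) : Re (a%:C%C * u) = a * Re u.
Proof. by case: u => [u v] /=; rewrite mul0r subr0. Qed.

(* the square of the norm of the pre-Hilbert space given by the trace *)
Definition sqnorm x : R := Re (tau (star x * x)).

Definition cross x y : R := Re (tau (star x * y + star y * x)).

Lemma sqnorm_ge0 x : 0 <= sqnorm x.
Proof. by have := tau_ge0 T x; rewrite lecE => /andP[]. Qed.

Lemma tau_sqnorm x : tau (star x * x) = (sqnorm x)%:C%C.
Proof. by rewrite [RHS]RRe_real // ger0_real // tau_ge0. Qed.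

Lemma sqnorm_eq0 x : sqnorm x = 0 -> x = 0.
Proof. by move=> h; apply: (tau_eq0 (T := T)); rewrite tau_sqnorm h. Qed.

Lemma sqnorm0 : sqnorm 0 = 0.
Proof. by rewrite /sqnorm mulr0 (tau0 tauP). Qed.

Lemma sqnormD x y : sqnorm (x + y) = sqnorm x + sqnorm y + cross x y.
Proof.
rewrite /sqnorm /cross starD mulrDl !mulrDr !(tauD tauP) !ReD.
by rewrite -!addrA; congr (_ + _); rewrite [LHS]addrA [LHS]addrC.
Qed.

Lemma sqnormZ (c : R[i]) x : sqnorm (c *: x) = Re (`|c| ^+ 2) * sqnorm x.
Proof.
rewrite /sqnorm starZ -scalerAl -scalerAr scalerA (tauZ tauP) mulrC -normCKC.
by rewrite tau_sqnorm mulrC -(RRe_real (ger0_real (exprn_ge0 2 (normr_ge0 c)))) -rmorphM.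
Qed.

Lemma star_scale_real a x : star (a%:C%C *: x) = a%:C%C *: star x.
Proof. by rewrite starZ conj_Creal // complex_real. Qed.

(** Expand the square norm of [a x - b y]. The free weights stand in for the Cauchy-Schwarz
    inequality. *)
Lemma cross_le a b x y : a * b = 1 ->
  cross x y <= a ^+ 2 * sqnorm x + b ^+ 2 * sqnorm y.
Proof.
move=> ab; have := sqnorm_ge0 (a%:C%C *: x + (- b)%:C%C *: y).
rewrite sqnormD /cross !star_scale_real -!scalerAl -!scalerAr !scalerA.
rewrite [(- b)%:C%C * _]mulrC -scalerDr (tauZ tauP) -rmorphM ReZ mulrN ab mulN1r.
rewrite /sqnorm !star_scale_real -!scalerAl -!scalerAr !scalerA !(tauZ tauP).
by rewrite -!rmorphM !ReZ mulrNN -!expr2 subr_ge0.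
Qed.

(* left multiplication by [x] has norm at most [c] *)
Definition bounded_by x c := 0 <= c /\ forall y, sqnorm (x * y) <= c ^+ 2 * sqnorm y.

Lemma bounded_byD x z a b : bounded_by x a -> bounded_by z b ->
  bounded_by (x + z) (a + b).
Proof.
move=> [a0 xa] [b0 zb]; split=> [|y]; first exact: addr_ge0.
have zero c w : c = 0 -> sqnorm (w * y) <= c ^+ 2 * sqnorm y -> w * y = 0.
  move=> -> h; apply: sqnorm_eq0; apply/eqP; rewrite eq_le sqnorm_ge0 andbT.
  by apply: le_trans h _; rewrite expr0n mul0r.
have [aE|an0] := eqVneq a 0.
  by rewrite mulrDl (zero a x) // add0r aE add0r.
have [bE|bn0] := eqVneq b 0.
  by rewrite mulrDl (zero b z) // addr0 bE addr0.
have a_gt0 : 0 < a by rewrite lt_def an0.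
have b_gt0 : 0 < b by rewrite lt_def bn0.
rewrite mulrDl sqnormD.
(* This weight makes both terms of [cross_le] at most [a * b * sqnorm y], as the square of [a + b]
   requires; it explains the separate treatment of zero bounds. *)
pose r := Num.sqrt (b / a).
have r_gt0 : 0 < r by rewrite sqrtr_gt0 divr_gt0.
have r2 : r ^+ 2 = b / a by rewrite sqr_sqrtr // divr_ge0.
have := cross_le (x * y) (z * y) (divff (lt0r_neq0 r_gt0)).
rewrite exprVn r2 invf_div => h.
apply: le_trans (lerD (lerD (xa y) (zb y)) h) _.
have h1 : b / a * sqnorm (x * y) <= a * b * sqnorm y.
  apply: le_trans (ler_wpM2l (divr_ge0 b0 a0) (xa y)) _.
  by rewrite le_eqVlt; apply/orP; left; apply/eqP; field.
have h2 : a / b * sqnorm (z * y) <= a * b * sqnorm y.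
  apply: le_trans (ler_wpM2l (divr_ge0 a0 b0) (zb y)) _.
  by rewrite le_eqVlt; apply/orP; left; apply/eqP; field.
apply: le_trans (lerD (lexx _) (lerD h1 h2)) _.
by rewrite le_eqVlt; apply/orP; left; apply/eqP; ring.
Qed.

Lemma Re_norm_ge0 (c : R[i]) : 0 <= Re `|c|.
Proof. by have := normr_ge0 c; rewrite lecE => /andP[]. Qed.

Lemma Re_norm_sqr (c : R[i]) : Re (`|c| ^+ 2) = Re `|c| ^+ 2.
Proof.
by rewrite -[in LHS](RRe_real (ger0_real (normr_ge0 c))) -rmorphXn.
Qed.

Lemma bounded_byZ (c : R[i]) x a : bounded_by x a -> bounded_by (c *: x) (Re `|c| * a).
Proof.
move=> [a0 xa]; split=> [|y]; first by rewrite mulr_ge0 ?Re_norm_ge0.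
rewrite -scalerAl sqnormZ Re_norm_sqr exprMn -[leRHS]mulrA.
by apply: ler_wpM2l; rewrite ?exprn_ge0 ?Re_norm_ge0.
Qed.

Lemma bounded_byM x z a b : bounded_by x a -> bounded_by z b ->
  bounded_by (x * z) (a * b).
Proof.
move=> [a0 xa] [b0 zb]; split=> [|y]; first exact: mulr_ge0.
rewrite -mulrA; apply: le_trans (xa _) _.
by rewrite exprMn -[leRHS]mulrA; apply: ler_wpM2l; rewrite ?exprn_ge0.
Qed.

Lemma bounded_by_ex x : exists c, bounded_by x c.
Proof.
have [k kx] := tw_exhaust T x; have [a ->] := lvl_sum_munit kx.
apply: (big_ind (fun z => exists c, bounded_by z c)).
- by exists 0; split=> // y; rewrite mul0r sqnorm0 expr0n mul0r.
- by move=> u v [c1 h1] [c2 h2]; exists (c1 + c2); exact: bounded_byD.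
move=> [i j] _; exists (Re `|a i j| * 1); apply: bounded_byZ; split=> //= y.
have eP := tw_embP T k; rewrite expr1n mul1r -subr_ge0.
have [es ee] := munit_projection eP j.
(* A matrix unit is a contraction: the loss is the square norm of the part of [y] outside its
   initial projection. *)
suff <- : sqnorm ((1 - tw_emb T k (delta_mx j j)) * y) =
  sqnorm y - sqnorm (tw_emb T k (delta_mx i j) * y) by exact: sqnorm_ge0.
have -> : sqnorm y = Re (tau (star y * y)) by [].
rewrite /sqnorm; apply/eqP; rewrite eq_sym subr_eq -ReD -(tauD tauP) eq_sym.
apply/eqP; congr (Re (tau _)).
rewrite !starM star_B star_1 es star_munit // !mulrA.
rewrite -(mulrA (star y) (tw_emb T k (delta_mx j i))) munitMid //.
rewrite -(mulrA (star y) (1 - _)) mulrBr !mulrBl !mulr1 !mul1r ee subrr subr0.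
by rewrite mulrBr mulr1 mulrBl subrK.
Qed.

(** The operator norm of left multiplication for the trace inner product; matrix units are
    contractions, so the set of bounds is nonempty. *)
Definition cnorm x : R := inf [set c | bounded_by x c].

Lemma cnorm_le x c : bounded_by x c -> cnorm x <= c.
Proof. by move=> xc; apply: ge_inf => //; exists 0 => d []. Qed.

Lemma cnormP x : bounded_by x (cnorm x).
Proof.
have [c0 hc0] := bounded_by_ex x.
split=> [|y]; first by apply: lb_le_inf; [exists c0 | move=> c []].
have [y0|yn0] := eqVneq (sqnorm y) 0.
  by case: hc0 => _ /(_ y); rewrite y0 !mulr0.
have y_gt0 : 0 < sqnorm y by rewrite lt_def yn0 sqnorm_ge0.
have h0 : 0 <= sqnorm (x * y) / sqnorm y by rewrite divr_ge0 ?sqnorm_ge0.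
have h : Num.sqrt (sqnorm (x * y) / sqnorm y) <= cnorm x.
  apply: lb_le_inf; first by exists c0.
  move=> c [c_ge0 xc]; rewrite -(ger0_norm c_ge0) -sqrtr_sqr ler_sqrt ?exprn_ge0 //.
  by rewrite ler_pdivrMr.
rewrite -ler_pdivrMr // -(sqr_sqrtr h0) ler_pXn2r // nnegrE ?sqrtr_ge0 //.
exact: le_trans (sqrtr_ge0 _) h.
Qed.

Lemma cnorm_ge0 x : 0 <= cnorm x. Proof. by case: (cnormP x). Qed.

Lemma cnormM x y : cnorm (x * y) <= cnorm x * cnorm y.
Proof. by apply: cnorm_le; apply: bounded_byM; exact: cnormP. Qed.

Lemma cnormZ_le (a : R[i]) x : cnorm (a *: x) <= Re `|a| * cnorm x.
Proof. by apply: cnorm_le; apply: bounded_byZ; exact: cnormP. Qed.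

(* From [0 <= |x* x y - c y|^2] with [c = |x* x|]. *)
Lemma cnorm_sqr_le x : cnorm x ^+ 2 <= cnorm (star x * x).
Proof.
set c := cnorm (star x * x); have [c_ge0 cP] := cnormP (star x * x).
rewrite -/c in c_ge0 cP.
have [c0|cn0] := eqVneq c 0.
  have x0 : x = 0.
    apply: sqnorm_eq0; apply/eqP; rewrite eq_le sqnorm_ge0 andbT.
    have xx0 : star x * x = 0.
      apply: sqnorm_eq0; apply/eqP; rewrite eq_le sqnorm_ge0 andbT.
      by have := cP 1; rewrite mulr1 c0 expr0n mul0r.
    by rewrite /sqnorm xx0 (tau0 tauP).
  have : cnorm x <= 0.
    by apply: cnorm_le; split=> // y; rewrite x0 mul0r sqnorm0 expr0n mul0r.
  move=> h; have -> : cnorm x = 0 by apply/eqP; rewrite eq_le h cnorm_ge0.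
  by rewrite expr0n.
have c_gt0 : 0 < c by rewrite lt_def cn0.
suff h : cnorm x <= Num.sqrt c.
  rewrite -[leRHS](sqr_sqrtr c_ge0) ler_pXn2r //; rewrite nnegrE.
    exact: cnorm_ge0.
  exact: sqrtr_ge0.
apply: cnorm_le; split=> [|y]; first exact: sqrtr_ge0.
rewrite sqr_sqrtr //.
pose r := Num.sqrt c.
have r_gt0 : 0 < r by rewrite sqrtr_gt0.
have r2 : r ^+ 2 = c by rewrite sqr_sqrtr.
have := cross_le (star x * x * y) y (mulVf (lt0r_neq0 r_gt0)).
have -> : cross (star x * x * y) y = 2 * sqnorm (x * y).
  rewrite /cross /sqnorm !starM starK !mulrA (tauD tauP) ReD.
  by rewrite mulr2n mulrDl mul1r.
rewrite exprVn r2 => h.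
have h2 : c^-1 * sqnorm (star x * x * y) <= c * sqnorm y.
  apply: le_trans (ler_wpM2l _ (cP y)) _; first by rewrite invr_ge0.
  by rewrite expr2 !mulrA mulVf // mul1r.
rewrite -(ler_pM2l (ltr0Sn R 1)); apply: le_trans h _.
apply: le_trans (lerD h2 (lexx _)) _.
by rewrite mulr_natl mulr2n.
Qed.

Lemma cnorm_cstar : cstar_norm cnorm.
Proof.
have star_le x : cnorm x <= cnorm (star x).
  have [->|xn0] := eqVneq (cnorm x) 0; first exact: cnorm_ge0.
  have := le_trans (cnorm_sqr_le x) (cnormM _ _).
  by rewrite expr2 ler_pM2r // lt_def xn0 cnorm_ge0.
split.
- move=> x x0; apply: sqnorm_eq0; apply/eqP; rewrite eq_le sqnorm_ge0 andbT.
  by case: (cnormP x) => _ /(_ 1); rewrite mulr1 x0 expr0n mul0r.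
- by move=> x y; apply: cnorm_le; apply: bounded_byD; exact: cnormP.
- move=> a x; apply/eqP; rewrite eq_le cnormZ_le andTb.
  have [->|a0] := eqVneq a 0.
    by rewrite normr0 mul0r cnorm_ge0.
  have := cnormZ_le a^-1 (a *: x); rewrite scalerA mulVf // scale1r.
  move=> /(ler_wpM2l (Re_norm_ge0 a)); rewrite mulrA.
  suff -> : Re `|a| * Re `|a^-1| = 1 by rewrite mul1r.
  rewrite -ReZ RRe_real; last exact: ger0_real.
  by rewrite -normrM divff // normr1.
- exact: cnormM.
move=> x; apply/eqP; rewrite eq_le cnorm_sqr_le andbT.
apply: le_trans (cnormM _ _) _; rewrite expr2; apply: ler_wpM2r; first exact: cnorm_ge0.
by rewrite -{2}[x](@starK _ D) star_le.
Qed.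

End CstarNorm.

(** * Degrees under norm approximation *)

Section Closeness.
Variables (R : realType) (D : starAlgType R[i]) (T : balanced_tower D).
Variables (N : D -> R) (NP : cstar_norm N).
Implicit Types (x y z p : D) (k m : nat).

Local Notation tau := (tw_tau T).
Local Notation q := (tw_q T).
Local Notation s := (tw_s T).
Local Notation t := (tw_t T).
Local Notation lvl := (lvl T).
Local Notation size k := (tw_size T k).
Let tauP := tw_tauP T.
Let embP := tw_embP T.

Let ND x y : N (x + y) <= N x + N y. Proof. by case: NP. Qed.
Let NM x y : N (x * y) <= N x * N y. Proof. by case: NP. Qed.
Let NS x : N (star x * x) = N x ^+ 2. Proof. by case: NP. Qed.
Let N_ge0 x : 0 <= N x. Proof. exact: cstar_norm_ge0. Qed.

Lemma norm_projection_le1 p : projection p -> N p <= 1.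
Proof.
move=> [ps pp]; have := NS p; rewrite ps pp => /eqP.
rewrite expr2 -subr_eq0 -[X in X - _]mulr1 -mulrBr mulf_eq0 subr_eq0.
by move=> /orP[/eqP-> //|/eqP<-].
Qed.

Lemma norm_partial_isometry_le1 x : projection (star x * x) -> N x <= 1.
Proof.
move=> /norm_projection_le1; rewrite NS => h.
by rewrite -(@ler_pXn2r _ 2) ?nnegrE // expr1n.
Qed.

(** If one trace were larger, [projection_common_vector] would give an element fixed by [p - p'],
    forcing the norm of the difference to be at least 1. *)
Lemma tau_close m p p' : lvl m p -> lvl m p' -> projection p -> projection p' ->
  N (p - p') < 1 -> tau p = tau p'.
Proof.
have le x x' : lvl m x -> lvl m x' -> projection x -> projection x' ->
    N (x - x') < 1 -> ~ (tau x' < tau x).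
  move=> mx mx' xP x'P h lt.
  have [v [v0 xv x'v]] := projection_common_vector tauP (embP m) mx mx' xP x'P lt.
  have := NM (x - x') v; rewrite mulrBl xv x'v subr0 => h2.
  have Nv : 0 < N v.
    rewrite lt_def N_ge0 andbT; apply: contraNneq v0 => Nv0.
    by case: NP => N0 _ _ _ _; rewrite (N0 v).
  by move: h2; rewrite ler_pMl // leNgt h.
move=> mp mp' pP p'P h; have h' : N (p' - p) < 1.
  by rewrite -(cstar_normN NP) opprB.
have [n [X [_ _ tn]]] := projection_decomp tauP (embP m) mp pP.
have [n' [X' [_ _ tn']]] := projection_decomp tauP (embP m) mp' p'P.
have := le _ _ mp mp' pP p'P h; have := le _ _ mp' mp p'P pP h'.
have sm : 0 < (size m)%:R :> R[i] by rewrite ltr0n; case: (embP m).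
rewrite tn tn' !ltr_pM2r ?invr_gt0 // !ltr_nat => /negP; rewrite -leqNgt => h1.
by move=> /negP; rewrite -leqNgt => h2; congr (_%:R / _); apply/eqP; rewrite eqn_leq h1 h2.
Qed.

Lemma half_sign_eigenprojection r (g : 'M[R[i]]_r -> D) q0 s0 :
  half_sign g q0 s0 -> projection (2^-1 *: (q0 + s0)).
Proof.
move=> h; have [_ ss s2 qs _] := h; have sq := half_sign_mulr h.
have [qs' qq] := half_sign_projection h; split.
  by rewrite starZ starD ss qs' conj_Creal // realV realn.
rewrite -scalerAl -scalerAr mulrDl !mulrDr qq qs sq s2 [s0 + q0]addrC.
by rewrite scaler_half.
Qed.

(** A matrix unit from block 3 to block 1 is an element on which both signs act trivially. *)
Lemma corner_exists k : exists a, [/\ lvl k a, s k * a = a, a * t k = a,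
  projection (a * star a) /\ projection (star a * a) & tau (a * star a) != 0].
Proof.
have eP := embP k.
have [_ _ _ _ [[i hi] _]] := tw_sP T k; have [_ ts _ _ [[j hj] _]] := tw_tP T k.
exists (tw_emb T k (delta_mx i j)); split.
- exact: range_munit.
- by rewrite -(munitMid eP i i j) mulrA hi.
- rewrite -(munitMid eP i j j) -mulrA; congr (_ * _).
  by apply: (inv_inj (@starK _ D)); rewrite starM ts star_munit.
- by rewrite star_munit // !munitMid //; split; exact: munit_projection.
- rewrite star_munit // munitMid // (tau_munit tauP eP) invr_eq0.
  exact: size_neq0.
Qed.

(** The halved sums are the block projections 1 and 3 of level [m]. On [f a], with [a] from block 3
    to block 1, this isolates the summands of [f] of type id. *)
Definition corner_projection m a := 2^-1 *: (q + s m) * a *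
  (2^-1 *: (1 - q + t m)) * star a.

Lemma corner_projectionP f k m c a : unital_star_hom f -> rigid_deg T f k m c ->
  lvl k a -> s k * a = a -> a * t k = a -> projection (a * star a) ->
  [/\ lvl m (corner_projection m (f a)), projection (corner_projection m (f a)) &
    tau (corner_projection m (f a)) = tau (a * star a) * (4^-1 * (1 + c))].
Proof.
move=> fP [w [w' [[fB fq [Bw wP wC sE] [Bw' w'P w'C tE] ww'] w0 w'0 wc]]] ka sa at_ aP.
have [[fL fM fS] f1] := fP.
have fka : (f @` lvl k) (f a) by exists a.
have ksa : lvl k (star a) by exact: range_emb_star.
have fksa : (f @` lvl k) (f (star a)) by exists (star a).
have fkaa : (f @` lvl k) (f (a * star a)) by exists (a * star a) => //; exact: lvlM.
have qa : q * a = a by have [_ _ _ qs _] := tw_sP T k; rewrite -sa mulrA qs.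
have ap : a * (1 - q) = a by rewrite -at_ -mulrA (half_sign_mulr (tw_tP T k)).
have E : corner_projection m (f a) = f (a * star a) * (half w false * half w' false).
  have e1 : 2^-1 *: (q + s m) * f a = f a * half w false.
    rewrite halfE expr0 scale1r -scalerAl -scalerAr mulrDl mulrDr mulr1.
    by rewrite -{1}fq -fM qa sE -mulrA wC // mulrA -fM sa.
  have e2 : f a * (2^-1 *: (1 - q + t m)) = f a * half w' false.
    rewrite halfE expr0 scale1r -!scalerAr mulrDr [f a * (1 + w')]mulrDr mulr1; congr (_ *: (_ + _)).
      by rewrite -{1}f1 -{1}fq -(linear_funB fL) -fM ap.
    by rewrite tE mulrA -fM at_.
  rewrite /corner_projection e1.
  have hw : commutes_with (f @` lvl k) (half w false) by exact: half_commutes.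
  have hw' : commutes_with (f @` lvl k) (half w' false) by exact: half_commutes.
  rewrite -(hw _ fka) -(mulrA (half w false)) e2 -fS -(mulrA (half w false)).
  rewrite -(mulrA (f a)) (hw' _ fksa) (mulrA (f a)) -fM mulrA (hw _ fkaa).
  by rewrite -mulrA.
have feP : projection (f (a * star a)).
  by case: aP => e1 e2; split; rewrite -?fS -?fM ?e1 ?e2.
rewrite E; split.
- by apply: lvlM; [apply: fB; exact: lvlM | apply: lvlM; exact: range_half].
- have := joint_projection feP wP w'P ww' (wC _ fkaa) (w'C _ fkaa) (false, false).
  by [].
- rewrite (tau_mul_image fP (k := k)); [|exact: lvlM|].
    by rewrite tau_half2 // w0 w'0 wc !mulr0 !addr0 mul1r expr0 mul1r.
  by apply: commutes_withM; exact: half_commutes.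
Qed.

(** The expression has two factors depending on [a], and each contributes at most [N (a - b)]; hence
    the bound [2^-1]. *)
Lemma corner_projection_close m a b : N a <= 1 -> N b <= 1 -> N (a - b) < 2^-1 ->
  N (corner_projection m a - corner_projection m b) < 1.
Proof.
move=> Na Nb ab.
have Es := norm_projection_le1 (half_sign_eigenprojection (tw_sP T m)).
have Et := norm_projection_le1 (half_sign_eigenprojection (tw_tP T m)).
rewrite /corner_projection; set e := 2^-1 *: _ in Es *; set d := 2^-1 *: _ in Et *.
have -> : e * a * d * star a - e * b * d * star b =
    e * (a - b) * d * star a + e * b * d * star (a - b).
  by rewrite star_B !mulrBr !mulrBl addrA subrK.
have bound x y : N y <= 1 -> N (x * y) <= N x.
  by move=> y1; apply: le_trans (NM _ _) _; rewrite -[leRHS]mulr1 ler_wpM2l.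
have boundl x y : N x <= 1 -> N (x * y) <= N y.
  by move=> x1; apply: le_trans (NM _ _) _; rewrite -[leRHS]mul1r ler_wpM2r.
have h1 : N (e * (a - b) * d * star a) <= N (a - b).
  apply: le_trans (bound _ _ _) _; first by rewrite (cstar_norm_star NP).
  by apply: le_trans (bound _ _ Et) _; exact: boundl.
have h2 : N (e * b * d * star (a - b)) <= N (a - b).
  apply: le_trans (boundl _ _ _) _; last by rewrite (cstar_norm_star NP).
  by apply: le_trans (bound _ _ Et) _; apply: le_trans (bound _ _ Nb) _.
apply: le_lt_trans (ND _ _) _; apply: le_lt_trans (lerD h1 h2) _.
have -> : 1 = 2^-1 + 2^-1 :> R by field.
exact: ltrD.
Qed.

Lemma rigid_deg_close f f' k m c c' a : unital_star_hom f -> unital_star_hom f' ->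
  rigid_deg T f k m c -> rigid_deg T f' k m c' ->
  lvl k a -> s k * a = a -> a * t k = a -> projection (a * star a) ->
  projection (star a * a) -> tau (a * star a) != 0 -> N (f a - f' a) < 2^-1 -> c = c'.
Proof.
move=> fP f'P fc f'c ka sa at_ aP aP' a0 ff'.
have [m1 P1 t1] := corner_projectionP fP fc ka sa at_ aP.
have [m2 P2 t2] := corner_projectionP f'P f'c ka sa at_ aP.
have Nle g : unital_star_hom g -> N (g a) <= 1.
  move=> [[_ gM gS] _]; apply: norm_partial_isometry_le1; case: aP' => e1 e2.
  by rewrite -gS -gM; split; rewrite -?gS -?gM ?e1 ?e2.
have := tau_close m1 m2 P1 P2 (corner_projection_close m (Nle _ fP) (Nle _ f'P) ff').
rewrite t1 t2 => /(mulfI a0) h.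
have four : (4 : R[i])^-1 != 0 by rewrite invr_eq0 pnatr_eq0.
by move: h => /(mulfI four) /addrI.
Qed.

End Closeness.

(** * The outer automorphism group in terms of degrees *)

(** [d] and [e] identify both groups with one and the same subgroup of the multiplicative group of
    [K]. *)
Lemma quotient_iso_by_invariant (K : fieldType) (G H : groupType) (N : normalSubgroup G)
    (d : G -> K) (e : H -> K) :
  (forall x y, d (x * y)%g = d x * d y) -> (forall x, nsg_set N x <-> d x = 1) ->
  (forall x y, e (x * y)%g = e x * e y) -> injective e ->
  (forall x, exists y, e y = d x) -> (forall y, exists x, d x = e y) ->
  group_isomorphic (quotientGroup N) H.
Proof.
move=> dM dN eM eI de ed.
have d1 : d 1%g = 1 by apply/dN; exact: nsg1.
have dV x : d (x^-1)%g * d x = 1 by rewrite -dM mulVg.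
have dE x y : \pi_(quotientGroup N)%qT x = \pi_(quotientGroup N)%qT y <-> d x = d y.
  rewrite quot_eq dN dM; split=> h; last by rewrite -h dV.
  have dx0 : d (x^-1)%g != 0.
    by apply: contra_eq_neq (dV x) => ->; rewrite mul0r eq_sym oner_neq0.
  by apply: (mulfI dx0); rewrite dV h.
have dpi x : d (repr (\pi_(quotientGroup N)%qT x)) = d x.
  by apply/dE; rewrite reprK.
have [F FP] := choice (fun a : quotientGroup N => de (repr a)).
have FM : {morph F : a b / (a * b)%g}.
  move=> a b; apply: eI; rewrite eM !FP.
  have [x ->] := quot_surj a; have [y ->] := quot_surj b.
  have -> : ((\pi_(quotientGroup N)%qT x : quotientGroup N) *
      (\pi_(quotientGroup N)%qT y : quotientGroup N))%g =
    \pi_(quotientGroup N)%qT (x * y)%g by exact: quot_mulE.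
  by rewrite !dpi dM.
have [G' GP] := choice ed.
pose Fm : {multiplicative quotientGroup N -> H} :=
  HB.pack F (isMultiplicative.Build _ _ F FM).
exists Fm; exists (fun y => \pi_(quotientGroup N)%qT (G' y)) => [a|y] /=.
  by rewrite -[RHS](reprK a); apply/dE; rewrite GP FP.
by apply: eI; rewrite FP dpi GP.
Qed.

(** * The degree on the relative automorphism group *)

Section RelativeAutomorphisms.
Variables (R : realType) (D1 D2 D : starAlgType R[i]).
Variables (pi : star_inclusion (D1 * D2)%type D) (T : balanced_tower D).
Hypotheses (pi1 : forall x, (exists y, pi (y, 0) = x) <-> block1 T x)
  (pi2 : forall x, (exists y, pi (0, y) = x) <-> block2 T x).
Implicit Types (f g : relAut pi) (x y z : D) (k m : nat) (c : R[i]).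

Local Notation q := (tw_q T).
Local Notation s := (tw_s T).
Local Notation lvl := (lvl T).

Lemma relAut_bijective f : bijective_star_hom T (val f) (val (f^-1)%g).
Proof.
have uh g : unital_star_hom (val g).
  by split; [exact: relAutP | exact: relAut_1].
have bp g : block_preserving T (val g).
  have /asboolP[_ g1 g2] := valP g; split=> x.
  - move=> /pi1[y yx]; apply/pi1.
    have : [set pi (x, 0) | x in setT] (val g x) by rewrite -g1; exists x => //; exists y.
    by move=> [y' _ h]; exists y'.
  - move=> /pi2[y yx]; apply/pi2.
    have : [set pi (0, y) | y in setT] (val g x) by rewrite -g2; exists x => //; exists y.
    by move=> [y' _ h]; exists y'.
split; [exact: uh | exact: uh | exact: relAutKV | exact: relAutVK | split; exact: bp].
Qed.

Lemma relAut_exists (f g : D -> D) : bijective_star_hom T f g ->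
  exists F : relAut pi, forall x, val F x = f x.
Proof.
move=> [[fH f1] [gH g1] fK gK [[fb1 fb2] [gb1 gb2]]].
have FA : Bijection fK gK \in rel_aut_pred pi.
  apply/asboolP; split=> //=.
  - apply/seteqP; split=> [_ [x [y _ yx] <-]|x [y _ yx]] /=.
      have /pi1[y' h] : block1 T (f x) by apply: fb1; apply/pi1; exists y.
      by exists y'.
    have /pi1[y' h] : block1 T (g x) by apply: gb1; apply/pi1; exists y.
    by exists (g x) => //; exists y'.
  - apply/seteqP; split=> [_ [x [y _ yx] <-]|x [y _ yx]] /=.
      have /pi2[y' h] : block2 T (f x) by apply: fb2; apply/pi2; exists y.
      by exists y'.
    have /pi2[y' h] : block2 T (g x) by apply: gb2; apply/pi2; exists y.
    by exists (g x) => //; exists y'.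
by exists (exist (fun h => h \in rel_aut_pred pi) _ FA).
Qed.

Definition degree f : R[i] := s2val (cid2 (has_degree_ex (relAut_bijective f))).

Lemma degreeP f : has_degree T (val f) (degree f).
Proof. exact: (s2valP (cid2 (has_degree_ex (relAut_bijective f)))). Qed.

Lemma degree_neq0 f : degree f != 0.
Proof. exact: (s2valP' (cid2 (has_degree_ex (relAut_bijective f)))). Qed.

Lemma has_degree_relAut f c : has_degree T (val f) c -> degree f = c.
Proof.
by apply: has_degree_unique (degreeP f); case: (relAut_bijective f).
Qed.

Lemma degreeM f g : degree (f * g)%g = degree f * degree g.
Proof.
apply: has_degree_relAut; rewrite mulrC.
exact: (has_degree_comp (relAut_bijective g) (relAut_bijective f)
  (degreeP g) (degreeP f)).
Qed.

Lemma in_blocks_disjoint k (q0 s0 x q1 s1 : D) : half_sign (tw_emb T k) q0 s0 ->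
  half_sign (tw_emb T k) q1 s1 -> q0 * q1 = 0 -> q1 * q0 = 0 ->
  in_blocks (lvl k) q0 s0 x -> x * s1 = s1 * x /\ x * q1 = q1 * x.
Proof.
move=> h0 h1 q01 q10 [_ qx xq _]; have [_ _ _ qs1 _] := h1.
have sq1 := half_sign_mulr h1; split.
  have -> : x * s1 = 0 by rewrite -xq -qs1 mulrA -(mulrA x) q01 mulr0 mul0r.
  by rewrite -qx -sq1 mulrA -(mulrA s1) q10 mulr0 mul0r.
have -> : x * q1 = 0 by rewrite -xq -mulrA q01 mulr0.
by rewrite -qx mulrA q10 mul0r.
Qed.

Lemma unitary_diagonal (u : D1 * D2) : unitary u ->
  exists m0, forall m, (m0 <= m)%N -> diagonal_unitary T m (pi u).
Proof.
move=> uP; have piU := unitary_incl pi uP.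
case: (incl_hom pi) => piL _ _.
have uE : pi u = pi (u.1, 0) + pi (0, u.2).
  rewrite -(linear_funD piL); congr (pi _).
  by case: (u) => a b; rewrite -[RHS]/(a + 0, 0 + b) addr0 add0r.
have /pi1[k1 h1] : exists y : D1, pi (y, 0) = pi (u.1, 0) by exists u.1.
have /pi2[k2 h2] : exists y : D2, pi (0, y) = pi (0, u.2) by exists u.2.
exists (maxn k1 k2) => m; rewrite geq_max => /andP[km1 km2].
have b1 := in_blocks_mono1 km1 h1; have b2 := in_blocks_mono2 km2 h2.
have [_ qq] := q_projection T.
have qp : q * (1 - q) = 0 by rewrite mulrBr mulr1 qq subrr.
have pq : (1 - q) * q = 0 by rewrite mulrBl mul1r qq subrr.
have [e1 e2] := in_blocks_disjoint (tw_sP T m) (tw_tP T m) qp pq b1.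
have [e3 e4] := in_blocks_disjoint (tw_tP T m) (tw_sP T m) pq qp b2.
case: b1 => l1 qx xq xs; case: b2 => l2 py yp yt.
split=> //; rewrite uE.
- exact: (range_embD (tw_embP T m) l1 l2).
- by rewrite mulrDl mulrDr xq qx e4.
- by rewrite mulrDl mulrDr xs e3.
- by rewrite mulrDl mulrDr yt e1.
Qed.

Lemma diagonal_unitary_incl m z : diagonal_unitary T m z ->
  exists2 u : D1 * D2, unitary u & pi u = z.
Proof.
move=> [[z1 z2] mz zq zs zt]; have [_ qq] := q_projection T.
have [_ _ _ qs _] := tw_sP T m; have [_ _ _ qt _] := tw_tP T m.
have sq := half_sign_mulr (tw_sP T m); have tq := half_sign_mulr (tw_tP T m).
have [_ pp] := half_sign_projection (tw_tP T m).
have zp : z * (1 - q) = (1 - q) * z by rewrite mulrBr mulrBl mulr1 mul1r zq.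
have mq := lvl_q T m.
have mp : lvl m (1 - q) by exact: half_sign_range (tw_embP T m) (tw_tP T m).
have /pi1[x xE] : block1 T (z * q).
  exists m; split; first exact: lvlM.
  - by rewrite zq mulrA qq.
  - by rewrite -mulrA qq.
  - by rewrite -mulrA qs mulrA -zs -mulrA sq.
have /pi2[y yE] : block2 T (z * (1 - q)).
  exists m; split; first exact: lvlM.
  - by rewrite zp mulrA pp.
  - by rewrite -mulrA pp.
  - by rewrite -mulrA qt mulrA -zt -mulrA tq.
case: (incl_hom pi) => piL piM piS.
have zE : pi (x, y) = z.
  have -> : (x, y) = (x, 0) + (0, y) :> D1 * D2.
    by rewrite -[RHS]/(x + 0, 0 + y) addr0 add0r.
  by rewrite (linear_funD piL) xE yE -mulrDr addrC subrK mulr1.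
by exists (x, y) => //; split; apply: (incl_inj (s := pi)); rewrite piM piS zE incl1.
Qed.

(** One unitary that is close enough on a single corner element already decides the degree, since
    its conjugation has degree 1. Conversely, degree 1 gives a unitary for each level, and the
    resulting sequence is eventually constant on every element. *)
Lemma approx_inner_degree1 f : approx_inner f <-> degree f = 1.
Proof.
split=> [[u [uU uf]]|f1].
  have [a [ka sa at_ [aP aP'] a0]] := corner_exists T 0.
  have NP := cnorm_cstar T.
  have : \forall n \near \oo,
      cnorm T (pi (u n) * a * star (pi (u n)) - val f a) < 2^-1.
    have := uf _ NP a => /cvgr0_norm_lt /(_ 2^-1).
    rewrite invr_gt0 ltr0n => /(_ isT); apply: filterS => n /=.
    by rewrite ger0_norm // cnorm_ge0.
  move=> [n _ /(_ n (leqnn n))]; set v := pi (u n) => hn.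
  have [m1 h1] := unitary_diagonal (uU n).
  have [m2 _ h2] := has_degree_lvl (relAut_bijective f) (degreeP f) 0.
  have [m3 _ h3] := rigid_deg_id T 0.
  pose m := maxn m1 (maxn m2 m3).
  have vD : diagonal_unitary T m v by apply: h1; exact: leq_maxl.
  have fm := h2 m (leq_trans (leq_maxl m2 m3) (leq_maxr m1 _)).
  have im := h3 m (leq_trans (leq_maxr m2 m3) (leq_maxr m1 _)).
  have vA := unital_star_hom_Ad (unitary_incl pi (uU n)).
  have vm := rigid_deg_compr (unital_star_hom_id D) vA im (rigid_Ad vD).
  rewrite mulr1 (tau1 (tw_tauP T)) mulr1 in vm.
  have [fH _ _ _ _] := relAut_bijective f.
  have := rigid_deg_close NP vA fH vm fm ka sa at_ aP aP' a0 hn.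
  rewrite -{1}[rho T 0 m]mul1r => /(mulIf (rho_neq0 T 0 m)) ->.
  by [].
have inner k : exists u : D1 * D2, unitary u /\
    forall x, lvl k x -> pi u * x * star (pi u) = val f x.
  have := degreeP f; rewrite f1 => f1'.
  have [m [z [zD zf]]] := has_degree1_inner (relAut_bijective f) f1' k.
  by have [u uU uz] := diagonal_unitary_incl zD; exists u; split=> //; rewrite uz.
have [u uP] := choice inner; exists u; split=> [n|N NP x]; first by case: (uP n).
apply: cvg_near_cst; have [k kx] := tw_exhaust T x.
exists k => // n /= kn; case: (uP n) => _ ->.
  by rewrite subrr (cstar_norm0 NP).
exact: lvl_mono kx.
Qed.

End RelativeAutomorphisms.

(** * Block projections and rigid embeddings *)

Section BlockProjections.
Variables (C : numClosedFieldType) (n : 'I_4 -> nat).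
Local Notation r := (\sum_i n i)%N.
Local Notation Q := (@block_projection C n).
Implicit Types (a b : 'M[C]_r) (i j k l : 'I_4).

Lemma submxblock_projl i a k l :
  submxblock (Q i *m a) k l = (k == i)%:R *: submxblock a k l.
Proof.
rewrite /block_projection -{1}(submxblockK a) mul_mxdiag_mxblock mxblockK.
by case: eqP => _; rewrite ?mul1mx ?scale1r ?mul0mx ?scale0r.
Qed.

Lemma submxblock_projr i a k l :
  submxblock (a *m Q i) k l = (l == i)%:R *: submxblock a k l.
Proof.
rewrite /block_projection -{1}(submxblockK a) mul_mxblock_mxdiag mxblockK.
by case: eqP => _; rewrite ?mulmx1 ?scale1r ?mulmx0 ?scale0r.
Qed.

Lemma submxblock_eq a b : (forall k l, submxblock a k l = submxblock b k l) -> a = b.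
Proof. by move=> ab; rewrite -(submxblockK a) -(submxblockK b); apply/eq_mxblock. Qed.

Lemma block_projectionM i j : Q i *m Q j = (i == j)%:R *: Q j.
Proof.
apply: submxblock_eq => k l; rewrite submxblock_projl.
rewrite -[X in _ *: submxblock X _ _](mulmx1 (Q j)) -[X in _ = submxblock (_ *: X) _ _](mulmx1 (Q j)).
have -> : submxblock ((i == j)%:R *: (Q j *m 1%:M)) k l =
   (i == j)%:R *: submxblock (Q j *m 1%:M) k l by apply/matrixP => u v; rewrite !mxE.
rewrite submxblock_projl !scalerA; congr (_ *: _).
rewrite -!natrM !mulnb; case: (eqVneq k j) => [->|_]; last by rewrite !andbF.
by rewrite eq_sym.
Qed.

Lemma sum_block_projection : \sum_i Q i = 1%:M.
Proof.
apply: submxblock_eq => k l; rewrite submxblock_sum (bigD1 k) //= big1 ?addr0.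
  by rewrite -[X in submxblock X _ _ = _](mulmx1 (Q k)) submxblock_projl eqxx scale1r.
move=> i ik; rewrite -(mulmx1 (Q i)) submxblock_projl eq_sym (negPf ik).
by rewrite scale0r.
Qed.

Lemma submxblock_star a k l : submxblock (mxstar a) k l = (submxblock a l k) ^t*.
Proof. by apply/matrixP => u v; rewrite !mxE. Qed.

Lemma block_projection_star i : mxstar (Q i) = Q i.
Proof.
apply: submxblock_eq => k l; rewrite submxblock_star.
have -> : submxblock (Q i) l k = (l == i)%:R *: submxblock 1%:M l k.
  by rewrite -(mulmx1 (Q i)) submxblock_projl.
have -> : submxblock (Q i) k l = (l == i)%:R *: submxblock 1%:M k l.
  by rewrite -(mul1mx (Q i)) submxblock_projr.
have -> : ((l == i)%:R *: submxblock (1%:M : 'M[C]_r) l k) ^t* =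
    (l == i)%:R *: (submxblock (1%:M : 'M[C]_r) l k) ^t*.
  by apply/matrixP => u v; rewrite !mxE rmorphM /= rmorph_nat.
rewrite -submxblock_star; congr (_ *: submxblock _ k l).
by rewrite /mxstar trmx1 map_mx1.
Qed.

Lemma block_projection_munit i : (0 < n i)%N ->
  exists u, Q i *m delta_mx u u = delta_mx u u.
Proof.
move=> ni; pose u : 'I_r := tagnat.Rank i (Ordinal ni); exists u.
apply: submxblock_eq => k l; rewrite submxblock_projl.
case: (eqVneq k i) => [_|ki]; first by rewrite scale1r.
rewrite scale0r; apply/matrixP => x y; rewrite !mxE.
case: eqP => //= h; case/eqP: ki.
by have := congr1 tagnat.sig1 h; rewrite !tagnat.Rank1K.
Qed.

Lemma submxblock0P i j a : submxblock a i j = 0 <-> Q i *m a *m Q j = 0.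
Proof.
split=> h.
  apply: submxblock_eq => k l; rewrite submxblock_projr submxblock_projl.
  rewrite [RHS]submxblock0; case: (eqVneq l j) => [->|]; last by rewrite scale0r.
  case: (eqVneq k i) => [->|]; last by rewrite scale0r scaler0.
  by rewrite h !scaler0.
have := congr1 (fun b => submxblock b i j) h.
by rewrite submxblock_projr submxblock_projl !eqxx !scale1r submxblock0.
Qed.

End BlockProjections.

Lemma ord4_cases (i : 'I_4) :
  [\/ i = inord 0, i = inord 1, i = inord 2 | i = inord 3].
Proof.
case: i => [[|[|[|[|k]]]] hk] //; [constructor 1 | constructor 2 | constructor 3 | constructor 4];
  by apply: val_inj; rewrite /= inordK.
Qed.

Lemma inord4_eq i j : (i < 4)%N -> (j < 4)%N ->
  ((inord i : 'I_4) == inord j) = (i == j).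
Proof. by move=> hi hj; rewrite -val_eqE /= !inordK. Qed.

Lemma block12_ord4 (i : 'I_4) : block12 i = (i == inord 0) || (i == inord 1).
Proof.
by rewrite /block12 -!val_eqE /= !inordK //; case: i => [[|[|[|[|k]]]] hk].
Qed.

Lemma block34_ord4 (i : 'I_4) : block34 i = (i == inord 2) || (i == inord 3).
Proof.
by rewrite /block34 -!val_eqE /= !inordK //; case: i => [[|[|[|[|k]]]] hk].
Qed.

Definition swaps12 (theta : 'S_4) : bool := theta (inord 0) != inord 0.
Definition swaps34 (theta : 'S_4) : bool := theta (inord 2) != inord 2.

Section RigidType.
Variable theta : 'S_4.
Hypothesis tP : rigid_type theta.

Lemma rigid_type12 :
  theta (inord 0) = inord (swaps12 theta) /\ theta (inord 1) = inord (~~ swaps12 theta).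
Proof.
have := tP (inord 0); have := tP (inord 1); rewrite !block12_ord4 !inord4_eq //=.
have h : theta (inord 0) != theta (inord 1) by rewrite (inj_eq perm_inj) inord4_eq.
rewrite /swaps12; move=> /orP[] /eqP e1 /orP[] /eqP e0; move: h;
  by rewrite e0 e1 ?eqxx ?inord4_eq.
Qed.

Lemma rigid_type34 :
  theta (inord 2) = inord (2 + swaps34 theta)%N /\
  theta (inord 3) = inord (2 + ~~ swaps34 theta)%N.
Proof.
have b34 i : block34 (theta i) = block34 i.
  have e x : block34 x = ~~ block12 x by rewrite /block34 leqNgt.
  by rewrite !e tP.
have := b34 (inord 2); have := b34 (inord 3); rewrite !block34_ord4 !inord4_eq //=.
have h : theta (inord 2) != theta (inord 3) by rewrite (inj_eq perm_inj) inord4_eq.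
rewrite /swaps34; move=> /orP[] /eqP e1 /orP[] /eqP e0; move: h;
  by rewrite e0 e1 ?eqxx ?inord4_eq.
Qed.

(** The sign with which a summand enters [delta] is the product of its two swap signs; this turns
    [delta] into a trace of [w * w']. *)
Lemma rigid_type_even :
  (theta \in [:: 1%g; (t12 * t34)%g]) = ~~ (swaps12 theta (+) swaps34 theta) /\
  (theta \in [:: t12; t34]) = swaps12 theta (+) swaps34 theta.
Proof.
have [h0 h1] := rigid_type12; have [h2 h3] := rigid_type34.
have ext (tau : 'S_4) : (theta == tau) = [&& theta (inord 0) == tau (inord 0),
    theta (inord 1) == tau (inord 1), theta (inord 2) == tau (inord 2) &
    theta (inord 3) == tau (inord 3)].
  apply/eqP/and4P => [->|[/eqP e0 /eqP e1 /eqP e2 /eqP e3]]; first by rewrite !eqxx.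
  by apply/permP => i; case: (ord4_cases i) => ->.
have tE (x y z : 'I_4) : tperm x y z = if z == x then y else if z == y then x else z.
  by rewrite permE.
rewrite !inE !ext !permM !perm1 h0 h1 h2 h3 /t12 /t34 !tE !inord4_eq //=.
all: by case: (swaps12 theta); case: (swaps34 theta).
Qed.

End RigidType.

Lemma sum_supp1 (V : nmodType) (I : finType) (F : I -> V) i :
  (forall k, k != i -> F k = 0) -> \sum_k F k = F i.
Proof. by move=> F0; rewrite (bigD1 i) //= big1 ?addr0. Qed.

Lemma sum_supp2 (V : nmodType) (I : finType) (F : I -> V) i j : i != j ->
  (forall k, k != i -> k != j -> F k = 0) -> \sum_k F k = F i + F j.
Proof.
move=> ij F0; rewrite (bigD1 i) //= (bigD1 j) 1?eq_sym //= big1 ?addr0 //.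
by move=> k /andP[ki kj]; exact: F0.
Qed.

(** * The diagonal part described by sign elements *)

Section DiagonalPart.
Variables (C : numClosedFieldType) (n : 'I_4 -> nat).
Local Notation r := (\sum_i n i)%N.
Local Notation Q := (@block_projection C n).
Variables (P : pred 'I_4) (i j : 'I_4).
Hypotheses (ij : i != j) (PE : forall k, P k = (k == i) || (k == j)).
Hypothesis Pcycle : forall k l, P k -> P l -> ~~ (block12 k && block34 l).
Implicit Types a : 'M[C]_r.

Let QQ k l : Q k *m Q l = (k == l)%:R *: Q l. Proof. exact: block_projectionM. Qed.

Lemma block_projection_supp k :
  Q k *m (Q i + Q j) = (P k)%:R *: Q k /\ (Q i + Q j) *m Q k = (P k)%:R *: Q k.
Proof.
rewrite mulmxDl mulmxDr !QQ PE [i == k]eq_sym [j == k]eq_sym.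
case: (eqVneq k i) => [->|_]; first by rewrite (negPf ij) !scale0r !addr0.
by case: (eqVneq k j) => [->|_]; rewrite ?scale0r ?scale1r ?add0r ?scaler0.
Qed.

Lemma block_projection_sign : [/\ Q i *m (Q i - Q j) = Q i, (Q i - Q j) *m Q i = Q i,
  Q j *m (Q i - Q j) = - Q j & (Q i - Q j) *m Q j = - Q j].
Proof.
have ji : j == i = false by rewrite eq_sym (negPf ij).
by split; rewrite ?mulmxBl ?mulmxBr !QQ ?eqxx ?ji ?(negPf ij) ?scale0r ?scale1r
  ?subr0 ?sub0r.
Qed.

(** Moving the sign element across an off-diagonal block [Q i *m a *m Q j] changes its sign, so the
    block equals its own negative. *)
Lemma offdiagonal_eq0 a : (Q i + Q j) *m a = a -> a *m (Q i + Q j) = a ->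
  a *m (Q i - Q j) = (Q i - Q j) *m a ->
  forall k l, ~~ ((k == l) && P k) -> Q k *m a *m Q l = 0.
Proof.
move=> qa aq as_ k l kl; have [q1 q2 q3 q4] := block_projection_sign.
have [Pk|Pk] := boolP (P k); last first.
  by rewrite -qa mulmxA (block_projection_supp k).1 (negPf Pk) scale0r !mul0mx.
have [Pl|Pl] := boolP (P l); last first.
  by rewrite -aq -!mulmxA (block_projection_supp l).2 (negPf Pl) scale0r !mulmx0.
have anti (x : 'M[C]_r) : x = - x -> x = 0.
  by move=> /eqP; rewrite -addr_eq0 => /eqP h; rewrite -[x]scaler_half h scaler0.
move: kl; rewrite Pk andbT; move: Pk Pl; rewrite !PE.
move=> /orP[] /eqP -> /orP[] /eqP ->; rewrite ?eqxx // => _; apply: anti.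
  by rewrite -[in LHS]q1 -(mulmxA (Q i)) -as_ -!mulmxA q4 !mulmxN.
have -> : - (Q j *m a *m Q i) = Q j *m (Q i - Q j) *m a *m Q i by rewrite q3 !mulNmx.
by rewrite -(mulmxA _ _ a) -as_ -!mulmxA q2.
Qed.

Lemma diagonal_partP a : diagonal_part P a <->
  [/\ (Q i + Q j) *m a = a, a *m (Q i + Q j) = a &
      a *m (Q i - Q j) = (Q i - Q j) *m a].
Proof.
have [q1 q2 q3 q4] := block_projection_sign.
split=> [[ac asc aP]|[qa aq as_]].
  have off k l : ~~ ((k == l) && P k) -> Q k *m a *m Q l = 0.
    move=> kl; apply/submxblock0P; have [Pkl|] := boolP (P k && P l); last exact: aP.
    case/andP: Pkl => Pk Pl; apply: ac; rewrite negb_or Pcycle // andbT.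
    by move: kl; rewrite Pk andbT.
  have aE : a = Q i *m a *m Q i + Q j *m a *m Q j.
    have aQ (b : 'M[C]_r) : b = \sum_k b *m Q k.
      by rewrite -mulmx_sumr sum_block_projection mulmx1.
    have Qa (b : 'M[C]_r) : b = \sum_k Q k *m b.
      by rewrite -mulmx_suml sum_block_projection mul1mx.
    have row k : Q k *m a = if P k then Q k *m a *m Q k else 0.
      rewrite [LHS]aQ (sum_supp2 (F := fun l => Q k *m a *m Q l) ij) => [|l li lj]; last first.
        apply: off; apply/negP => /andP[/eqP kl].
        by rewrite PE kl (negPf li) (negPf lj).
      rewrite PE; case: (eqVneq k i) => [->|ki] /=.
        by rewrite (off i j) ?addr0 // (negPf ij).
      case: (eqVneq k j) => [->|kj] /=.
        by rewrite (off j i) ?add0r // eq_sym (negPf ij).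
      by rewrite !off ?addr0 // PE (negPf ki) (negPf kj) andbF.
    rewrite {1}[a]Qa (sum_supp2 (F := fun k => Q k *m a) ij) => [|k ki kj]; last first.
      by rewrite row PE (negPf ki) (negPf kj).
    by congr (_ + _); rewrite [LHS]row PE eqxx ?orbT.
  have [[i1 i2] [j1 j2]] := (block_projection_supp i, block_projection_supp j).
  rewrite !PE !eqxx ?orbT !scale1r in i1 i2 j1 j2.
  rewrite aE; split.
  - by rewrite mulmxDr !mulmxA i2 j2.
  - by rewrite mulmxDl -!mulmxA i1 j1.
  - by rewrite mulmxDl mulmxDr !mulmxA -!(mulmxA _ _ (Q i - Q j)) q1 q2 q3 q4 mulmxN !mulNmx.
have off := offdiagonal_eq0 qa aq as_.
have starD (x y : 'M[C]_r) : mxstar (x + y) = mxstar x + mxstar y.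
  by rewrite /mxstar linearD /= map_mxD.
have starB (x y : 'M[C]_r) : mxstar (x - y) = mxstar x - mxstar y.
  by rewrite /mxstar linearB /= map_mxB.
have starM (x y : 'M[C]_r) : mxstar (x *m y) = mxstar y *m mxstar x by exact: adjmxM.
have offs : forall k l, ~~ ((k == l) && P k) -> Q k *m mxstar a *m Q l = 0.
  apply: offdiagonal_eq0.
  - by rewrite -{2}aq starM starD !block_projection_star.
  - by rewrite -{2}qa starM starD !block_projection_star.
  - by have := congr1 (@mxstar C r) as_; rewrite !starM !starB !block_projection_star.
split=> [k l kl|k l kl|k l kl]; apply/submxblock0P.
- by apply: off; apply: contraNN kl => /andP[-> _].
- by apply: offs; apply: contraNN kl => /andP[-> _].
- by apply: off; apply: contraNN kl => /andP[/eqP <- ->].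
Qed.

End DiagonalPart.

(** * Signs and traces of a rigid embedding *)

Section RigidEmbedding.
Variables (C : numClosedFieldType) (n n' : 'I_4 -> nat).
Variable f : rigid_embedding C n n'.
Hypotheses (n_gt0 : forall i, (0 < n i)%N) (f1 : f 1%:M = 1%:M).
Local Notation r := (\sum_i n i)%N.
Local Notation r' := (\sum_i n' i)%N.
Local Notation Q := (@block_projection C n).
Local Notation Q' := (@block_projection C n').
Local Notation o k := (inord k : 'I_4).
Implicit Types (a b : 'M[C]_r) (e : 'I_(rsize f) -> bool).

Let r_gt0 : (0 < r)%N.
Proof. by rewrite (bigD1 (o 0)) //= addn_gt0 n_gt0. Qed.

Local Notation sigma s := (@rsummand _ _ _ f s).
Local Notation ty s := (@rtype _ _ _ f s).

Let sL s : linear (sigma s). Proof. by case: (rsummandP s) => [[]]. Qed.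
Let sM s a b : sigma s (a *m b) = sigma s a *m sigma s b.
Proof. by case: (rsummandP s) => [[_ sM _]] *; exact: sM. Qed.
Let sS s a : sigma s (a ^t*) = (sigma s a) ^t*.
Proof. by case: (rsummandP s) => [[_ _ sS]] *; exact: sS. Qed.
Let tyP s : rigid_type (ty s). Proof. by case: (rsummandP s). Qed.
Let sO s t a b : s != t -> sigma s a *m sigma t b = 0.
Proof. by move=> st; exact: rsummand_orth. Qed.
Let fE a : f a = \sum_s sigma s a. Proof. exact: rmapE. Qed.

(** The embedding with its orthogonal summands given signs. At 1 this is a symmetry commuting with
    the range of [f] when [f] is unital, and the swap signs yield the [w] and [w'] of the tower. *)
Definition twist e a : 'M[C]_r' := \sum_s (-1) ^+ e s *: sigma s a.

Lemma twist0 a : twist (fun=> false) a = f a.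
Proof. by rewrite fE; apply: eq_bigr => s _; rewrite expr0 scale1r. Qed.

Lemma twistM e e' a b : twist e a *m twist e' b = twist (fun s => e s (+) e' s) (a *m b).
Proof.
rewrite mulmx_suml; apply: eq_bigr => s _; rewrite mulmx_sumr.
rewrite (sum_supp1 (i := s)
  (F := fun t => (-1) ^+ e s *: sigma s a *m ((-1) ^+ e' t *: sigma t b))) => [|t ts].
  by rewrite -scalemxAl -scalemxAr scalerA -signr_addb sM.
by rewrite -scalemxAl -scalemxAr sO ?scaler0 // eq_sym.
Qed.

Lemma twist_star e a : (twist e a) ^t* = twist e (a ^t*).
Proof.
rewrite /twist linear_sum map_mx_sum; apply: eq_bigr => s _.
by rewrite linearZ /= map_mxZ rmorph_sign sS.
Qed.

Lemma eq_twist e e' a : e =1 e' -> twist e a = twist e' a.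
Proof. by move=> ee; apply: eq_bigr => s _; rewrite ee. Qed.

Lemma twist_eq e a (x : 'M[C]_r') :
  (forall s, x *m sigma s 1%:M = (-1) ^+ e s *: sigma s a) -> x = twist e a.
Proof.
move=> h; rewrite -[LHS]mulmx1 -f1 fE mulmx_sumr.
by apply: eq_bigr => s _; exact: h.
Qed.

Lemma summand_block s i : Q' (ty s i) *m sigma s (Q i) = sigma s (Q i).
Proof.
case: (rsummandP s) => _ _ _ _ /(_ i i 1%:M) [k l|a' _].
  rewrite negb_or => /andP[kl _]; apply/submxblock0P.
  by rewrite mulmx1 block_projectionM (negPf kl) scale0r.
rewrite mulmx1 block_projectionM eqxx scale1r => ->.
by rewrite !mulmxA block_projectionM eqxx scale1r.
Qed.

Lemma sum_ord4 (V : nmodType) (F : 'I_4 -> V) :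
  \sum_i F i = F (o 0) + F (o 1) + F (o 2) + F (o 3).
Proof.
rewrite !big_ord_recl big_ord0 addr0 !addrA.
by congr (F _ + F _ + F _ + F _); apply: val_inj; rewrite /= inordK.
Qed.

Lemma summand_sum s a : sigma s a = \sum_i sigma s (a *m Q i).
Proof. by rewrite -(linear_fun_sum (sL s)) -mulmx_sumr sum_block_projection mulmx1. Qed.

Lemma sign12_ord4 s i : (o 0 == ty s i)%:R - (o 1 == ty s i)%:R =
  (-1) ^+ swaps12 (ty s) * ((o 0 == i)%:R - (o 1 == i)%:R) :> C.
Proof.
have [h0 h1] := rigid_type12 (tyP s); have [h2 h3] := rigid_type34 (tyP s).
case: (ord4_cases i) => ->; rewrite ?h0 ?h1 ?h2 ?h3 !inord4_eq //.
all: by case: (swaps12 (ty s)); case: (swaps34 (ty s)) => //=; ring.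
Qed.

Lemma sign34_ord4 s i : (o 2 == ty s i)%:R - (o 3 == ty s i)%:R =
  (-1) ^+ swaps34 (ty s) * ((o 2 == i)%:R - (o 3 == i)%:R) :> C.
Proof.
have [h0 h1] := rigid_type12 (tyP s); have [h2 h3] := rigid_type34 (tyP s).
case: (ord4_cases i) => ->; rewrite ?h0 ?h1 ?h2 ?h3 !inord4_eq //.
all: by case: (swaps12 (ty s)); case: (swaps34 (ty s)) => //=; ring.
Qed.

Lemma half_ord4 s i : (o 0 == ty s i)%:R + (o 1 == ty s i)%:R =
  (o 0 == i)%:R + (o 1 == i)%:R :> C.
Proof.
have [h0 h1] := rigid_type12 (tyP s); have [h2 h3] := rigid_type34 (tyP s).
case: (ord4_cases i) => ->; rewrite ?h0 ?h1 ?h2 ?h3 !inord4_eq //.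
all: by case: (swaps12 (ty s)); case: (swaps34 (ty s)) => //=; ring.
Qed.

(* a combination of block projections followed by a summand only sees the
   type of the summand *)
Lemma summand_comb s (c d : 'I_4 -> C) (x : 'M[C]_r') (y : 'M[C]_r) z :
  (forall i, x *m Q' i = c i *: Q' i) -> (forall i, y *m Q i = d i *: Q i) ->
  (forall i, c (ty s i) = z * d i) -> x *m sigma s 1%:M = z *: sigma s y.
Proof.
move=> xc yd cd; rewrite summand_sum [in RHS]summand_sum mulmx_sumr scaler_sumr.
apply: eq_bigr => i _; rewrite mul1mx -summand_block mulmxA xc -scalemxAl.
by rewrite summand_block cd yd (linear_funZ (sL s)) scalerA.
Qed.

Lemma block_projection_comb n0 (i j k : 'I_4) :
  (@block_projection C n0 i - block_projection C n0 j) *m block_projection C n0 k =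
    ((i == k)%:R - (j == k)%:R) *: block_projection C n0 k /\
  (@block_projection C n0 i + block_projection C n0 j) *m block_projection C n0 k =
    ((i == k)%:R + (j == k)%:R) *: block_projection C n0 k.
Proof.
by rewrite mulmxBl mulmxDl !block_projectionM scalerBl scalerDl.
Qed.

Lemma summand_sign12 s : (Q' (o 0) - Q' (o 1)) *m sigma s 1%:M =
  (-1) ^+ swaps12 (ty s) *: sigma s (Q (o 0) - Q (o 1)).
Proof.
apply: (summand_comb (c := fun i => (o 0 == i)%:R - (o 1 == i)%:R)
  (d := fun i => (o 0 == i)%:R - (o 1 == i)%:R)) => i.
- by case: (block_projection_comb n' (o 0) (o 1) i).
- by case: (block_projection_comb n (o 0) (o 1) i).
- exact: sign12_ord4.
Qed.

Lemma summand_sign34 s : (Q' (o 2) - Q' (o 3)) *m sigma s 1%:M =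
  (-1) ^+ swaps34 (ty s) *: sigma s (Q (o 2) - Q (o 3)).
Proof.
apply: (summand_comb (c := fun i => (o 2 == i)%:R - (o 3 == i)%:R)
  (d := fun i => (o 2 == i)%:R - (o 3 == i)%:R)) => i.
- by case: (block_projection_comb n' (o 2) (o 3) i).
- by case: (block_projection_comb n (o 2) (o 3) i).
- exact: sign34_ord4.
Qed.

Lemma summand_half s : (Q' (o 0) + Q' (o 1)) *m sigma s 1%:M =
  sigma s (Q (o 0) + Q (o 1)).
Proof.
rewrite -[RHS]scale1r.
apply: (summand_comb (c := fun i => (o 0 == i)%:R + (o 1 == i)%:R)
  (d := fun i => (o 0 == i)%:R + (o 1 == i)%:R)) => i.
- by case: (block_projection_comb n' (o 0) (o 1) i).
- by case: (block_projection_comb n (o 0) (o 1) i).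
- by rewrite half_ord4 mul1r.
Qed.

Lemma rigid_sign12 : Q' (o 0) - Q' (o 1) =
  twist (fun s => swaps12 (ty s)) (Q (o 0) - Q (o 1)).
Proof. by apply: twist_eq => s; exact: summand_sign12. Qed.

Lemma rigid_sign34 : Q' (o 2) - Q' (o 3) =
  twist (fun s => swaps34 (ty s)) (Q (o 2) - Q (o 3)).
Proof. by apply: twist_eq => s; exact: summand_sign34. Qed.

Lemma rigid_half : Q' (o 0) + Q' (o 1) = f (Q (o 0) + Q (o 1)).
Proof.
rewrite -twist0; apply: twist_eq => s.
by rewrite expr0 scale1r; exact: summand_half.
Qed.

(** [multiplicity] is a truncated quotient of ranks. It is exact here because the rank at 1 is [r]
    times the rank at a minimal projection, traces of projections being ranks. *)
Lemma mxtrace_summand s : \tr (sigma s 1%:M) = r%:R.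
Proof.
pose i0 := Ordinal r_gt0.
have tr_scale a : \tr (sigma s a) = \tr a * \tr (sigma s (delta_mx i0 i0)).
  apply: (@mx_trace_unique _ _ (fun a => \tr (sigma s a))).
    by move=> c x y; rewrite (sL s) mxtraceD mxtraceZ.
  by move=> x y; rewrite !sM mxtrace_mulC.
have proj a : a *m a = a -> a ^t* = a ->
    \tr (sigma s a) = (\rank (sigma s a))%:R.
  move=> aa as_; have sa : sigma s a *m sigma s a = sigma s a by rewrite -sM aa.
  have ss : (sigma s a) ^t* = sigma s a by rewrite -sS as_.
  by have [X [_ _ ->]] := projection_mx_decomp sa ss.
have := tr_scale 1%:M; rewrite mxtrace1 (proj (delta_mx i0 i0)); first last.
- by rewrite trmx_delta map_delta_mx.
- exact: mul_delta_mx.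
rewrite proj; first last.
- by rewrite trmx1 map_mx1.
- by rewrite mulmx1.
case: (rsummandP s) => _ _; rewrite /multiplicity => hm _ _.
rewrite -natrM => /eqP; rewrite eqr_nat => /eqP hr; move: hm; rewrite hr mulKn //.
by move=> ->; rewrite muln1.
Qed.

Lemma mxtrace_twist e : \tr (twist e 1%:M) = r%:R * \sum_s (-1) ^+ e s.
Proof.
rewrite /twist raddf_sum mulr_sumr; apply: eq_bigr => s _.
by rewrite /= mxtraceZ mxtrace_summand mulrC.
Qed.

Lemma rigid_size : r' = (rsize f * r)%N.
Proof.
have : \tr (twist (fun=> false) 1%:M) = r'%:R by rewrite twist0 f1 mxtrace1.
have E : \sum_(s < rsize f) (-1) ^+ false = (rsize f)%:R :> C.
  by rewrite sumr_const card_ord expr0.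
by rewrite mxtrace_twist E -natrM => /eqP; rewrite eqr_nat mulnC => /eqP.
Qed.

Lemma rigid_multiplicity : multiplicity f = rsize f.
Proof. by rewrite /multiplicity f1 mxrank1 rigid_size mulnK. Qed.

Lemma rigid_delta :
  \sum_s (-1) ^+ (swaps12 (ty s) (+) swaps34 (ty s)) = (delta f)%:~R :> C.
Proof.
rewrite /delta intrB -!pmulrn -!sum1_card !natr_sum.
rewrite [in RHS]big_mkcond [X in _ = _ - X]big_mkcond -sumrB; apply: eq_bigr => s _.
have [] := rigid_type_even (tyP s); rewrite !inE => -> ->.
by case: (swaps12 _ (+) _); rewrite /= ?expr1 ?expr0 ?sub0r ?subr0.
Qed.

Lemma rigid_delta_le : (absz (delta f) <= rsize f)%N.
Proof.
rewrite -(ler_nat C) natr_absz intr_norm -rigid_delta.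
apply: le_trans (ler_norm_sum _ _ _) _.
rewrite (eq_bigr (fun=> 1)) => [|s _]; last by rewrite normr_sign.
by rewrite sumr_const card_ord.
Qed.

End RigidEmbedding.

(** * The tower of a generic index 4 inclusion *)

(** The trace of a larger matrix algebra restricts to a multiple of the trace of a smaller one, and
    normalisation at 1 removes the factor; so the normalised traces glue. *)
Lemma trace_exists (C : numClosedFieldType) (D : starAlgType C) (size : nat -> nat)
    (emb : forall k, 'M[C]_(size k) -> D) :
  (forall k, mx_embedding (@emb k)) ->
  (forall k, range (@emb k) `<=` range (@emb k.+1)) ->
  (forall x, exists k, range (@emb k) x) ->
  exists tau : D -> C, normalised_trace tau.
Proof.
move=> embP incr exh.
have mono k m : (k <= m)%N -> range (@emb k) `<=` range (@emb m).
  move=> /subnK <-; elim: (m - k)%N => [|j IH] //.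
  by apply: subset_trans IH _; rewrite addSn; exact: incr.
have lift k m (a : 'M[C]_(size k)) (b : 'M[C]_(size m)) : (k <= m)%N ->
    emb m b = emb k a -> \tr a / (size k)%:R = \tr b / (size m)%:R.
  move=> km ba.
  have /choice[B BP] : forall c, exists d, emb m d = emb k c.
    move=> c; have [] := @mono k m km (emb k c); first by exists c.
    by move=> d _ h; exists d.
  case: (embP k) => k0 [kL kM _] k1; case: (embP m) => m0 [mL mM _] m1.
  have inj := emb_inj (embP m).
  have sk := natr_size_neq0 (embP k); have sm := natr_size_neq0 (embP m).
  have h := @mx_trace_unique _ _ (fun a => \tr (B a)) (Ordinal k0).
  have {}h c : \tr (B c) = \tr c * \tr (B (delta_mx (Ordinal k0) (Ordinal k0))).
    apply: h => [d x y|x y].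
      rewrite -mxtraceZ -mxtraceD; congr (\tr _); apply: inj.
      by rewrite BP kL mL !BP.
    have BM u v : B (u *m v) = B u *m B v by apply: inj; rewrite BP kM mM !BP.
    by rewrite !BM mxtrace_mulC.
  have B1 : B 1%:M = 1%:M by apply: inj; rewrite BP k1 m1.
  have -> : b = B a by apply: inj; rewrite ba BP.
  have := h 1%:M; rewrite B1 !mxtrace1 (h a).
  move: (\tr (B _)) => z sE; have z0 : z != 0.
    by apply: contraNneq sm => z0; rewrite sE z0 mulr0.
  by rewrite sE; field; rewrite sk z0.
have ex x : exists c, forall k a, emb k a = x -> c = \tr a / (size k)%:R.
  have [k [a _ ka]] := exh x; exists (\tr a / (size k)%:R) => l b lb.
  have [m [km lm]] : exists m, (k <= m)%N /\ (l <= m)%N.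
    by exists (maxn k l); rewrite leq_maxl leq_maxr.
  have [] := mono _ _ km x; first by exists a.
  move=> d _ dx; rewrite (lift k m a d km) ?(lift l m b d lm) //.
    by rewrite dx lb.
  by rewrite dx ka.
have [tau tauP] := choice ex.
have tauE k a : tau (emb k a) = \tr a / (size k)%:R by exact: (tauP (emb k a)).
have common x y : exists k a b, emb k a = x /\ emb k b = y.
  have [k kx] := exh x; have [l ly] := exh y.
  have [a _ ax] := mono _ _ (leq_maxl k l) _ kx.
  have [b _ by_] := mono _ _ (leq_maxr k l) _ ly.
  by exists (maxn k l), a, b.
exists tau; split=> [c x y|x y|].
- have [k [a [b [<- <-]]]] := common x y; case: (embP k) => _ [kL _ _] _.
  by rewrite -kL !tauE mxtraceD mxtraceZ mulrDl mulrA.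
- have [k [a [b [<- <-]]]] := common x y; case: (embP k) => _ [_ kM _] _.
  by rewrite -!kM !tauE mxtrace_mulC.
- case: (embP 0%N) => _ _ <-.
  by rewrite tauE mxtrace1 divff // (natr_size_neq0 (embP 0%N)).
Qed.

(* Two traces cut down by complementary sign projections are proportional on a
   full matrix algebra [S] with [e1, e2] in [S] in opposite blocks, which forces
   [(1 + tau w)^2 = (1 - tau w)^2]. *)
Lemma matroid_balanced (C : numClosedFieldType) (D1 D : starAlgType C) (T : tower D)
    (iota : D1 -> D) (q : D) (s : nat -> D) k :
  matroid D1 -> linear iota -> (forall x y, iota (x * y) = iota x * iota y) ->
  (forall k, half_sign (tw_emb T k) q (s k)) ->
  (forall m, (k <= m)%N -> exists w, sign_change (lvl T k) (lvl T m) id (s k) (s m) w) ->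
  (forall y, exists m0, forall m, (m0 <= m)%N -> in_blocks (lvl T m) q (s m) (iota y)) ->
  (forall x, in_blocks (lvl T k) q (s k) x -> exists y, iota y = x) ->
  exists m w, [/\ (k <= m)%N, tw_tau T w = 0 &
    sign_change (lvl T k) (lvl T m) id (s k) (s m) w].
Proof.
move=> [F [Fmx Ftot Fcov]] iL iM hs hw hy hx.
have eP := tw_embP T k; have tauP := tw_tauP T.
have [Bs ss s2 qs [[i hi] [j hj]]] := hs k.
pose e1 := tw_emb T k (delta_mx i i); pose e2 := tw_emb T k (delta_mx j j).
have [e1s e11] : star e1 = e1 /\ e1 * e1 = e1 by exact: munit_projection.
have [e2s e22] : star e2 = e2 /\ e2 * e2 = e2 by exact: munit_projection.
have qe1 : q * e1 = e1 by rewrite -s2 -mulrA hi hi.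
have qe2 : q * e2 = e2 by rewrite -s2 -mulrA hj mulrN hj opprK.
have qst : star q = q by case: (half_sign_projection (hs k)).
have [x1 x1E] : exists y, iota y = e1.
  apply: hx; split=> //; first exact: range_munit.
    by rewrite -{1}e1s -qst -starM qe1.
  by rewrite hi -{1}e1s -ss -starM hi.
have [x2 x2E] : exists y, iota y = e2.
  apply: hx; split=> //; first exact: range_munit.
    by rewrite -{1}e2s -qst -starM qe2.
  by rewrite hj -{1}e2s -ss -starM hj star_N e2s.
(* Since the matrix subalgebras form a chain, a single one contains both elements. *)
have [S [FS Sx1 Sx2]] : exists S, [/\ F S, S x1 & S x2].
  have [S1 FS1 S1x] : (\bigcup_(S in F) S) x1 by rewrite Fcov.
  have [S2 FS2 S2x] : (\bigcup_(S in F) S) x2 by rewrite Fcov.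
  have [h|h] := Ftot _ _ FS1 FS2; [exists S2 | exists S1]; split=> //; exact: h.
have [N [phi [N0 [pL pM _] _ pS]]] := Fmx _ FS.
rewrite -pS in Sx1 Sx2; case: Sx1 => a1 _ a1E; case: Sx2 => a2 _ a2E.
have [m1 hm1] : exists m1, forall m (ij : 'I_N * 'I_N), (m1 <= m)%N ->
    in_blocks (lvl T m) q (s m) (iota (phi (delta_mx ij.1 ij.2))).
  have [h hP] := choice (fun ij : 'I_N * 'I_N => hy (phi (delta_mx ij.1 ij.2))).
  exists (\max_ij h ij) => m ij hm; apply: hP.
  by apply: leq_trans hm; exact: leq_bigmax.
pose m := maxn k m1; have km : (k <= m)%N by exact: leq_maxl.
have [w ww] := hw m km; exists m, w; split=> //.
have [_ _ wC sm] := ww; rewrite image_id in wC.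
have comm a z : z = q \/ z = s m -> iota (phi a) * z = z * iota (phi a).
  move=> hz; rewrite [a]matrix_sum_delta.
  rewrite (linear_fun_sum pL) (linear_fun_sum iL) mulr_suml mulr_sumr.
  apply: eq_bigr => u _; rewrite (linear_fun_sum pL) (linear_fun_sum iL).
  rewrite mulr_suml mulr_sumr; apply: eq_bigr => v _.
  rewrite (linear_funZ pL) (linear_funZ iL) -scalerAl -scalerAr; congr (_ *: _).
  have [_ qx xq xs] := hm1 m (u, v) (leq_maxr _ _).
  by case: hz => ->; rewrite ?qx ?xq.
pose t (c : C) a := tw_tau T ((q + c *: s m) * iota (phi a)).
have tE c a : t c a = \tr a * t c (delta_mx (Ordinal N0) (Ordinal N0)).
  apply: mx_trace_unique => [d x y|x y]; rewrite /t.
    by rewrite pL iL mulrDr -scalerAr (tauD tauP) (tauZ tauP).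
  rewrite !pM !iM !mulrA (tauC tauP) mulrA; congr (tw_tau T (_ * _)).
  rewrite mulrDr mulrDl -scalerAr -scalerAl (comm _ _ (or_introl erefl)).
  by rewrite (comm _ _ (or_intror erefl)).
have prop : t 1 a1 * t (-1) a2 = t 1 a2 * t (-1) a1.
  by rewrite (tE 1 a1) (tE (-1) a2) (tE 1 a2) (tE (-1) a1); ring.
have te1 c : t c a1 = tw_tau T e1 * (1 + c * tw_tau T w).
  rewrite /t a1E x1E sm mulrDl -scalerAl qe1 -mulrA wC ?mulrA ?hi; last exact: range_munit.
  rewrite (tauD tauP) (tauZ tauP) (tau_mul_commutant tauP eP (range_munit _ _ _) wC).
  by ring.
have te2 c : t c a2 = tw_tau T e2 * (1 - c * tw_tau T w).
  rewrite /t a2E x2E sm mulrDl -scalerAl qe2 -mulrA wC ?mulrA ?hj; last exact: range_munit.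
  rewrite mulNr scalerN (tauB tauP) (tauZ tauP).
  rewrite (tau_mul_commutant tauP eP (range_munit _ _ _) wC).
  by ring.
have sk := natr_size_neq0 eP.
have e10 : tw_tau T e1 != 0 by rewrite (tau_munit tauP eP) invr_eq0.
have e20 : tw_tau T e2 != 0 by rewrite (tau_munit tauP eP) invr_eq0.
move: prop; rewrite !te1 !te2; move: e10 e20.
move: (tw_tau T e1) (tw_tau T e2) (tw_tau T w) => c1 c2 c c10 c20 h.
have : 4 * c1 * c2 * c = 0.
  have -> : 4 * c1 * c2 * c = c1 * (1 + 1 * c) * (c2 * (1 - -1 * c)) -
    c2 * (1 - 1 * c) * (c1 * (1 + -1 * c)) by ring.
  by rewrite h subrr.
by move=> /eqP; rewrite !mulf_eq0 (negPf c10) (negPf c20) pnatr_eq0 /= => /eqP.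
Qed.

(** * Passing from the presentation to the limit algebra *)

Section Presentation.
Variables (C : numClosedFieldType) (D1 D2 D : starAlgType C).
Variables (pi : star_inclusion (D1 * D2)%type D) (P : generic_index4 pi).
Local Notation n k := (gsize (gi_system P) k).
Local Notation f k := (gmap (gi_system P) k).
Local Notation g k := (@gi_map _ _ _ _ _ P k).
Local Notation o k := (inord k : 'I_4).
Local Notation Q k := (@block_projection C (n k)).
Local Notation r k := (\sum_i n k i)%N.

Lemma gi_compat k a : g k.+1 (f k a) = g k a.
Proof. by case: (gi_limit P). Qed.

Lemma gi_inj k : injective (g k).
Proof.
move=> a b ab; have [_ _ h] := gi_limit P.
have [m] := h _ _ _ ab; elim: m => [|m IH] //=.
by move=> /(@rmap_inj _ _ _ (f _)).
Qed.

Let gM k a b : g k (a *m b) = g k a * g k b.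
Proof. by case: (gi_hom P k) => _ gM _; exact: gM. Qed.
Let gS k a : g k (a ^t*) = star (g k a).
Proof. by case: (gi_hom P k) => _ _ gS; exact: gS. Qed.

Lemma size_gt0 k : (0 < r k)%N.
Proof. by rewrite (bigD1 (o 0)) //= addn_gt0 gsize_gt0. Qed.

(** The unit of [D] comes from some level, where injectivity forces its preimage to be the identity
    matrix; from then on all connecting maps are unital. *)
Lemma gi_unital : exists K, forall k, (K <= k)%N ->
  g k 1%:M = 1 /\ f k 1%:M = 1%:M.
Proof.
have unit_1 k z : g k z = 1 -> z = 1%:M.
  move=> z1; rewrite -[z]mulmx1; apply: (gi_inj (k := k)).
  by rewrite gM z1 mul1r.
have step k : g k 1%:M = 1 -> f k 1%:M = 1%:M /\ g k.+1 1%:M = 1.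
  move=> h; have e : f k 1%:M = 1%:M by apply: unit_1; rewrite gi_compat.
  by rewrite -[in X in _ /\ X]e gi_compat.
have [_ exh _] := gi_limit P; have [K [z Kz]] := exh 1.
exists K => k; have h : g K 1%:M = 1 by rewrite -Kz (unit_1 _ _ Kz).
suff gk : forall i, g (i + K)%N 1%:M = 1.
  move=> /subnK <-; split; first exact: gk.
  by case: (step _ (gk (k - K)%N)).
elim=> [|i IH] //; by case: (step _ IH).
Qed.

Lemma gi_lift k m a : (k <= m)%N -> exists b, g m b = g k a.
Proof.
move=> /subnK <-; elim: (m - k)%N => [|i [b IH]]; first by exists a.
by exists (f _ b); exact: etrans (gi_compat b) IH.
Qed.

Lemma diagonal12P k a : @diagonal_part C (n k) block12 a <->
  [/\ (Q k (o 0) + Q k (o 1)) *m a = a, a *m (Q k (o 0) + Q k (o 1)) = a &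
      a *m (Q k (o 0) - Q k (o 1)) = (Q k (o 0) - Q k (o 1)) *m a].
Proof.
apply: diagonal_partP; first by rewrite inord4_eq.
  exact: block12_ord4.
by move=> i j bi bj; rewrite bi /= /block34 -ltnNge.
Qed.

Lemma diagonal34P k a : @diagonal_part C (n k) block34 a <->
  [/\ (Q k (o 2) + Q k (o 3)) *m a = a, a *m (Q k (o 2) + Q k (o 3)) = a &
      a *m (Q k (o 2) - Q k (o 3)) = (Q k (o 2) - Q k (o 3)) *m a].
Proof.
apply: diagonal_partP; first by rewrite inord4_eq.
  exact: block34_ord4.
by move=> i j bi bj; rewrite bj andbT /block12 -leqNgt.
Qed.

Lemma sum_projection4 k :
  Q k (o 0) + Q k (o 1) + (Q k (o 2) + Q k (o 3)) = 1%:M.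
Proof.
by rewrite addrA -(sum_ord4 (fun i => Q k i)) (sum_block_projection C (n k)).
Qed.

Lemma rigid_half_supp k : (Q k.+1 (o 0) + Q k.+1 (o 1)) *m f k (Q k (o 0) + Q k (o 1)) =
    f k (Q k (o 0) + Q k (o 1)) /\
  (Q k.+1 (o 2) + Q k.+1 (o 3)) *m f k (Q k (o 2) + Q k (o 3)) =
    f k (Q k (o 2) + Q k (o 3)).
Proof.
have sM s a b : rsummand (r := f k) s (a *m b) = rsummand s a *m rsummand s b.
  by case: (rsummandP s) => [[_ sM _]] *; exact: sM.
have sL s : linear (rsummand (r := f k) s) by case: (rsummandP s) => [[]].
pose E := Q k (o 0) + Q k (o 1); pose E' := Q k (o 2) + Q k (o 3).
have EE' : E' = 1%:M - E by apply/eqP; rewrite eq_sym subr_eq addrC sum_projection4.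
have EE2 : Q k.+1 (o 2) + Q k.+1 (o 3) = 1%:M - (Q k.+1 (o 0) + Q k.+1 (o 1)).
  by apply/eqP; rewrite eq_sym subr_eq addrC sum_projection4.
have h s a : (Q k.+1 (o 0) + Q k.+1 (o 1)) *m rsummand (r := f k) s a =
    rsummand s (E *m a).
  by rewrite -{1}(mul1mx a) sM mulmxA summand_half -sM.
have EE : E *m E = E.
  rewrite {2}/E mulmxDr.
  have [_ e0] := block_projection_comb C (n k) (o 0) (o 1) (o 0).
  have [_ e1] := block_projection_comb C (n k) (o 0) (o 1) (o 1).
  by rewrite e0 e1 !inord4_eq //= addr0 add0r !scale1r.
rewrite !rmapE !mulmx_sumr; split; apply: eq_bigr => s _.
  by rewrite h -/E EE.
by rewrite EE2 mulmxBl mul1mx h -/E -/E' EE' mulmxBr mulmx1 EE subrr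
  (linear_fun0 (sL s)) subr0.
Qed.

(** [D1] and [D2] are unions over all levels, including the early ones with nonunital connecting
    maps; only the support of [f k] on the relevant half is therefore assumed. *)
Lemma diagonal_part_map k (B : pred 'I_4) (i j : 'I_4) a :
  i != j -> (forall l, B l = (l == i) || (l == j)) ->
  (forall l m, B l -> B m -> ~~ (block12 l && block34 m)) ->
  (Q k.+1 i + Q k.+1 j) *m f k (Q k i + Q k j) = f k (Q k i + Q k j) ->
  diagonal_part B a -> diagonal_part B (f k a).
Proof.
move=> ij BE Bc fE aP; have [_ fM fS] := rmap_hom (f k).
have QS l (u v : 'I_4) : (Q l u + Q l v) ^t* = Q l u + Q l v.
  by rewrite linearD /= map_mxD; congr (_ + _); exact: block_projection_star.
have fsE : (f k a) ^t* = f k (a ^t*) by exact: esym (fS a).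
have /(diagonal_partP ij BE Bc)[qa aq _] := aP; have [ac asc _] := aP.
have fsc : cycle_algebra (mxstar (f k a)).
  by rewrite -[mxstar _]fS; exact: rmap_cycle.
have fq : (Q k.+1 i + Q k.+1 j) *m f k a = f k a by rewrite -qa fM mulmxA fE.
have fq' : f k a *m (Q k.+1 i + Q k.+1 j) = f k a.
  have h : (Q k.+1 i + Q k.+1 j) *m f k (a ^t*) = f k (a ^t*).
    by rewrite -{1 2}aq adjmxM QS fM mulmxA fE.
  by rewrite -[RHS](@trmxCK C) fsE -h adjmxM QS -fsE trmxCK.
split; [exact: rmap_cycle | exact: fsc | move=> u v uv; apply/submxblock0P].
rewrite -fq -fq' mulmxA -[_ *m _ *m Q _ _]mulmxA -[_ *m (_ + _) *m Q _ _]mulmxA.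
have [-> _] := block_projection_supp C (n k.+1) ij BE u.
have [_ ->] := block_projection_supp C (n k.+1) ij BE v.
move: uv; case: (B u) => /=; last by rewrite scale0r !mul0mx.
by move=> /negPf ->; rewrite scale0r !mulmx0.
Qed.

Lemma diagonal12_map k a : diagonal_part (@block12) a -> diagonal_part (@block12) (f k a).
Proof.
apply: diagonal_part_map (proj1 (rigid_half_supp k)); first by rewrite inord4_eq.
  exact: block12_ord4.
by move=> i j bi bj; rewrite bi /= /block34 -ltnNge.
Qed.

Lemma diagonal34_map k a : diagonal_part (@block34) a -> diagonal_part (@block34) (f k a).
Proof.
apply: diagonal_part_map (proj2 (rigid_half_supp k)); first by rewrite inord4_eq.
  exact: block34_ord4.
by move=> i j bi bj; rewrite bj andbT /block12 -leqNgt.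
Qed.

Lemma diagonal_lift (B : pred 'I_4) k m a :
  (forall k a, @diagonal_part C (n k) B a -> @diagonal_part C (n k.+1) B (f k a)) ->
  (k <= m)%N -> @diagonal_part C (n k) B a ->
  exists2 b, @diagonal_part C (n m) B b & g m b = g k a.
Proof.
move=> Bf /subnK <- aP; elim: (m - k)%N => [|i [b bP IH]]; first by exists a.
by exists (f _ b); [exact: Bf | exact: etrans (gi_compat b) IH].
Qed.

End Presentation.

Section PresentationTower.
Variables (C : numClosedFieldType) (D1 D2 D : starAlgType C).
Variables (pi : star_inclusion (D1 * D2)%type D) (P : generic_index4 pi) (K : nat).
Local Notation n k := (gsize (gi_system P) k).
Local Notation f k := (gmap (gi_system P) k).
Local Notation g k := (@gi_map _ _ _ _ _ P k).
Local Notation o k := (inord k : 'I_4).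
Local Notation Q k := (@block_projection C (n k)).
Local Notation r k := (\sum_i n k i)%N.
Hypothesis g1 : forall k, (K <= k)%N -> g k 1%:M = 1 /\ f k 1%:M = 1%:M.
Hypothesis delta_neq0 : forall k, (K <= k)%N -> delta (f k) != 0.

Let gL k : linear (g k). Proof. by case: (gi_hom P k). Qed.
Let gM k a b : g k (a *m b) = g k a * g k b.
Proof. by case: (gi_hom P k) => _ gM _; exact: gM. Qed.
Let gS k a : g k (a ^t*) = star (g k a).
Proof. by case: (gi_hom P k) => _ _ gS; exact: gS. Qed.

Lemma gi_embedding k : (K <= k)%N -> mx_embedding (g k).
Proof.
move=> /g1[gk _]; split=> //; last exact: (gi_hom P).
exact: size_gt0.
Qed.

Lemma half_sign_blocks k (i j : 'I_4) : i != j ->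
  half_sign (g k) (g k (Q k i + Q k j)) (g k (Q k i - Q k j)).
Proof.
move=> ij; have [q1 q2 q3 q4] := block_projection_sign C (n k) ij.
split; first by exists (Q k i - Q k j).
- by rewrite -gS linearB /= map_mxB; congr (g k (_ - _)); exact: block_projection_star.
- by rewrite -gM mulmxBl q1 q3 opprK.
- by rewrite -gM mulmxDl q1 q3.
have unit l : exists u, Q k l *m delta_mx u u = delta_mx u u.
  by apply: block_projection_munit; exact: gsize_gt0.
split; [have [u uE] := unit i | have [u uE] := unit j]; exists u.
  by rewrite -gM -{1}uE mulmxA q2 uE.
by rewrite -gM -{1}uE mulmxA q4 mulNmx uE (linear_funN (@gL k)).
Qed.

Lemma sign_change_twist k e (x : ambient C (n k)) : (K <= k)%N ->
  sign_change (range (g k)) (range (g k.+1)) id (g k x)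
    (g k.+1 (twist (f := f k) e x)) (g k.+1 (twist (f := f k) e 1%:M)).
Proof.
move=> Kk; have [_ fk1] := g1 Kk; have [gk1 _] := g1 (leqW Kk).
have fE a : g k a = g k.+1 (twist (f := f k) (fun=> false) a).
  by rewrite twist0 gi_compat.
split; first by exists (twist (f := f k) e 1%:M).
- split; first by rewrite -gS twist_star trmx1 map_mx1.
  rewrite -gM twistM mulmx1 (eq_twist (e' := fun=> false)) => [|s].
    by rewrite twist0 fk1.
  by rewrite addbb.
- move=> y [_ [a _ <-] <-]; rewrite fE -!gM !twistM mulmx1 mul1mx.
  by congr (g _ _); apply: eq_twist => s; rewrite addbC.
- by rewrite fE -gM twistM mulmx1.
Qed.

Definition gi_q : D := g K (Q K (o 0) + Q K (o 1)).
Definition gi_s j : D := g (j + K)%N (Q (j + K)%N (o 0) - Q (j + K)%N (o 1)).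
Definition gi_t j : D := g (j + K)%N (Q (j + K)%N (o 2) - Q (j + K)%N (o 3)).
Definition gi_w j : D := g (j + K).+1
  (twist (f := f (j + K)%N) (fun s => swaps12 (rtype s)) 1%:M).
Definition gi_w' j : D := g (j + K).+1
  (twist (f := f (j + K)%N) (fun s => swaps34 (rtype s)) 1%:M).

Lemma gi_qE j : gi_q = g (j + K)%N (Q (j + K)%N (o 0) + Q (j + K)%N (o 1)).
Proof.
elim: j => [|j IH] //; rewrite IH -gi_compat.
have [_ h] := g1 (leq_addl j K).
by rewrite (rigid_half h).
Qed.

Lemma gi_qCE j : 1 - gi_q = g (j + K)%N (Q (j + K)%N (o 2) + Q (j + K)%N (o 3)).
Proof.
have [gj _] := g1 (leq_addl j K).
by apply/eqP; rewrite subr_eq addrC (gi_qE j) -(linear_funD (@gL _)) sum_projection4 gj.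
Qed.

Lemma gi_sP j : half_sign (g (j + K)%N) gi_q (gi_s j).
Proof. by rewrite (gi_qE j); apply: half_sign_blocks; rewrite inord4_eq. Qed.

Lemma gi_tP j : half_sign (g (j + K)%N) (1 - gi_q) (gi_t j).
Proof. by rewrite (gi_qCE j); apply: half_sign_blocks; rewrite inord4_eq. Qed.

Lemma gi_wP j : sign_change (range (g (j + K)%N)) (range (g (j + K).+1)) id
  (gi_s j) (gi_s j.+1) (gi_w j).
Proof.
have Kj := leq_addl j K; have [_ h] := g1 Kj.
have -> : gi_s j.+1 = g (j + K).+1 (twist (f := f (j + K)%N)
    (fun s => swaps12 (rtype s)) (Q (j + K)%N (o 0) - Q (j + K)%N (o 1))).
  by rewrite -(rigid_sign12 h).
exact: sign_change_twist.
Qed.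

Lemma gi_w'P j : sign_change (range (g (j + K)%N)) (range (g (j + K).+1)) id
  (gi_t j) (gi_t j.+1) (gi_w' j).
Proof.
have Kj := leq_addl j K; have [_ h] := g1 Kj.
have -> : gi_t j.+1 = g (j + K).+1 (twist (f := f (j + K)%N)
    (fun s => swaps34 (rtype s)) (Q (j + K)%N (o 2) - Q (j + K)%N (o 3))).
  by rewrite -(rigid_sign34 h).
exact: sign_change_twist.
Qed.

Lemma gi_wC j : gi_w j * gi_w' j = gi_w' j * gi_w j.
Proof.
by rewrite -!gM !twistM mulmx1; congr (g _ _); apply: eq_twist => s; rewrite addbC.
Qed.

Lemma rsize_neq0 k : (K <= k)%N -> (rsize (f k))%:R != 0 :> C.
Proof.
move=> Kk; have [_ h] := g1 Kk; rewrite pnatr_eq0 -lt0n.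
have := size_gt0 P k.+1; rewrite (rigid_size (@gsize_gt0 _ _ _) h).
by rewrite muln_gt0 => /andP[].
Qed.

Lemma gi_degree tau : normalised_trace tau -> forall j,
  tau (gi_w j * gi_w' j) =
  (delta (f (j + K)%N))%:~R / (rsize (f (j + K)%N))%:R.
Proof.
move=> tauP j; have Kj := leq_addl j K; have [_ h] := g1 Kj.
rewrite -gM twistM mulmx1 (tau_emb tauP (gi_embedding (leqW Kj))).
rewrite mxtrace_twist; last by move=> i; exact: gsize_gt0.
rewrite rigid_delta (rigid_size (@gsize_gt0 _ _ _) h) natrM.
have s0 : (r (j + K)%N)%:R != 0 :> C by rewrite pnatr_eq0 -lt0n size_gt0.
by field; rewrite s0 rsize_neq0.
Qed.

Lemma gi_range_mono k : range (g k) `<=` range (g k.+1).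
Proof. by move=> _ [a _ <-]; exists (f k a) => //; rewrite gi_compat. Qed.

Lemma gi_exhaust x : exists j, range (g (j + K)%N) x.
Proof.
have [_ exh _] := gi_limit P; have [k [a <-]] := exh x; exists k.
by have [b <-] := gi_lift a (leq_addr K k); exists b.
Qed.

Lemma gi_trace : exists tau : D -> C, normalised_trace tau.
Proof.
apply: (@trace_exists _ _ (fun j => r (j + K)%N) (fun j => g (j + K)%N)) => [j|j|x].
- exact: gi_embedding (leq_addl _ _).
- exact: gi_range_mono.
- exact: gi_exhaust.
Qed.

Lemma gi_tower_exists : exists T : tower D,
  [/\ tw_q T = gi_q, tw_size T = (fun j => r (j + K)%N),
      forall j, lvl T j = range (g (j + K)%N),
      (forall j, tw_s T j = gi_s j) /\ (forall j, tw_t T j = gi_t j) &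
      forall j, tw_tau T (tw_w T j * tw_w' T j) =
        (delta (f (j + K)%N))%:~R / (rsize (f (j + K)%N))%:R].
Proof.
have [tau tauP] := gi_trace.
have eP j : mx_embedding (g (j + K)%N) by exact: gi_embedding (leq_addl _ _).
have d0 j : tau (gi_w j * gi_w' j) != 0.
  rewrite (gi_degree tauP) mulf_neq0 ?intr_eq0 ?delta_neq0 ?leq_addl //.
  by rewrite invr_eq0 rsize_neq0 ?leq_addl.
exists (Tower (tw_size := fun j => r (j + K)%N) (tw_emb := fun j => g (j + K)%N)
  tauP eP (fun j => @gi_range_mono (j + K)%N) gi_exhaust gi_sP gi_tP gi_wP gi_w'P gi_wC d0).
by split=> // j; exact: gi_degree.
Qed.

Lemma in_blocks12 j x : in_blocks (range (g (j + K)%N)) gi_q (gi_s j) x <->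
  exists2 a, @diagonal_part C (n (j + K)%N) block12 a & g (j + K)%N a = x.
Proof.
have inj := @gi_inj _ _ _ _ _ P (j + K)%N; rewrite (gi_qE j).
split=> [[[a _ <-] qa aq as_]|[a /diagonal12P[qa aq as_] <-]].
  by exists a => //; apply/diagonal12P; split; apply: inj; rewrite !gM.
by split; rewrite -?gM ?qa ?aq ?as_ //; exists a.
Qed.

Lemma in_blocks34 j x : in_blocks (range (g (j + K)%N)) (1 - gi_q) (gi_t j) x <->
  exists2 a, @diagonal_part C (n (j + K)%N) block34 a & g (j + K)%N a = x.
Proof.
have inj := @gi_inj _ _ _ _ _ P (j + K)%N; rewrite (gi_qCE j).
split=> [[[a _ <-] qa aq as_]|[a /diagonal34P[qa aq as_] <-]].
  by exists a => //; apply/diagonal34P; split; apply: inj; rewrite !gM.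
by split; rewrite -?gM ?qa ?aq ?as_ //; exists a.
Qed.

Lemma incl1_blocks x : (exists y, pi (y, 0) = x) <->
  exists j, in_blocks (range (g (j + K)%N)) gi_q (gi_s j) x.
Proof.
have D1_ := gi_D1 P; split=> [[y <-]|[j /in_blocks12[a aP <-]]].
  have : [set pi (x, 0) | x in setT] (pi (y, 0)) by exists y.
  rewrite D1_ => -[k _ [a aP <-]]; exists k; apply/in_blocks12.
  exact: diagonal_lift (@diagonal12_map _ _ _ _ _ P) (leq_addr _ _) aP.
have : (\bigcup_k (g k @` @diagonal_part C (n k) block12)) (g (j + K)%N a).
  by exists (j + K)%N => //; exists a.
by rewrite -D1_ => -[y _ yE]; exists y.
Qed.

Lemma incl2_blocks x : (exists y, pi (0, y) = x) <->
  exists j, in_blocks (range (g (j + K)%N)) (1 - gi_q) (gi_t j) x.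
Proof.
have D2_ := gi_D2 P; split=> [[y <-]|[j /in_blocks34[a aP <-]]].
  have : [set pi (0, y) | y in setT] (pi (0, y)) by exists y.
  rewrite D2_ => -[k _ [a aP <-]]; exists k; apply/in_blocks34.
  exact: diagonal_lift (@diagonal34_map _ _ _ _ _ P) (leq_addr _ _) aP.
have : (\bigcup_k (g k @` @diagonal_part C (n k) block34)) (g (j + K)%N a).
  by exists (j + K)%N => //; exists a.
by rewrite -D2_ => -[y _ yE]; exists y.
Qed.

Lemma gi_balanced_tower_exists : exists T : balanced_tower D,
  [/\ forall x, (exists y, pi (y, 0) = x) <-> block1 T x,
      forall x, (exists y, pi (0, y) = x) <-> block2 T x,
      forall j, tw_size T j.+1 = (multiplicity (f (j + K)%N) * tw_size T j)%N &
      forall j, tw_tau T (tw_w T j * tw_w' T j) =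
        (delta (f (j + K)%N))%:~R / (multiplicity (f (j + K)%N))%:R].
Proof.
have [T [qE rE lE [sE tE] dE]] := gi_tower_exists.
have P1 x : (exists y, pi (y, 0) = x) <-> block1 T x.
  rewrite /block1 qE; apply: iff_trans (incl1_blocks x) _.
  by split=> -[j h]; exists j; move: h; rewrite lE sE.
have P2 x : (exists y, pi (0, y) = x) <-> block2 T x.
  rewrite /block2 qE; apply: iff_trans (incl2_blocks x) _.
  by split=> -[j h]; exists j; move: h; rewrite lE tE.
have [pL pM _] := incl_hom pi.
have chain k m : (k <= m)%N ->
    (exists w, sign_change (lvl T k) (lvl T m) id (tw_s T k) (tw_s T m) w) /\
    (exists w, sign_change (lvl T k) (lvl T m) id (tw_t T k) (tw_t T m) w).
  by move=> /(rigid_id T)[w [w' [[_ _ ws wt _] _]]]; split; [exists w | exists w'].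
have B1 k : exists m w, [/\ (k <= m)%N, tw_tau T w = 0 &
    sign_change (lvl T k) (lvl T m) id (tw_s T k) (tw_s T m) w].
  apply: (@matroid_balanced _ _ _ T (fun y => pi (y, 0)) (tw_q T)).
  - exact: gi_matroid1 P.
  - by move=> c x y; rewrite -pL; congr (pi _); congr pair; exact: esym (etrans (addr0 _) (scaler0 _ _)).
  - by move=> x y; rewrite -pM; congr (pi _); congr pair; exact: esym (mulr0 _).
  - exact: tw_sP.
  - by move=> m /chain[].
  - move=> y; have [j h] : block1 T (pi (y, 0)) by apply/P1; exists y.
    by exists j => m jm; exact: in_blocks_mono1 h.
  - by move=> x h; apply/P1; exists k.
have B2 k : exists m w, [/\ (k <= m)%N, tw_tau T w = 0 &
    sign_change (lvl T k) (lvl T m) id (tw_t T k) (tw_t T m) w].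
  apply: (@matroid_balanced _ _ _ T (fun y => pi (0, y)) (1 - tw_q T)).
  - exact: gi_matroid2 P.
  - by move=> c x y; rewrite -pL; congr (pi _); congr pair; exact: esym (etrans (addr0 _) (scaler0 _ _)).
  - by move=> x y; rewrite -pM; congr (pi _); congr pair; exact: esym (mulr0 _).
  - exact: tw_tP.
  - by move=> m /chain[].
  - move=> y; have [j h] : block2 T (pi (0, y)) by apply/P2; exists y.
    by exists j => m jm; exact: in_blocks_mono2 h.
  - by move=> x h; apply/P2; exists k.
have mE j : multiplicity (f (j + K)%N) = rsize (f (j + K)%N).
  by have [_ h] := g1 (leq_addl j K); exact: rigid_multiplicity (@gsize_gt0 _ _ _) h.
exists (BalancedTower B1 B2); split=> // j; last by rewrite mE; exact: dE.
rewrite [tw_size _]rE mE; have [_ h] := g1 (leq_addl j K).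
exact: rigid_size (@gsize_gt0 _ _ _) h.
Qed.

End PresentationTower.

(** * The range of the degree in the two cases *)

Section OuterAutomorphisms.
Variables (R : realType) (D1 D2 D : starAlgType R[i]).
Variables (pi : star_inclusion (D1 * D2)%type D) (T : balanced_tower D).
Hypotheses (pi1 : forall x, (exists y, pi (y, 0) = x) <-> block1 T x)
  (pi2 : forall x, (exists y, pi (0, y) = x) <-> block2 T x).
Variables (delta : nat -> int) (mult : nat -> nat).
Hypotheses (delta_neq0 : forall j, delta j != 0)
  (delta_le : forall j, (absz (delta j) <= mult j)%N)
  (sizeS : forall j, tw_size T j.+1 = (mult j * tw_size T j)%N)
  (degE : forall j, tw_tau T (tw_w T j * tw_w' T j) = (delta j)%:~R / (mult j)%:R).
Variables (H : zmodType) (h : nat -> {additive int -> H}).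
Hypotheses (hS : forall k x, h k.+1 (delta k * x) = h k x)
  (h_exhaust : forall y, exists k x, h k x = y)
  (h_inj : forall k, injective (h k)).
Implicit Types (f : relAut pi) (c : R[i]) (k m : nat).

Local Notation rho := (rho T).
Local Notation degree := (degree pi1 pi2).
Local Notation Delta := (@Delta R[i] delta).
Local Notation ratio := (fun j => (absz (delta j))%:R / (mult j)%:R : R).

Lemma mult_neq0 j : (mult j)%:R != 0 :> R[i].
Proof.
rewrite pnatr_eq0 -lt0n; have := size_neq0 T j.+1.
by rewrite sizeS pnatr_eq0 -lt0n muln_gt0 => /andP[].
Qed.

(** The multiplicities in the denominators of [rho] cancel against the growth of the matrix
    sizes. *)
Lemma integral_degreeE c k m : (k <= m)%N -> integral_degree T c k m = c * Delta k m.
Proof.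
suff h0 : forall j, rho k (j + k)%N * (tw_size T (j + k)%N)%:R =
    Delta k (j + k)%N * (tw_size T k)%:R.
  move=> /subnK <-; rewrite /integral_degree -(mulrA c) h0 mulrA mulfK //.
  exact: size_neq0.
elim=> [|j IH]; first by rewrite /rho /Delta !big_geq.
rewrite addSn /rho /Delta !big_nat_recr ?leq_addl //= -/(rho _ _) -/(Delta _ _).
rewrite sizeS degE natrM [RHS]mulrAC -IH.
by field; exact: mult_neq0.
Qed.

Lemma degree_integral f : integral_mult delta (degree f).
Proof.
move=> k; have [fP _ _ _ _] := relAut_bijective pi1 pi2 f.
have [m km hm] := has_degree_lvl (relAut_bijective pi1 pi2 f) (degreeP pi1 pi2 f) k.
exists m => //; have [z hz] := rigid_deg_integral fP (hm m (leqnn _)).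
by exists z; rewrite -integral_degreeE.
Qed.

Lemma degree1 : degree 1%g = 1.
Proof. exact: (has_degree_relAut pi1 pi2 (f := 1%g) (has_degree_id T)). Qed.

Lemma degreeV f : degree (f^-1)%g = (degree f)^-1.
Proof.
apply: (mulIf (degree_neq0 pi1 pi2 f)); rewrite mulVf ?degree_neq0 //.
by rewrite -degreeM mulVg degree1.
Qed.

Lemma degreeX f n : degree (f ^+ n)%g = degree f ^+ n.
Proof.
elim: n => [|n IH].
  by rewrite expg0 expr0 degree1.
by rewrite expgS exprS degreeM IH.
Qed.

Lemma relAut_degree_exists c : c != 0 -> integral_mult delta c -> integral_mult delta c^-1 ->
  (forall k, exists m0, forall m, (m0 <= m)%N -> `|c * rho k m| <= 1) ->
  (forall k, exists m0, forall m, (m0 <= m)%N -> `|c^-1 * rho k m| <= 1) ->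
  exists f, degree f = c.
Proof.
move=> c0 ci cVi cle cVle.
have int d : integral_mult delta d -> forall k, exists2 m, (k <= m)%N &
    exists z : int, integral_degree T d k m = z%:~R.
  move=> di k; have [m km [z hz]] := di k.
  by exists m => //; exists z; rewrite integral_degreeE.
have [f [g [fg fc]]] := realise_degree c0
  (realisable_of_integral (int _ ci) cle) (realisable_of_integral (int _ cVi) cVle).
have [F FE] := relAut_exists pi1 pi2 fg; exists F.
apply: has_degree_relAut; suff -> : (val F : D -> D) = f by [].
by apply/funext.
Qed.

Lemma rho_norm k m : `|rho k m| = real_complex R (\prod_(k <= j < m) ratio j).
Proof.
rewrite normr_prod rmorph_prod; apply: eq_bigr => j _.
rewrite degE normrM normfV normr_nat -intr_norm -natr_absz.
by rewrite rmorphM /= fmorphV /= !rmorph_nat.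
Qed.

Lemma degree_bound f k : exists m0, forall m, (m0 <= m)%N -> `|degree f * rho k m| <= 1.
Proof.
have [fP _ _ _ _] := relAut_bijective pi1 pi2 f.
have [m0 _ hm] := has_degree_lvl (relAut_bijective pi1 pi2 f) (degreeP pi1 pi2 f) k.
by exists m0 => m /hm /(rho_norm_le1 fP).
Qed.

(** The degree is a quotient of [(A - B) / (A + B)] by a product of rational numbers. Being real, it
    can only be 1 or -1 once its modulus is 1. *)
Lemma degree_real f : degree f \is Num.real.
Proof.
have [fP _ _ _ _] := relAut_bijective pi1 pi2 f.
have [m _ hm] := has_degree_lvl (relAut_bijective pi1 pi2 f) (degreeP pi1 pi2 f) 0.
have [A [B [hs hc]]] := rigid_deg_multiplicities fP (hm m (leqnn _)).
have AB : (A + B)%:R != 0 :> R[i].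
  have := size_neq0 T m; rewrite hs !pnatr_eq0 muln_eq0 double_eq0 negb_or.
  by case/andP.
have rr : rho 0 m \is Num.real.
  by apply: rpred_prod => j _; rewrite degE realM ?realV ?realz ?realn.
rewrite -[degree f](mulfK (rho_neq0 T 0 m)) -[_ * rho 0 m](mulfK AB) hc.
by rewrite !realM ?realV ?realB ?realn.
Qed.

Lemma degree_small : (\forall l \near \oo, (fun N : nat => \prod_(l <= j < N) ratio j) @ \oo --> (0 : R)) ->
  forall c k, exists m0, forall m, (m0 <= m)%N -> `|c * rho k m| <= 1.
Proof.
move=> small c k; have [l0 _ hl] := small; pose l := maxn l0 k; pose b := complex.Re `|c * rho k l|.
have bE : real_complex R b = `|c * rho k l| by rewrite RRe_real // normr_real.
have b0 : 0 <= b by rewrite -lecR bE rmorph0 normr_ge0.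
(* The tail product is awaited below [1 / (b + 1)]; adding 1 covers [b = 0]. *)
have b1 : 0 < (b + 1)^-1 by rewrite invr_gt0 ltr_wpDl.
have [N _ hN] := cvgr0_norm_lt _ (hl l (leq_maxl l0 k)) _ b1.
exists (maxn N l) => m; rewrite geq_max => /andP[Nm lm].
rewrite -(rhoM T (leq_maxr l0 k) lm) mulrA normrM -bE rho_norm -rmorphM /=.
rewrite -[X in _ <= X](rmorph1 (real_complex R)) lecR.
have := hN m Nm; move: (\prod_(l <= j < m) _) => p /= hp.
apply: le_trans (ler_wpM2l b0 (le_trans (ler_norm p) (ltW hp))) _.
by rewrite ler_pdivrMr ?mul1r ?lerDl ?ler01 // ltr_wpDl.
Qed.

Lemma Out_iso_Aut :
  (\forall l \near \oo, (fun N : nat => \prod_(l <= j < N) ratio j) @ \oo --> (0 : R)) ->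
  group_isomorphic (Out pi) (zmodAut H).
Proof.
move=> small; pose e := @aut_degree R[i] H h delta delta_neq0 hS h_exhaust h_inj.
apply: (@quotient_iso_by_invariant R[i] _ _ _ degree e).
- exact: degreeM.
- exact: approx_inner_degree1.
- exact: aut_degreeM.
- exact: aut_degree_inj.
- move=> f; apply: mult_aut_exists; first exact: degree_neq0.
    exact: degree_integral.
  by rewrite -degreeV; exact: degree_integral.
- move=> theta; apply: relAut_degree_exists; first exact: aut_degree_neq0.
  + exact: aut_degree_integral.
  + by rewrite -aut_degreeV; exact: aut_degree_integral.
  + exact: degree_small.
  + exact: degree_small.
Qed.

Lemma ratio_le1 j : 0 <= ratio j <= 1.
Proof.
rewrite divr_ge0 ?ler0n //= ler_pdivrMr ?mul1r ?ler_nat ?delta_le //.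
by rewrite ltr0n lt0n -(pnatr_eq0 R[i]) mult_neq0.
Qed.

(** The ratios are at most 1, so the partial products decrease; a product without a positive lower
    bound tends to 0. Absence of bounds for every [l] would thus give convergence for every [l]. *)
Lemma ratio_lower_bound :
  ~ (\forall l \near \oo, (fun N : nat => \prod_(l <= j < N) ratio j) @ \oo --> (0 : R)) ->
  exists l (eps : R), 0 < eps /\
    forall m, (l <= m)%N -> eps <= \prod_(l <= j < m) ratio j.
Proof.
move=> nz; apply: contrapT => nb; apply: nz; apply: nearW => l.
apply/cvgr0Pnorm_lt => eps eps0.
have [m lm hm] : exists2 m, (l <= m)%N & \prod_(l <= j < m) ratio j < eps.
  apply: contrapT => nm; apply: nb; exists l, eps; split=> // m lm.
  by rewrite leNgt; apply/negP => h0; apply: nm; exists m.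
exists m => // N /= mN; apply: le_lt_trans hm.
have ge0 a b : 0 <= \prod_(a <= j < b) ratio j.
  by apply: prodr_ge0 => j _; case/andP: (ratio_le1 j).
rewrite ger0_norm // (big_cat_nat lm mN) /= ler_piMr //.
by apply: prodr_ile1 => j _; exact: ratio_le1.
Qed.

(* Apply [degree_bound] to the powers of [f]. *)
Lemma degree_norm_le1 f l (eps : R) : 0 < eps ->
  (forall m, (l <= m)%N -> eps <= \prod_(l <= j < m) ratio j) -> `|degree f| <= 1.
Proof.
move=> eps0 hl; pose x := complex.Re `|degree f|.
have xE : real_complex R x = `|degree f| by rewrite RRe_real // normr_real.
rewrite -xE -[X in _ <= X](rmorph1 (real_complex R)) lecR leNgt; apply/negP => x1.
have x0 : 0 < x by exact: lt_trans x1.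
have bound n : x ^+ n * eps <= 1.
  have [m0 hm] := degree_bound (f ^+ n)%g l.
  have := hm _ (leq_maxl m0 l); rewrite degreeX normrM normrX -xE rho_norm.
  rewrite -rmorphXn -rmorphM /= -[X in _ <= X](rmorph1 (real_complex R)) lecR.
  apply: le_trans; rewrite ler_wpM2l ?exprn_ge0 ?(ltW x0) //.
  by apply: hl; exact: leq_maxr.
have xV : `|x^-1| < 1 by rewrite ger0_norm ?invr_ge0 ?(ltW x0) // invf_lt1.
have [n _ /(_ n (leqnn n)) /=] := cvgr0_norm_lt _ (cvg_expr xV) _ eps0.
rewrite exprVn normrV ?unitfE ?expf_neq0 ?gt_eqF // ger0_norm ?exprn_ge0 ?(ltW x0) //.
rewrite ltNge => /negP; apply.
by rewrite -[_^-1]mul1r ler_pdivlMr ?exprn_gt0 // mulrC.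
Qed.

Lemma Out_iso_Z2 :
  ~ (\forall l \near \oo, (fun N : nat => \prod_(l <= j < N) ratio j) @ \oo --> (0 : R)) ->
  group_isomorphic (Out pi) 'Z_2.
Proof.
move=> /ratio_lower_bound[l [eps [eps0 hl]]].
have le1 f := degree_norm_le1 f eps0 hl.
(* The bound by 1 holds for [f] and for its inverse. *)
have sq1 f : degree f ^+ 2 = 1.
  rewrite -(real_normK (degree_real f)).
  suff -> : `|degree f| = 1 by rewrite expr1n.
  apply/eqP; rewrite eq_le le1 /= -[X in _ <= X]invrK -normfV -degreeV.
  by rewrite invf_ge1 ?le1 // normr_gt0 degree_neq0.
have Delta_int c : (c = 1 \/ c = -1) -> integral_mult delta c.
  move=> c1 k; exists k => //; rewrite /Delta big_geq // mulr1.
  by case: c1 => ->; [exists 1 | exists (-1)].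
(* The identity automorphism already supplies the bound on [rho], and [c] does not change the
   modulus; this makes -1 realisable. *)
have unit_bound c : `|c| = 1 -> forall k, exists m0, forall m, (m0 <= m)%N ->
    `|c * rho k m| <= 1.
  move=> c1 k; have [m0 hm] := degree_bound 1%g k.
  by exists m0 => m /hm; rewrite degree1 mul1r normrM c1 mul1r.
have [f fE] : exists f, degree f = -1.
  apply: relAut_degree_exists; rewrite ?invrN1 ?oppr_eq0 ?oner_eq0 //.
  - by apply: Delta_int; right.
  - by apply: Delta_int; right.
  - by apply: unit_bound; rewrite normrN1.
  - by apply: unit_bound; rewrite normrN1.
apply: (@quotient_iso_by_invariant R[i] _ _ _ degree (fun z : 'Z_2 => (-1) ^+ (z : nat))).
- exact: degreeM.
- exact: approx_inner_degree1.
- by move=> [[|[|x]] hx] [[|[|y]] hy] //=; rewrite ?expr0 ?expr1 ?mulr1 ?mul1r // mulrNN mulr1.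
- move=> [[|[|x]] hx] [[|[|y]] hy] //= /eqP; rewrite ?expr0 ?expr1 => e01; apply: val_inj => //=.
    by move: e01; rewrite eq_sym eqNr oner_eq0.
  by move: e01; rewrite eqNr oner_eq0.
- move=> g; have := sq1 g; move=> /eqP; rewrite sqrf_eq1 => /orP[] /eqP ->.
    by exists 0.
  by exists 1.
- move=> [[|[|z]] hz] //=; first by exists 1%g; rewrite degree1.
  by exists f.
Qed.

End OuterAutomorphisms.

Lemma cvg_shifted_products (R : realType) (u : nat -> R) K :
  (\forall l \near \oo, (fun N : nat => \prod_(l <= k < N) u k) @ \oo --> (0 : R)) <->
  (\forall l \near \oo,
    (fun N : nat => \prod_(l <= k < N) u (k + K)%N) @ \oo --> (0 : R)).
Proof.
have h l : ((fun N : nat => \prod_(l <= k < N) u (k + K)%N) @ \oo --> (0 : R)) =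
    ((fun N : nat => \prod_((l + K)%N <= k < N) u k) @ \oo --> (0 : R)).
  rewrite -(cvg_shiftn K (fun N : nat => \prod_((l + K)%N <= k < N) u k)).
  have -> // : (fun N : nat => \prod_(l <= k < N) u (k + K)%N) =
      (fun N : nat => \prod_((l + K)%N <= k < (N + K)%N) u k).
    by apply/funext => N; rewrite big_addn addnK.
split=> -[l0 _ hl].
  exists l0 => // l /= ll; rewrite h; apply: hl => /=; exact: leq_trans ll (leq_addr _ _).
exists (l0 + K)%N => // l /= ll.
have Kl := leq_trans (leq_addl _ _) ll.
by rewrite -(subnK Kl) -h; apply: hl; rewrite /= leq_subRL // addnC.
Qed.

Theorem theorem5p6 (R : realType) (D1 D2 D : starAlgType R[i])
    (pi : star_inclusion (D1 * D2)%type D) (P : generic_index4 pi)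
    (H1 : zmodType) (h : nat -> {additive int -> H1}) :
  even_matroid D1 -> even_matroid D2 ->
  is_H1_limit (gi_system P) h -> (exists x : H1, x != 0) ->
  (coupling_zero R (gi_system P) -> group_isomorphic (Out pi) (zmodAut H1)) /\
  (~ coupling_zero R (gi_system P) -> group_isomorphic (Out pi) 'Z_2).
Proof.
move=> _ _ [hS hex heq] [x x0].
pose d k := delta (gmap (gi_system P) k); pose mu k := multiplicity (gmap (gi_system P) k).
have lift k m n : (k <= m)%N -> exists n', h m n' = h k n.
  move=> /subnK <-; elim: (m - k)%N => [|i [n' IH]]; first by exists n.
  by exists (d (i + k)%N * n'); exact: etrans (hS _ _) IH.
have [k0 [n0 hx]] := hex x; have [k1 g1] := gi_unital P.
pose K := maxn k0 k1.
(* The nonzero element comes from level [k0], so a vanishing [delta] at a later level would kill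
   it. *)
have dK k : (K <= k)%N -> d k != 0.
  move=> /(leq_trans (leq_maxl k0 k1)) kk; apply: contraNneq x0 => dk0.
  have [n hn] := lift _ _ n0 kk.
  by rewrite -hx -hn -hS -/(d k) dk0 mul0r raddf0.
have {}g1 k : (K <= k)%N -> @gi_map _ _ _ _ _ P k 1%:M = 1 /\ gmap (gi_system P) k 1%:M = 1%:M.
  by move=> /(leq_trans (leq_maxr k0 k1)); exact: g1.
have [T [P1 P2 sE dE]] := gi_balanced_tower_exists g1 dK.
have hI k : injective (h (k + K)%N).
  move=> a b /heq[m]; elim: m => [|m IH] //= /mulfI; rewrite -/(d _) => inj.
  by apply/IH/inj/dK; rewrite addnA leq_addl.
have hE y : exists k n, h (k + K)%N n = y.
  have [k [n <-]] := hex y; exists k; exact: lift (leq_addr _ _).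
have dle j : (absz (d (j + K)%N) <= mu (j + K)%N)%N.
  have [_ f1] := g1 _ (leq_addl j K).
  rewrite /mu (rigid_multiplicity (@gsize_gt0 _ _ _) f1).
  exact: rigid_delta_le.
have sK := cvg_shifted_products (fun k => (absz (d k))%:R / (mu k)%:R : R) K.
split=> [/sK hk|hk].
  exact: (Out_iso_Aut P1 P2 (fun j => dK _ (leq_addl j K)) sE dE
    (h := fun j => h (j + K)%N) (fun j => hS (j + K)%N) hE hI hk).
apply: (Out_iso_Z2 P1 P2 dle sE dE) => /sK; exact: hk.
Qed.
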